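(* Let $(V,\omega)$ be a vertex operator algebra and $g$ an automorphism of $V$ of finite order $T$. There exists a bijection between the (isomorphism classes of) irreducible admissible $g$-twisted $V$-modules and the (isomorphism classes of) irreducible $(1/T)\mathbb N$-graded $g$-twisted $\phi$-coordinated $V$-modules.
   Context: A vertex operator algebra $(V,Y,\mathbf 1,\omega)$ is a vertex algebra with $V=\bigoplus_{n\in\mathbb Z}V_n$, $\dim V_n<\infty$, $V_n=0$ for $n\ll0$, $\omega\in V_2$, $L(m)=\omega_{m+1}$ satisfying the Virasoro relations, $L(0)|_{V_n}=n$, $Y(L(-1)w,z)=\frac d{dz}Y(w,z)$; $\mathrm{wt}\,u=n$ for $u\in V_n$. An automorphism $g$ is a vertex algebra automorphism with $g\omega=\omega$; $V^r=\{v:gv=e^{-2\pi\sqrt{-1}r/T}v\}$. A weak $g$-twisted $V$-module is a vector space $M$ with $Y_M(u,z)=\sum_{n\in r/T+\mathbb Z}u_nz^{-n-1}$ for $u\in V^r$ (extended linearly) such that $Y_M(\mathbf 1,z)=\mathrm{id}_M$, $u_{r/T+n}w=0$ for $n\gg0$, and for $u\in V^r$, $v\in V$: $z_0^{-1}\delta(\frac{z_1-z_2}{z_0})Y_M(u,z_1)Y_M(v,z_2)-z_0^{-1}\delta(\frac{z_2-z_1}{-z_0})Y_M(v,z_2)Y_M(u,z_1)=z_2^{-1}(\frac{z_1-z_0}{z_2})^{-r/T}\delta(\frac{z_1-z_0}{z_2})Y_M(Y(u,z_0)v,z_2)$. An admissible $g$-twisted $V$-module is a weak one with a grading $M=\bigoplus_{n\in(1/T)\mathbb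 N}M(n)$ such that $v_mM(n)\subseteq M(n+\mathrm{wt}v-m-1)$ for homogeneous $v$; irreducible means nonzero with no graded (admissible) submodules other than $0$ and itself (with the convention $M(0)\neq0$). A $g$-twisted $\phi$-coordinated $V$-module is a vector space $W$ with a linear map $Y_W(\cdot,x):V\to\mathrm{Hom}(W,W((x^{1/T})))$, $Y_W(v,x)=\sum_{n\in(1/T)\mathbb Z}v_nx^{-n-1}$, with (i) $Y_W(\mathbf 1,x)=\mathrm{id}_W$; (ii) $Y_W(gv,x)=\lim_{x^{1/T}\to\omega_T^{-1}x^{1/T}}Y_W(v,x)$, $\omega_T=e^{-2\pi\sqrt{-1}/T}$; (iii) for $u,v$ there is $k\in\mathbb N$ with $(x_1-x_2)^kY_W(u,x_1)Y_W(v,x_2)\in\mathrm{Hom}(W,W((x_1^{1/T},x_2^{1/T})))$ and $x_2^k(e^{x_0}-1)^kY_W(Y(u,x_0)v,x_2)=\big((x_1-x_2)^kY_W(u,x_1)Y_W(v,x_2)\big)|_{x_1^{1/T}=(x_2e^{x_0})^{1/T}}$. It is $(1/T)\mathbb N$-graded if $W=\bigoplus_{n\in(1/T)\mathbb N}W(n)$ with $v_mW(n)\subseteq W(n-m-1)$ for all $v\in V$; nonzero graded modules are assumed to have $W(0)\ne0$; irreducible means nonzero with no submodules other than $0$ and itself. *)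

(* Defs.v *)
From HB Require Import structures.
From mathcomp Require Import all_boot all_order all_algebra.
From mathcomp Require Import complex.
From mathcomp Require Import reals trigo.
Set Implicit Arguments. Unset Strict Implicit. Unset Printing Implicit Defensive.
Import Order.TTheory GRing.Theory Num.Theory.
Local Open Scope ring_scope.

(* Conventions.  The ground field is C := R[i] for an arbitrary        *)
(* R : realType (every realType is isomorphic to the real numbers, so  *)
(* R[i] is the field of complex numbers).                              *)
(* All formal-series identities are written coefficientwise.  A mode   *)
(* index k : int of a twisted / phi-coordinated vertex operator stands *)
(* for the exponent k/T, i.e.  Y_M(v,z) = sum_k (YM v k) z^(-k/T - 1). *)

Section Defs.
Variable R : realType.
Local Notation C := (R[i]).

Definition binc (q : C) (i : nat) : C :=
  (\prod_(j < i) (q - j%:R)) / (i`!)%:R.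
Definition binz (m : int) (i : nat) : C := binc (m%:~R) i.

(* equality of two sums over i : nat of (finitely supported) families:
   all sufficiently long partial sums agree *)
Definition nsum_eq (U : zmodType) (f g : nat -> U) : Prop :=
  exists K0 : nat, forall K : nat, (K0 <= K)%N ->
    \sum_(i < K) f i = \sum_(i < K) g i.

(* omega_T = exp(-2 pi sqrt(-1) / T) *)
Definition omegaT (T : nat) : C :=
  Complex (cos (2 * pi / T%:R)) (- sin (2 * pi / T%:R)).

Definition is_subspace (U : lmodType C) (P : U -> Prop) : Prop :=
  P 0 /\ forall (a : C) (x y : U), P x -> P y -> P (a *: x + y).

Definition is_direct_grading (I : eqType) (U : lmodType C) (G : I -> U -> Prop)
  : Prop :=
  (forall n, is_subspace (G n)) /\
  (forall x : U, exists s : seq (I * U),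
      uniq (map fst s) /\ (forall p, p \in s -> G p.1 p.2) /\
      x = \sum_(p <- s) p.2) /\
  (forall s : seq (I * U),
      uniq (map fst s) -> (forall p, p \in s -> G p.1 p.2) ->
      \sum_(p <- s) p.2 = 0 -> forall p, p \in s -> p.2 = 0).

Definition fin_dim (U : lmodType C) (P : U -> Prop) : Prop :=
  exists s : seq U, (forall x, x \in s -> P x) /\
    forall v, P v -> exists c : nat -> C, v = \sum_(i < size s) c i *: s`_i.

(* Y u n v = u_n v ;  wt n = V_n ;  cc = central charge *)
Definition is_VOA (V : lmodType C) (Y : V -> int -> V -> V) (vac om : V)
  (wt : int -> V -> Prop) : Prop :=
  (forall (a : C) u u' n v, Y (a *: u + u') n v = a *: Y u n v + Y u' n v) /\
  (forall u n (a : C) v v', Y u n (a *: v + v') = a *: Y u n v + Y u n v') /\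
  (forall u v, exists N : int, forall n, N <= n -> Y u n v = 0) /\
  (* vacuum property Y(1,z) = id *)
  (forall n v, Y vac n v = if n == -1 then v else 0) /\
  (* creation property: Y(v,z)1 in V[[z]], Y(v,z)1|_{z=0} = v *)
  (forall v n, 0 <= n -> Y v n vac = 0) /\
  (forall v, Y v (-1) vac = v) /\
  (* Jacobi identity, coefficientwise (Borcherds identity) *)
  (forall u v w (l m n : int),
     nsum_eq (fun i => binz m i *: Y (Y u (l + i%:Z) v) (m + n - i%:Z) w)
             (fun i => ((-1) ^+ i * binz l i) *:
                 (Y u (m + l - i%:Z) (Y v (n + i%:Z) w)
                  - ((-1 : C) ^ l) *: Y v (n + l - i%:Z) (Y u (m + i%:Z) w)))) /\
  is_direct_grading wt /\
  (forall n, fin_dim (wt n)) /\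
  (exists N : int, forall n v, n < N -> wt n v -> v = 0) /\
  wt 2 om /\
  (exists cc : C, forall (m n : int) v,
      Y om (m + 1) (Y om (n + 1) v) - Y om (n + 1) (Y om (m + 1) v) =
      (m - n)%:~R *: Y om (m + n + 1) v +
      (if m + n == 0 then ((m ^+ 3 - m)%:~R / 12%:R) * cc else 0) *: v) /\
  (forall n v, wt n v -> Y om 1 v = n%:~R *: v) /\
  (forall w (n : int) x, Y (Y om 0 w) n x = - (n%:~R *: Y w (n - 1) x)).

Definition is_VOA_aut (V : lmodType C) (Y : V -> int -> V -> V) (om : V)
  (g : V -> V) : Prop :=
  (forall (a : C) x y, g (a *: x + y) = a *: g x + g y) /\
  bijective g /\
  (forall u n v, g (Y u n v) = Y (g u) n (g v)) /\
  g om = om.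

Definition has_order (V : Type) (g : V -> V) (T : nat) : Prop :=
  (0 < T)%N /\ (forall v, iter T g v = v) /\
  (forall k : nat, (0 < k < T)%N -> exists v, iter k g v <> v).

Definition eigsp (V : lmodType C) (g : V -> V) (T : nat) (r : nat) (v : V) :=
  g v = omegaT T ^+ r *: v.

Definition mod_isom (V : Type) (M M' : lmodType C)
  (YM : V -> int -> M -> M) (YM' : V -> int -> M' -> M') : Prop :=
  exists f : M -> M',
    (forall (a : C) x y, f (a *: x + y) = a *: f x + f y) /\ bijective f /\
    (forall v k x, f (YM v k x) = YM' v k (f x)).

Definition is_submodule (V : Type) (M : lmodType C) (YM : V -> int -> M -> M)
  (N : M -> Prop) : Prop :=
  is_subspace N /\ forall v k x, N x -> N (YM v k x).

Section Twisted.
Variables (V : lmodType C) (Y : V -> int -> V -> V) (vac om : V)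
  (wt : int -> V -> Prop) (g : V -> V) (T : nat).

Definition is_weak_twisted (M : lmodType C) (YM : V -> int -> M -> M) : Prop :=
  (forall (a : C) u u' k x, YM (a *: u + u') k x = a *: YM u k x + YM u' k x) /\
  (forall u k (a : C) x y, YM u k (a *: x + y) = a *: YM u k x + YM u k y) /\
  (* for u in V^r, Y_M(u,z) only involves z^{-n-1}, n in r/T + Z *)
  (forall (r : nat) u (k : int) x, (r < T)%N -> eigsp g T r u ->
      (k %% T%:Z)%Z != r%:Z -> YM u k x = 0) /\
  (* Y_M(1,z) = id_M *)
  (forall k x, YM vac k x = if k == - T%:Z then x else 0) /\
  (forall (r : nat) u x, (r < T)%N -> eigsp g T r u ->
      exists N : int, forall k, N <= k -> YM u k x = 0) /\
  (* twisted Jacobi identity, coefficientwise: Res_{z0} z0^l Res_{z1} z1^m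
     Res_{z2} z2^n with l in Z, m = a/T in r/T + Z, n = b/T *)
  (forall (r : nat) u v x (l a b : int), (r < T)%N -> eigsp g T r u ->
      (a %% T%:Z)%Z = r%:Z ->
      nsum_eq
        (fun i => binc (a%:~R / T%:R) i *:
                    YM (Y u (l + i%:Z) v) (a + b - T%:Z * i%:Z) x)
        (fun i => ((-1) ^+ i * binz l i) *:
            (YM u (a + T%:Z * (l - i%:Z)) (YM v (b + T%:Z * i%:Z) x)
             - ((-1 : C) ^ l) *:
                 YM v (b + T%:Z * (l - i%:Z)) (YM u (a + T%:Z * i%:Z) x)))).

(* M(k/T) = gr k ; extended by 0 to negative indices *)
Definition grZ (M : lmodType C) (gr : nat -> M -> Prop) (e : int) (x : M) :=
  match e with Posz k => gr k x | Negz _ => x = 0 end.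

Definition is_admissible (M : lmodType C) (YM : V -> int -> M -> M)
  (gr : nat -> M -> Prop) : Prop :=
  is_weak_twisted YM /\ is_direct_grading gr /\
  (* v_m M(n) in M(n + wt v - m - 1), with m = j/T, n = k/T *)
  (forall (d : int) v (j : int) (k : nat) x, wt d v -> gr k x ->
      grZ gr (k%:Z + T%:Z * d - j - T%:Z) (YM v j x)).

Definition is_graded_submodule (M : lmodType C) (YM : V -> int -> M -> M)
  (gr : nat -> M -> Prop) (N : M -> Prop) : Prop :=
  is_submodule YM N /\
  forall x, N x -> exists s : seq (nat * M),
      uniq (map fst s) /\ (forall p, p \in s -> gr p.1 p.2 /\ N p.2) /\
      x = \sum_(p <- s) p.2.

Definition is_irr_admissible (M : lmodType C) (YM : V -> int -> M -> M)
  (gr : nat -> M -> Prop) : Prop :=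
  is_admissible YM gr /\
  (exists x : M, gr 0%N x /\ x <> 0) /\
  (forall N : M -> Prop, is_graded_submodule YM gr N ->
      (forall x, N x -> x = 0) \/ (forall x, N x)).

(* coefficient of x1^{-A/T-1} x2^{-B/T-1} in
   (x1 - x2)^K Y_W(u,x1) Y_W(v,x2) w *)
Definition phi_prod (W : lmodType C) (YW : V -> int -> W -> W) (K : nat)
  (u v : V) (w : W) (A B : int) : W :=
  \sum_(i < K.+1) (('C(K, i))%:R * (-1) ^+ i) *:
     YW u (A + T%:Z * (K%:Z - i%:Z)) (YW v (B + T%:Z * i%:Z) w).

(* coefficient of x0^s in (e^{x0} - 1)^K *)
Definition expm1_pow_coef (K s : nat) : C :=
  (\sum_(i < K.+1) (('C(K, i))%:R * (-1) ^+ (K - i) * (i%:R) ^+ s)) / (s`!)%:R.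

Definition is_phi_coordinated (W : lmodType C) (YW : V -> int -> W -> W) : Prop :=
  (forall (a : C) u u' k x, YW (a *: u + u') k x = a *: YW u k x + YW u' k x) /\
  (forall u k (a : C) x y, YW u k (a *: x + y) = a *: YW u k x + YW u k y) /\
  (* Y_W(v,x) in Hom(W, W((x^{1/T}))) *)
  (forall v x, exists N : int, forall k, N <= k -> YW v k x = 0) /\
  (forall k x, YW vac k x = if k == - T%:Z then x else 0) /\
  (* (ii) Y_W(gv,x) = Y_W(v,x)|_{x^{1/T} -> omega_T^{-1} x^{1/T}} *)
  (forall v k x, YW (g v) k x = (omegaT T ^ k) *: YW v k x) /\
  (forall u v : V, exists K : nat, forall w : W,
     (* (x1-x2)^K Y_W(u,x1)Y_W(v,x2) w in W((x1^{1/T}, x2^{1/T})) *)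
     (exists N : int, forall A B : int, (N <= A \/ N <= B) ->
         phi_prod YW K u v w A B = 0) /\
     (* coefficient of x0^t x2^{-c/T-1} of
        x2^K (e^{x0}-1)^K Y_W(Y(u,x0)v,x2) w  and of
        ((x1-x2)^K Y_W(u,x1)Y_W(v,x2) w)|_{x1^{1/T} = x2^{1/T} e^{x0/T}} *)
     (forall t c : int, exists M0 : nat, forall M : nat, (M0 <= M)%N ->
         \sum_(s < M) expm1_pow_coef K s *:
             YW (Y u (s%:Z - t - 1) v) (c + K%:Z * T%:Z) w
         = match t with
           | Negz _ => 0
           | Posz t' =>
             \sum_(i < 2 * M)
               (((- ((i%:Z - M%:Z) + T%:Z))%:~R / T%:R) ^+ t' / (t'`!)%:R) *:
               phi_prod YW K u v w (i%:Z - M%:Z) (c - T%:Z - (i%:Z - M%:Z))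
           end)).

Definition is_graded_phi (W : lmodType C) (YW : V -> int -> W -> W)
  (gr : nat -> W -> Prop) : Prop :=
  is_phi_coordinated YW /\ is_direct_grading gr /\
  (* v_m W(n) in W(n - m - 1), with m = j/T, n = k/T *)
  (forall v (j : int) (k : nat) x, gr k x ->
      grZ gr (k%:Z - j - T%:Z) (YW v j x)) /\
  ((exists x : W, x <> 0) -> exists x : W, gr 0%N x /\ x <> 0).

Definition is_irr_graded_phi (W : lmodType C) (YW : V -> int -> W -> W)
  (gr : nat -> W -> Prop) : Prop :=
  is_graded_phi YW gr /\
  (exists x : W, x <> 0) /\
  (forall N : W -> Prop, is_submodule YW N ->
      (forall x, N x -> x = 0) \/ (forall x, N x)).

End Twisted.

Record gmod (V : Type) := GMod {
  gm_car : lmodType C;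
  gm_Y : V -> int -> gm_car -> gm_car;
  gm_gr : nat -> gm_car -> Prop }.

Definition gmod_isom (V : Type) (M M' : gmod V) : Prop :=
  mod_isom (@gm_Y V M) (@gm_Y V M').

End Defs.

(* Main.v *)
(** Zhu's operators [Y[u, x] = Y(e^(x L(0)) u, e^x - 1)] form a second vertex algebra structure
    on V, and [Phi] intertwines the two structures: [Phi (Y(u, x) v) = Y[Phi u, x] Phi v].
    Here [Phi] solves a flow equation in the operators L(1), L(2), ..., and the intertwining
    property is proved weight by weight because both sides satisfy the same recursion.  It is
    unipotent for the weight filtration, hence bijective, and it commutes with g.

    If Y_M is a g-twisted module structure, then [Y_W(v, x) = Y_M(x^(L(0)) Phi v, x)] is
    phi-coordinated, and Y_M is recovered from Y_W.  Both the twisted Jacobi identity and the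
    phi-coordinated axiom are equivalent to weak associativity: in the coordinate
    [y = e^x0 - 1] the latter says that the modes of u_j v are the binomial moments of the finitely
    supported coefficients of [(x1 - x2)^K Y(u, x1) Y(v, x2)].  Commutativity, which the
    phi-coordinated axiom does not mention, comes from skew symmetry because moments determine
    finitely supported families.

    The two notions of irreducibility differ: one concerns graded submodules, the other all
    submodules.  On an irreducible admissible module [L(0) - deg] commutes with all modes, so it
    is a scalar by Dixmier's argument (countable dimension over an uncountable field), and
    therefore every submodule is graded. *)

Require Import Defs.
From HB Require Import structures.
From mathcomp Require Import all_boot all_order all_algebra.
From mathcomp Require Import complex.
From mathcomp Require Import boolp classical_sets reals trigo.
From mathcomp Require Import ring lra zify.
Set Implicit Arguments. Unset Strict Implicit. Unset Printing Implicit Defensive.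
Import Order.TTheory GRing.Theory Num.Theory.
Local Open Scope ring_scope.

(** * Finitely supported sums *)

(** The change of coordinate behind Zhu's structure is [z |-> e^z - 1]. It is joined to the identity
    by [z_t = (e^(tz) - 1) / t]; with [y = t z_t] its velocity is [((1 + y) log (1 + y) - y) / t^2],
    the sum of the [gam j t^j z_t^(j+2)]. The field [z^(j+2) d/dz] corresponds to [L(j+1)], which
    lowers weights by [j + 1], so the power of [t] equals the drop in weight. The flow thus becomes
    a recursion on this drop, and at [t = 1] it is a finite sum on each vector because weights are
    bounded below. The same series is expanded in powers of [x0] by the phi-coordinated axiom and in
    powers of [y = e^x0 - 1] by weak associativity. The two are compared through the series
    [e^(hx) (e^x - 1)^M], which are triangular in [M]. Twisting by [x^(L(0))] moves mode indices by
    [T] times an integral weight, hence preserves them modulo [T]; this is why condition (ii)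
    matches the support condition of twisted modules. *)

Section FiniteSums.
Variables (I : eqType) (U : zmodType).
Implicit Types (F G : I -> U) (S : seq I).

Definition suppin F S := forall i, i \notin S -> F i = 0.
Definition finsupp F := exists S, suppin F S.

(** Total: the value is 0 on a family without finite support, so identities can be stated without
    carrying a proof of finiteness. *)
Definition fsum F : U :=
  match pselect (finsupp F) with
  | left e => \sum_(i <- undup (projT1 (cid e))) F i
  | right _ => 0
  end.

Lemma sum_suppin F S S' : uniq S -> uniq S' -> suppin F S -> suppin F S' ->
  \sum_(i <- S) F i = \sum_(i <- S') F i.
Proof.
move=> uS uS' sS sS'.
have aux A B : suppin F B -> \sum_(i <- A) F i = \sum_(i <- [seq x <- A | x \in B]) F i.
  move=> sB; rewrite big_filter [LHS](bigID (fun x => x \in B)) /=.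
  by rewrite [X in _ + X]big1 ?addr0 // => i /sB.
rewrite (aux _ _ sS') (aux S' _ sS); apply: perm_big.
by apply: uniq_perm; rewrite ?filter_uniq // => x; rewrite !mem_filter andbC.
Qed.

Lemma fsumE F S : uniq S -> suppin F S -> fsum F = \sum_(i <- S) F i.
Proof.
move=> uS sS; rewrite /fsum; case: pselect => [e|]; last by case; exists S.
apply: sum_suppin; rewrite ?undup_uniq //.
by move=> i; rewrite mem_undup; apply: (projT2 (cid e)).
Qed.

Lemma suppin_undup F S : suppin F S -> suppin F (undup S).
Proof. by move=> sS i; rewrite mem_undup; apply: sS. Qed.

Lemma suppin_catl F S S' : suppin F S -> suppin F (S ++ S').
Proof. by move=> sS i; rewrite mem_cat negb_or => /andP[/sS]. Qed.

Lemma suppin_catr F S S' : suppin F S' -> suppin F (S ++ S').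
Proof. by move=> sS i; rewrite mem_cat negb_or => /andP[_ /sS]. Qed.

Lemma eq_fsum F G : F =1 G -> fsum F = fsum G.
Proof. by move=> /funext ->. Qed.

Lemma fsum0 F : (forall i, F i = 0) -> fsum F = 0.
Proof. by move=> F0; rewrite (@fsumE F [::]) ?big_nil // => i _; apply: F0. Qed.

Lemma fsum1 F j : (forall i, i != j -> F i = 0) -> fsum F = F j.
Proof.
move=> Fj; rewrite (@fsumE F [:: j]) ?big_seq1 //.
by move=> i; rewrite inE; apply: Fj.
Qed.

Lemma finsuppD F G : finsupp F -> finsupp G -> finsupp (fun i => F i + G i).
Proof.
move=> [S sS] [S' sS']; exists (S ++ S') => i iN.
by rewrite (@suppin_catl F S S' sS) // (@suppin_catr G S S' sS') // addr0.
Qed.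

Lemma fsumD F G : finsupp F -> finsupp G ->
  fsum (fun i => F i + G i) = fsum F + fsum G.
Proof.
move=> [S sS] [S' sS'].
have u := undup_uniq (S ++ S').
rewrite (@fsumE F _ u) ?(@fsumE G _ u) -?big_split /=;
  try exact: suppin_undup (@suppin_catl F S S' sS);
  try exact: suppin_undup (@suppin_catr G S S' sS').
apply: fsumE => // i iN.
by rewrite (suppin_undup (@suppin_catl F S S' sS)) // (suppin_undup
  (@suppin_catr G S S' sS')) // addr0.
Qed.

End FiniteSums.

Lemma fsum_morph (I : eqType) (U W : zmodType) (f : U -> W) (F : I -> U) :
  f 0 = 0 -> {morph f : x y / x + y} -> finsupp F ->
  f (fsum F) = fsum (fun i => f (F i)).
Proof.
move=> f0 fD [S sS].
rewrite (fsumE (undup_uniq S) (suppin_undup sS)) (big_morph f fD f0).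
symmetry; apply: fsumE; rewrite ?undup_uniq // => i.
by rewrite mem_undup => /sS ->.
Qed.

Lemma finsupp_morph (I : eqType) (U W : zmodType) (f : I -> U -> W) (F : I -> U) :
  (forall i, f i 0 = 0) -> finsupp F -> finsupp (fun i => f i (F i)).
Proof. by move=> f0 [S sS]; exists S => i /sS ->. Qed.

Lemma fsum_reindex (I J : eqType) (U : zmodType) (h : J -> I) (F : I -> U) :
  injective h -> finsupp (F \o h) -> (forall i, F i <> 0 -> exists j, i = h j) ->
  fsum F = fsum (fun j => F (h j)).
Proof.
move=> hinj [S sS] him.
rewrite (@fsumE _ _ (fun j => F (h j)) (undup S)) ?undup_uniq //; last exact: (suppin_undup sS).
rewrite (@fsumE _ _ F (map h (undup S))) ?map_inj_uniq ?undup_uniq ?big_map // => i iN.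
apply: contrapT => Fi; have [j ij] := him _ Fi.
by apply: Fi; rewrite ij; apply: sS; apply: contra iN => jS; rewrite ij map_f ?mem_undup.
Qed.

Lemma fsum_nat (U : zmodType) (F : nat -> U) K :
  (forall i, (K <= i)%N -> F i = 0) -> fsum F = \sum_(i < K) F i.
Proof.
move=> F0; rewrite (@fsumE _ _ F (iota 0 K)) ?iota_uniq //.
  by rewrite -(big_mkord predT F) /index_iota subn0.
by move=> i; rewrite mem_iota add0n leq0n /= -leqNgt; apply: F0.
Qed.

Lemma finsupp_nat (U : zmodType) (F : nat -> U) K :
  (forall i, (K <= i)%N -> F i = 0) -> finsupp F.
Proof.
move=> F0; exists (iota 0 K) => i.
by rewrite mem_iota add0n leq0n /= -leqNgt; apply: F0.
Qed.

Definition zrange M : seq int := [seq i%:Z - M%:Z | i <- iota 0 (2 * M)].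

Lemma zrange_uniq M : uniq (zrange M).
Proof. by rewrite map_inj_uniq ?iota_uniq // => i j; lia. Qed.

Lemma mem_zrange M A : (A \in zrange M) = (- M%:Z <= A < M%:Z).
Proof.
apply/mapP/idP => [ [k]|h]; first by rewrite mem_iota => h ->; lia.
exists (absz (A + M%:Z)); rewrite ?mem_iota; lia.
Qed.

Lemma fsum_int (U : zmodType) (F : int -> U) M :
  (forall A, A < - M%:Z \/ M%:Z <= A -> F A = 0) ->
  fsum F = \sum_(i < 2 * M) F (i%:Z - M%:Z).
Proof.
move=> F0; rewrite (fsumE (zrange_uniq M)); last first.
  move=> A; rewrite mem_zrange => AN; apply: F0; lia.
by rewrite big_map -(big_mkord predT (fun i => F (i%:Z - M%:Z))) /index_iota subn0.
Qed.

Lemma finsupp_int (U : zmodType) (F : int -> U) (a b : int) :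
  (forall A, A < a \/ b <= A -> F A = 0) -> finsupp F.
Proof.
move=> F0; exists (zrange (absz a + absz b)) => A; rewrite mem_zrange => AN.
apply: F0; lia.
Qed.

Lemma fsum_int_large (U : zmodType) (F : int -> U) (a b : int) :
  (forall A, A < a \/ b <= A -> F A = 0) ->
  exists M0, forall M, (M0 <= M)%N -> \sum_(i < 2 * M) F (i%:Z - M%:Z) = fsum F.
Proof.
move=> F0; exists (absz a + absz b)%N => M hM; symmetry; apply: fsum_int => A hA.
apply: F0; lia.
Qed.

(** * Consequences of linearity given as an equation *)

Section LinearMaps.
Variables (K : pzRingType) (U W : lmodType K) (f : U -> W).
Hypothesis fL : forall a x y, f (a *: x + y) = a *: f x + f y.

Lemma lin_D x y : f (x + y) = f x + f y.
Proof. by have := fL 1 x y; rewrite !scale1r. Qed.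
Lemma lin_0 : f 0 = 0.
Proof. by apply: (@addrI _ (f 0)); rewrite -lin_D !addr0. Qed.
Lemma lin_Z a x : f (a *: x) = a *: f x.
Proof. by have := fL a x 0; rewrite lin_0 !addr0. Qed.
Lemma lin_N x : f (- x) = - f x.
Proof. by rewrite -scaleN1r lin_Z scaleN1r. Qed.
Lemma lin_B x y : f (x - y) = f x - f y.
Proof. by rewrite lin_D lin_N. Qed.
Lemma lin_sum (I : Type) (r : seq I) (P : pred I) F :
  f (\sum_(i <- r | P i) F i) = \sum_(i <- r | P i) f (F i).
Proof. exact: (big_morph f lin_D lin_0). Qed.
Lemma lin_fsum (I : eqType) (F : I -> U) : finsupp F -> f (fsum F) = fsum (fun i => f (F i)).
Proof. exact: fsum_morph lin_0 lin_D. Qed.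
End LinearMaps.

Lemma scalerLin (K : comPzRingType) (U : lmodType K) (c : K) a (x y : U) :
  c *: (a *: x + y) = a *: (c *: x) + c *: y.
Proof. by rewrite scalerDr !scalerA mulrC. Qed.

Lemma fsumZ (K : comPzRingType) (I : eqType) (U : lmodType K) (c : K) (F : I -> U) :
  finsupp F -> fsum (fun i => c *: F i) = c *: fsum F.
Proof. by move=> fF; rewrite (lin_fsum (scalerLin c)). Qed.

Lemma finsuppZ (K : pzRingType) (I : eqType) (U : lmodType K) (c : I -> K) (F : I -> U) :
  finsupp F -> finsupp (fun i => c i *: F i).
Proof. by apply: (finsupp_morph (f := fun i x => c i *: x)) => i; rewrite scaler0. Qed.

(** * Binomial coefficients and power series *)

Section Binomials.
Variable R : realType.
Local Notation C := (R[i]).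
Implicit Types (q x y : C).

Lemma binc0 q : binc q 0 = 1.
Proof. by rewrite /binc big_ord0 divr1. Qed.

Lemma natf_neq0 (n : nat) : (n.+1%:R : C) != 0.
Proof. by rewrite pnatr_eq0. Qed.

Lemma factf_neq0 (n : nat) : (n`!%:R : C) != 0.
Proof. by rewrite pnatr_eq0 -lt0n fact_gt0. Qed.

Lemma bincS q i : binc q i.+1 = binc q i * (q - i%:R) / i.+1%:R.
Proof.
rewrite /binc big_ord_recr /= factS natrM.
move: (factf_neq0 i) (natf_neq0 i); move: (i`!%:R : C) (i.+1%:R : C) => a b h1 h2.
by field; rewrite h1 h2.
Qed.

Lemma binc_nat (n i : nat) : binc (n%:R : C) i = ('C(n, i))%:R.
Proof.
elim: i => [|i IH]; first by rewrite binc0 bin0.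
rewrite bincS IH; apply: (mulIf (natf_neq0 i)); rewrite divfK ?natf_neq0 //.
have [le_in|lt_ni] := leqP i n.
  by rewrite -natrB // -!natrM [in RHS]mulnC mul_bin_left mulnC.
by rewrite !bin_small ?mul0r // ltnW.
Qed.

Lemma binc0S i : binc (0 : C) i.+1 = 0.
Proof. by rewrite (binc_nat 0). Qed.

Lemma binc_pascal q i : binc (q + 1) i.+1 = binc q i.+1 + binc q i.
Proof.
elim: i => [|i IH]; first by rewrite !bincS !binc0 /=; field.
rewrite bincS IH [binc q i.+2]bincS.
have := bincS q i; have := natf_neq0 i; have := natf_neq0 i.+1 => h1 h2.
move=> e; have {}e : binc q i * (q - i%:R) = binc q i.+1 * i.+1%:R by rewrite e divfK.
have -> : (q + 1 - i.+1%:R) = q - i%:R by rewrite -[i.+1%:R]natr1; ring.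
rewrite mulrDl e -[i.+2%:R]natr1 -[i.+1%:R]natr1.
by field; rewrite !natr1.
Qed.

Lemma binc_opp q i : binc (- q - 1) i = (-1) ^+ i * binc (q + i%:R) i.
Proof.
elim: i q => [|i IH] q; first by rewrite !binc0 mulr1.
have e x : binc (x + 1) i.+1 = binc x i * (x + 1) / i.+1%:R.
  rewrite binc_pascal bincS; have := natf_neq0 i; rewrite -natr1 => h.
  by field.
rewrite bincS IH -[i.+1%:R]natr1 addrA e exprS.
by have := natf_neq0 i; rewrite -natr1 => h; field.
Qed.

(** Induction on [n]: the new factor [x + y - n] is [(x - i) + (y - (n - i))], and each half raises
    one of the two lower indices. *)
Lemma binc_Vandermonde x y n :
  binc (x + y) n = \sum_(i < n.+1) binc x i * binc y (n - i).
Proof.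
elim: n => [|n IH]; first by rewrite big_ord_recl big_ord0 subnn !binc0 addr0 mulr1.
rewrite bincS IH mulr_suml.
have e (i : 'I_n.+1) : binc x i * binc y (n - i) * (x + y - n%:R) =
   binc x i.+1 * i.+1%:R * binc y (n - i) + binc x i * (binc y (n - i).+1 * (n - i).+1%:R).
  rewrite !bincS !divfK ?natf_neq0 // natrB; last by rewrite -ltnS.
  ring.
under eq_bigr do rewrite e.
rewrite big_split /= -[RHS](mulfK (natf_neq0 n)); congr (_ / _).
rewrite mulr_suml.
under [RHS]eq_bigr => i _.
  have -> : binc x i * binc y (n.+1 - i) * n.+1%:R =
    binc x i * i%:R * binc y (n.+1 - i) + binc x i * (binc y (n.+1 - i) * (n.+1 - i)%:R).
    by rewrite natrB; [ring | rewrite -ltnS].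
  over.
rewrite big_split /= [X in _ = X + _]big_ord_recl mulr0 mul0r add0r.
rewrite [X in _ = _ + X]big_ord_recr /= subnn mulr0 mulr0 addr0.
congr (_ + _); apply: eq_bigr => i _; rewrite /bump ?leq0n ?add1n ?subSS //.
by rewrite subSn // -ltnS.
Qed.

Lemma binz_int (m : nat) i : binz R m%:Z i = ('C(m, i))%:R.
Proof. by rewrite /binz -binc_nat. Qed.

End Binomials.

(** * Formal power series and the coefficients of [e^(hx) (e^x - 1)^M] *)

Section PowerSeries.
Variable R : realType.
Local Notation C := (R[i]).

Definition ps := nat -> C.
HB.instance Definition _ := gen_eqMixin ps.
HB.instance Definition _ := gen_choiceMixin ps.

Implicit Types f g : ps.
Definition psadd f g : ps := fun k => f k + g k.
Definition psopp f : ps := fun k => - f k.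
Definition pszero : ps := fun=> 0.
Definition psone : ps := fun k => (k == 0%N)%:R.
Definition psmul f g : ps := fun k => \sum_(i < k.+1) f i * g (k - i)%N.

Fact psaddA : associative psadd.
Proof. by move=> f g h; apply/funext => k; apply: addrA. Qed.
Fact psaddC : commutative psadd.
Proof. by move=> f g; apply/funext => k; apply: addrC. Qed.
Fact psadd0 : left_id pszero psadd.
Proof. by move=> f; apply/funext => k; apply: add0r. Qed.
Fact psaddN : left_inverse pszero psopp psadd.
Proof. by move=> f; apply/funext => k; apply: addNr. Qed.

HB.instance Definition _ := GRing.isZmodule.Build ps psaddA psaddC psadd0 psaddN.

(** Coefficients up to [n] of a product depend only on truncations, so the ring laws are inherited
    from polynomials. *)
Lemma psmul_poly f g (p q : {poly C}) n :
  (forall k, (k <= n)%N -> p`_k = f k) -> (forall k, (k <= n)%N -> q`_k = g k) ->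
  forall k, (k <= n)%N -> (p * q)`_k = psmul f g k.
Proof.
move=> pf qg k kn; rewrite coefM; apply: eq_bigr => j _.
by rewrite pf ?qg //; [rewrite (leq_trans (leq_subr _ _)) | rewrite (leq_trans _ kn) // -ltnS].
Qed.

Definition pstr n f : {poly C} := \poly_(k < n.+1) f k.
Lemma pstrE n f k : (k <= n)%N -> (pstr n f)`_k = f k.
Proof. by move=> kn; rewrite coef_poly ltnS kn. Qed.

Fact psmulA : associative psmul.
Proof.
move=> f g h; apply/funext => n.
have e := @pstrE n.
rewrite -(@psmul_poly _ _ (pstr n f) (pstr n g * pstr n h) n (e f)) ?leqnn //; last first.
  exact: psmul_poly (e g) (e h).
rewrite -(@psmul_poly _ _ (pstr n f * pstr n g) (pstr n h) n _ (e h)) ?leqnn ?mulrA //.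
exact: psmul_poly (e f) (e g).
Qed.
Fact psmulC : commutative psmul.
Proof.
move=> f g; apply/funext => n; have e := @pstrE n.
rewrite -(@psmul_poly _ _ (pstr n f) (pstr n g) n (e f) (e g)) //.
by rewrite mulrC (psmul_poly (e g) (e f)).
Qed.
Fact psmul1 : left_id psone psmul.
Proof.
move=> f; apply/funext => n; rewrite /psmul big_ord_recl /psone eqxx mul1r subn0.
by rewrite big1 ?addr0 // => k _; rewrite mul0r.
Qed.
Fact psmulDl : left_distributive psmul psadd.
Proof.
move=> f g h; apply/funext => n; rewrite /psmul /psadd -big_split /=.
by apply: eq_bigr => k _; rewrite mulrDl.
Qed.
Fact psone_neq0 : psone != 0.
Proof. by apply/eqP => /(congr1 (fun f : ps => f 0%N)); apply/eqP;
  rewrite /psone eqxx oner_eq0. Qed.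

HB.instance Definition _ := GRing.Zmodule_isComNzRing.Build ps
  psmulA psmulC psmul1 psmulDl psone_neq0.

Lemma psD f g k : (f + g) k = f k + g k. Proof. by []. Qed.
Lemma psN f k : (- f) k = - f k. Proof. by []. Qed.
Lemma psM f g k : (f * g) k = \sum_(i < k.+1) f i * g (k - i)%N. Proof. by []. Qed.
Lemma ps1 k : (1 : ps) k = (k == 0%N)%:R. Proof. by []. Qed.
Lemma ps_sum (I : Type) (r : seq I) (P : pred I) (F : I -> ps) k :
  (\sum_(i <- r | P i) F i) k = \sum_(i <- r | P i) F i k.
Proof. by apply: (big_morph (fun f : ps => f k)). Qed.

Lemma eq_psM f f' g n : (forall k, (k <= n)%N -> f k = f' k) -> (f * g) n = (f' * g) n.
Proof. by move=> e; rewrite !psM; apply: eq_bigr => k _; rewrite e // -ltnS. Qed.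

Definition psX : ps := fun k => (k == 1%N)%:R.

Lemma psXM0 f : (psX * f) 0%N = 0.
Proof. by rewrite psM big_ord_recl big_ord0 /psX mul0r addr0. Qed.
Lemma psXMS f k : (psX * f) k.+1 = f k.
Proof.
rewrite psM 2!big_ord_recl /= /psX /= mul0r add0r mul1r big1 ?addr0 ?subn1 //.
by move=> j _; rewrite mul0r.
Qed.

Lemma psX_small f n k : f 0%N = 0 -> (k < n)%N -> (f ^+ n) k = 0.
Proof.
move=> f0; elim: n k => // n IH k kn; rewrite exprS psM big1 // => j _.
have [->|j0] := eqVneq (j : nat) 0%N; first by rewrite f0 mul0r.
rewrite IH ?mulr0 //; have := ltn_ord j; lia.
Qed.

(** Geometric series in [h = 1 - f]; as [h] has no constant term, coefficient [k] is complete after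
    [k + 1] powers. *)
Lemma ps_inv f : f 0%N = 1 -> exists g, f * g = 1.
Proof.
move=> f0; pose h := 1 - f.
have h0 : h 0%N = 0 by rewrite /h psD psN f0 subrr.
exists (fun k => \sum_(n < k.+1) (h ^+ n) k); apply/funext => k.
rewrite mulrC (@eq_psM _ (\sum_(n < k.+1) h ^+ n)); last first.
  move=> j jk; rewrite ps_sum.
  rewrite (big_ord_widen k.+1 (fun n => (h ^+ n) j)) // big_mkcond /=.
  apply: eq_bigr => n _; case: ifP => // /negbT; rewrite -leqNgt => nj.
  by rewrite psX_small.
have -> : (\sum_(n < k.+1) h ^+ n) * f = 1 - h ^+ k.+1.
  have -> : f = - (h - 1) by rewrite /h; ring.
  by rewrite mulrN mulrC -subrX1 opprB.
by rewrite psD psN psX_small // subr0.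
Qed.

(** The Euler operator [x d/dx], a derivation that does not move the index. *)
Definition pstheta f : ps := fun k => k%:R * f k.

Lemma pstheta_M f g : pstheta (f * g) = pstheta f * g + f * pstheta g.
Proof.
apply/funext => k; rewrite psD !psM /pstheta mulr_sumr -big_split /=.
apply: eq_bigr => j _; have jk : (j <= k)%N by rewrite -ltnS.
by rewrite natrB //; ring.
Qed.

Definition psexp (c : C) : ps := fun k => c ^+ k / k`!%:R.

Lemma psexpD c d : psexp (c + d) = psexp c * psexp d.
Proof.
apply/funext => n; rewrite psM /psexp addrC exprDn mulr_suml; apply: eq_bigr => j _.
have jn : (j <= n)%N by rewrite -ltnS.
rewrite -mulr_natr.
have := bin_fact jn => /(congr1 (fun k => k%:R : C)); rewrite !natrM => <-.
move: (factf_neq0 R j) (factf_neq0 R (n - j)).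
have : ('C(n, j)%:R : C) != 0 by rewrite pnatr_eq0 -lt0n bin_gt0.
set a := _%:R; set b := _%:R; set e := _%:R => h1 h2 h3.
by field; rewrite h1 h2 h3.
Qed.

(* [(e^x - 1) / x] *)
Definition psE : ps := fun k => (k.+1`!%:R)^-1.

Lemma psexp1 : psexp 1 = 1 + psX * psE.
Proof.
apply/funext => -[|k]; rewrite psD ps1 /psexp expr1n mul1r.
  by rewrite psXM0 fact0 invr1 addr0.
by rewrite psXMS add0r.
Qed.

Lemma theta_psE : pstheta psE = psexp 1 - psE.
Proof.
apply/funext => k; rewrite psD psN /pstheta /psE /psexp expr1n mul1r factS natrM.
move: (factf_neq0 R k) (natf_neq0 R k); rewrite -natr1; set a := _%:R => h1 h2.
by field; rewrite h1 h2.
Qed.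

Definition psC (c : C) : ps := fun k => if k == 0%N then c else 0.
Lemma psCM c f k : (psC c * f) k = c * f k.
Proof.
rewrite psM big_ord_recl /psC eqxx subn0 big1 ?addr0 // => j _.
by rewrite mul0r.
Qed.

Lemma theta_psexp c : pstheta (psexp c) = psC c * (psX * psexp c).
Proof.
apply/funext => k; rewrite psCM /pstheta /psexp.
case: k => [|k]; first by rewrite psXM0 mul0r mulr0.
rewrite psXMS exprS factS natrM.
move: (factf_neq0 R k) (natf_neq0 R k); move: (k`!%:R : C) (k.+1%:R : C) => a b h1 h2.
by field; rewrite h1 h2.
Qed.

Fact psE0 : psE 0%N = 1. Proof. by rewrite /psE invr1. Qed.
Definition psF : ps := projT1 (cid (ps_inv psE0)).
Lemma psEF : psE * psF = 1. Proof. exact: (projT2 (cid (ps_inv psE0))). Qed.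

Definition psQ (M : int) : ps :=
  match M with Posz n => psE ^+ n | Negz n => psF ^+ n.+1 end.

Lemma psQS M : psQ (M + 1) = psE * psQ M.
Proof.
case: M => n; first by rewrite -PoszD addn1 /= exprS.
case: n => [|n]; first by rewrite /= expr1 psEF.
have -> : Negz n.+1 + 1 = Negz n by lia.
by rewrite /= [psF ^+ n.+2]exprS mulrA psEF mul1r.
Qed.

Lemma psCn_natr (n : nat) : psC n%:R = n%:R.
Proof.
elim: n => [|n IH].
  by apply/funext => k; rewrite /psC; case: ifP.
rewrite -natr1 -[RHS]natr1 -IH; apply/funext => k; rewrite psD ps1 /psC.
by case: k => [|k] //=; rewrite addr0.
Qed.

Lemma psCN c : psC (- c) = - psC c.
Proof. by apply/funext => k; rewrite psN /psC; case: ifP => //; rewrite oppr0. Qed.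

Lemma theta_psX f n : pstheta (f ^+ n.+1) = psC n.+1%:R * (pstheta f * f ^+ n).
Proof.
rewrite psCn_natr; elim: n => [|n IH].
  by rewrite expr1 expr0 mulr1 mul1r.
rewrite exprS pstheta_M IH -[n.+2%:R]natr1 [f ^+ n.+1]exprS.
by move: (pstheta f) (f ^+ n) (n.+1%:R : ps) => a b c; ring.
Qed.

Lemma theta_ps1 : pstheta 1 = 0.
Proof. by apply/funext => -[|k]; rewrite /pstheta ps1 /= ?mul0r ?mulr0. Qed.

Lemma theta_psF : pstheta psF = - (psF * psF * pstheta psE).
Proof.
have := congr1 pstheta psEF; rewrite pstheta_M theta_ps1 => /(congr1 (fun f => psF * f)).
rewrite mulr0 mulrDr [psF * (psE * _)]mulrA [psF * psE]mulrC psEF mul1r.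
by move=> /eqP; rewrite addrC addr_eq0 => /eqP ->; congr (- _); ring.
Qed.

Lemma theta_psQ M : pstheta (psQ M) = psC M%:~R * (pstheta psE * psQ (M - 1)).
Proof.
case: M => n.
  case: n => [|n].
    rewrite /= theta_ps1; apply/funext => k; rewrite psCM mul0r //.
  have -> : n.+1%:Z - 1 = n%:Z by lia.
  by rewrite /= theta_psX.
have -> : Negz n - 1 = Negz n.+1 by lia.
have -> : (Negz n)%:~R = - (n.+1%:R : C) by rewrite NegzE mulrNz.
rewrite /= theta_psX theta_psF psCN !exprS; ring.
Qed.

(* [cf M h k] is the coefficient of [x^k] in [e^(hx) ((e^x - 1)/x)^M] *)
Definition cf (M : int) (h : C) : ps := psexp h * psQ M.

Lemma cf0 M h : cf M h 0%N = 1.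
Proof.
rewrite /cf psM big_ord_recl big_ord0 addr0 subn0 /psexp expr0 fact0 divr1 mul1r.
have e f n : f 0%N = 1 -> (f ^+ n) 0%N = 1 :> C.
  move=> f0; elim: n => [|n IH]; first by [].
  by rewrite exprS psM big_ord_recl big_ord0 addr0 subn0 f0 IH mul1r.
case: M => n /=; rewrite e ?psE0 //.
have := congr1 (fun f : ps => f 0%N) psEF.
by rewrite psM big_ord_recl big_ord0 addr0 subn0 psE0 mul1r.
Qed.

Lemma cf0h h k : cf 0 h k = h ^+ k / k`!%:R.
Proof. by rewrite /cf /= mulr1. Qed.

Lemma cf_exp M h c k : cf M (c + h) k = \sum_(j < k.+1) c ^+ j / j`!%:R * cf M h (k - j)%N.
Proof. by rewrite /cf psexpD -mulrA psM. Qed.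

(** Multiplication of [e^(hx) psE^M] by [e^x = 1 + x psE]. *)
Lemma cf_pascal M h k : cf M (h + 1) k.+1 = cf M h k.+1 + cf (M + 1) h k.
Proof.
rewrite -[cf (M + 1) h k]psXMS -psD; congr (_ k.+1).
have e (a b x y : ps) : a * (1 + x * y) * b = a * b + x * (a * (y * b)) by ring.
by rewrite /cf psexpD psexp1 psQS e.
Qed.

(** The Euler operator applied to [e^(hx) psE^M], using that it sends [psE] to [e^x - psE]. *)
Lemma cf_theta M h k :
  k.+1%:R * cf M h k.+1 = h * cf M h k + M%:~R * (cf (M - 1) (h + 1) k.+1 - cf M h k.+1).
Proof.
have -> : k.+1%:R * cf M h k.+1 = pstheta (cf M h) k.+1 by [].
have <- : (psC h * (psX * cf M h)) k.+1 = h * cf M h k by rewrite psCM psXMS.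
have <- : (psC M%:~R * (cf (M - 1) (h + 1) - cf M h)) k.+1 =
  M%:~R * (cf (M - 1) (h + 1) k.+1 - cf M h k.+1) by rewrite psCM psD psN.
rewrite -psD; congr (_ k.+1).
rewrite /cf pstheta_M theta_psexp theta_psQ theta_psE psexpD.
have e : psQ M = psE * psQ (M - 1) by rewrite -psQS subrK.
rewrite [X in _ = _ + _ * (_ - psexp h * X)]e.
have {}e (a b x y u v w z : ps) : v * (z * a) * x + a * (w * ((b - u) * y)) =
  v * (z * (a * x)) + w * (a * b * y - a * (u * y)) by ring.
exact: e.
Qed.

(* [cf] extended by zero to negative exponents, so that no boundary terms occur. *)
Definition ck (M : int) (h : C) (k : int) : C :=
  match k with Posz k => cf M h k | Negz _ => 0 end.

Lemma ck_neg M h k : k < 0 -> ck M h k = 0.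
Proof. by case: k. Qed.

Lemma ck_0 M h : ck M h 0 = 1.
Proof. exact: cf0. Qed.

Lemma ck_pascal M h k : ck M (h + 1) k = ck M h k + ck (M + 1) h (k - 1).
Proof.
case: k => [[|k]|k]; first by rewrite sub0r /= !cf0 addr0.
  have -> : k.+1%:Z - 1 = k by lia.
  exact: cf_pascal.
have -> : Negz k - 1 = Negz k.+1 by lia.
by rewrite /= addr0.
Qed.

Lemma ck_theta M h k :
  k%:~R * ck M h k = h * ck M h (k - 1) + M%:~R * (ck (M - 1) (h + 1) k - ck M h k).
Proof.
case: k => [[|k]|k]; first by rewrite sub0r /= !cf0 subrr !mulr0 mul0r addr0.
  have -> : k.+1%:Z - 1 = k by lia.
  exact: cf_theta.
have -> : Negz k - 1 = Negz k.+1 by lia.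
by rewrite /= subrr !mulr0 addr0.
Qed.

Lemma ck_exp M h c (k : int) K : k < K%:Z ->
  ck M (c + h) k = \sum_(j < K) c ^+ j / j`!%:R * ck M h (k - j%:Z).
Proof.
case: k => k kK; last first.
  by rewrite big1 //= => j _; rewrite ck_neg ?mulr0 //; lia.
rewrite /= cf_exp (big_ord_widen K (fun j => c ^+ j / j`!%:R * cf M h (k - j)%N)) //.
rewrite big_mkcond /=; apply: eq_bigr => j _; case: ifP => jk.
  by have -> : k%:Z - j%:Z = (k - j)%N by lia.
by rewrite ck_neg ?mulr0 //; lia.
Qed.

Lemma ck_addn M h (n : nat) (k : int) K : k < K%:Z ->
  ck M (h + n%:R) k = \sum_(i < K) binc (n%:R : C) i * ck (M + i%:Z) h (k - i%:Z).
Proof.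
elim: n M k K => [|n IH] M k K kK.
  rewrite addr0; case: K kK => [|K] kK.
    by rewrite big_ord0 ck_neg.
  rewrite big_ord_recl binc0 mul1r big1 ?addr0 ?subr0 // => j _.
  by rewrite binc0S mul0r.
rewrite -natr1 addrA ck_pascal (IH _ _ _ kK).
case: K kK => [|K] kK.
  by rewrite !big_ord0 add0r ck_neg //; lia.
rewrite (IH _ _ K); last by lia.
rewrite [in LHS]big_ord_recl [in RHS]big_ord_recl !binc0 -addrA; congr (_ + _).
rewrite -big_split /=; apply: eq_bigr => j _.
rewrite binc_pascal mulrDl; congr (_ + _); congr (_ * ck _ _ _); rewrite /bump; lia.
Qed.

Definition binp (i : nat) : {poly C} := (i`!%:R)^-1 *: \prod_(j < i) ('X - j%:R%:P).

Lemma horner_binp i c : (binp i).[c] = binc c i.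
Proof.
rewrite /binp /binc hornerZ mulrC horner_prod; congr (_ / _).
by apply: eq_bigr => j _; rewrite hornerXsubC.
Qed.

Lemma coef1_binp i : (binp i.+1)`_1 = (-1) ^+ i / i.+1%:R.
Proof.
rewrite /binp coefZ big_ord_recl subr0 coefXM /= -horner_coef0 horner_prod.
under eq_bigr do rewrite hornerXsubC sub0r /bump add1n.
have -> : \prod_(j < i) - (j.+1%:R : C) = (-1) ^+ i * i`!%:R.
  elim: i => [|i IH]; first by rewrite big_ord0 mulr1.
  by rewrite big_ord_recr /= IH factS natrM exprS; ring.
rewrite factS natrM.
move: (factf_neq0 R i) (natf_neq0 R i); move: (i`!%:R : C) (i.+1%:R : C) => a b h1 h2.
by field; rewrite h1 h2.
Qed.

Lemma poly_nat_inj (p q : {poly C}) : (forall n : nat, p.[n%:R] = q.[n%:R]) -> p = q.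
Proof.
move=> e; apply/eqP; rewrite -subr_eq0; apply/eqP.
apply: (@roots_geq_poly_eq0 _ _ [seq n%:R | n <- iota 0 (size (p - q))]).
- by apply/allP => x /mapP [n _ ->]; rewrite /root hornerD hornerN e subrr.
- by rewrite map_inj_uniq ?iota_uniq // => i j /eqP; rewrite eqr_nat => /eqP.
- by rewrite size_map size_iota.
Qed.

(** Both sides are polynomials in an exponent [c]: one expands [e^(cx)] in [x], the other expands
    [(1 + (e^x - 1))^c]. By [ck_addn] they agree at every natural number, hence as polynomials. *)
Lemma ck_poly M h (k : int) K : k < K%:Z ->
  \sum_(j < K) (ck M h (k - j%:Z) / j`!%:R) *: 'X^j =
  \sum_(i < K) ck (M + i%:Z) h (k - i%:Z) *: binp i.
Proof.
move=> kK; apply: poly_nat_inj => n; rewrite !horner_sum.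
have := ck_addn M h n kK; rewrite [h + _]addrC (ck_exp _ _ _ kK) => e.
transitivity (\sum_(j < K) n%:R ^+ j / j`!%:R * ck M h (k - j%:Z)).
  by apply: eq_bigr => j _; rewrite hornerZ hornerXn; ring.
by rewrite e; apply: eq_bigr => j _; rewrite hornerZ horner_binp mulrC.
Qed.

Lemma ck_add M h c (k : int) K : k < K%:Z ->
  ck M (h + c) k = \sum_(i < K) binc c i * ck (M + i%:Z) h (k - i%:Z).
Proof.
move=> kK; rewrite addrC (ck_exp _ _ _ kK).
have := congr1 (fun p => p.[c]) (ck_poly M h kK); rewrite !horner_sum => e.
transitivity (\sum_(j < K) ((ck M h (k - j%:Z) / j`!%:R) *: 'X^j).[c]).
  by apply: eq_bigr => j _; rewrite hornerZ hornerXn; ring.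
by rewrite e; apply: eq_bigr => j _; rewrite hornerZ horner_binp mulrC.
Qed.

(* [x = log (1 + (e^x - 1))] *)
Lemma ck_log M h (k : int) K : k < K%:Z ->
  ck M h k = \sum_(i < K) (-1) ^+ i / i.+1%:R * ck (M + 1 + i%:Z) h (k - i%:Z).
Proof.
case: K => [|K] kK.
  by rewrite big_ord0 ck_neg //; lia.
have kK' : k + 1 < K.+2%:Z by lia.
(* The linear coefficient in [c] of [e^(cx) = (1 + y)^c] is [x = log (1 + y)]. The degree [k + 1]
   compensates the factor [x] on the left. *)
have := congr1 (fun p : {poly C} => p`_1) (ck_poly M h kK'); rewrite !coef_sum.
rewrite 2!big_ord_recl /= !coefZ !coefXn /= big1; last first.
  by move=> j _; rewrite coefZ coefXn mulr0.
rewrite mulr0 add0r addr0 mulr1 divr1 addrK => ->.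
rewrite big_ord_recl /binp big_ord0 !coefZ coef1 !mulr0 add0r; apply: eq_bigr => j _.
rewrite lift0 coefZ -/(binp _) coef1_binp mulrC; congr (_ * ck _ _ _); lia.
Qed.

(* The coefficients of [((1 + y) log (1 + y) - y) / y]. *)
Definition gam (i : nat) : C := (-1) ^+ i / (i.+1%:R * i.+2%:R).

Lemma gamE i : gam i = (-1) ^+ i / i.+1%:R + (-1) ^+ i.+1 / i.+2%:R.
Proof.
rewrite /gam exprS; have := natf_neq0 R i.+1; have := natf_neq0 R i.
rewrite -[i.+2%:R]natr1; move: (i.+1%:R : C) => a h1 h2.
by field; rewrite h1 h2.
Qed.

(** At [y = e^x - 1] the series attached to [gam] is [(x e^x - y) / y]; the factor [e^x] is then
    expanded by the Pascal rule. *)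
Lemma ck_gam M h (k : int) K : k <= K%:Z ->
  \sum_(i < K) gam i * ck (M + 1 + i%:Z) h (k - 1 - i%:Z) =
  ck M h (k - 1) + ck (M - 1) h k - ck M h k.
Proof.
move=> kK; under eq_bigr do rewrite gamE mulrDl.
rewrite big_split /= -ck_log; last by lia.
rewrite -addrA; congr (_ + _).
rewrite (@ck_log (M - 1) h k K.+1); last by lia.
rewrite big_ord_recl /= divr1 expr0 mul1r.
have -> : M - 1 + 1 + 0 = M by lia.
rewrite subr0 addrC addKr; apply: eq_bigr => j _.
congr (_ * ck _ _ _); rewrite /bump; lia.
Qed.

(** The terms in [M] come from [ck_gam] and those in [h] from [ck_log], because [(i + 2) gam i] is
    [(-1)^i / (i + 1)]. The factors [M + (i + 2) h] are those produced by the commutator of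
    [L(i + 1)] with a vertex operator in [L_Y]. *)
Lemma ck_dilation M h (k : int) K : k <= K%:Z ->
  k%:~R * ck M h k =
  \sum_(i < K) gam i * (M%:~R + i.+2%:R * h) * ck (M + 1 + i%:Z) h (k - 1 - i%:Z).
Proof.
move=> kK.
have e i x : gam i * (M%:~R + i.+2%:R * h) * x =
   M%:~R * (gam i * x) + h * ((-1) ^+ i / i.+1%:R * x).
  rewrite /gam; have := natf_neq0 R i.+1; have := natf_neq0 R i.
  by move: (i.+1%:R : C) (i.+2%:R : C) => a b h1 h2; field; rewrite h1 h2.
under eq_bigr do rewrite e.
rewrite big_split /= -!mulr_sumr ck_gam // -ck_log; last by lia.
rewrite ck_theta ck_pascal subrK; ring.
Qed.

(** Expansion of [(1 + y)^(-m-1)]. The shift of [h] is the weight that [L(m + 1)] removes from the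
    vector it acts on. *)
Lemma ck_lower M h m (k : int) K : k < K%:Z ->
  gam m * ck M (h - m.+1%:R) k =
  \sum_(i < K) gam (m + i) * 'C(m + i + 2, m.+2)%:R * ck (M + i%:Z) h (k - i%:Z).
Proof.
move=> kK; rewrite (ck_add _ _ _ kK) mulr_sumr; apply: eq_bigr => j _.
rewrite mulrA; congr (_ * _).
have -> : - m.+1%:R = - m%:R - 1 :> C by rewrite -natr1 opprD.
rewrite binc_opp -natrD binc_nat /gam exprD.
have e : ((m + j + 2) * ((m + j + 1) * 'C(m + j, m)) = m.+2 * (m.+1 * 'C(m + j + 2, m.+2)))%N.
  have := mul_bin_diag (m + j + 1) m; rewrite addn1 /= => ->.
  rewrite mulnCA; have := mul_bin_diag (m + j + 2) m.+1; rewrite addn2 /= => ->.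
  by rewrite mulnCA.
have {}e := congr1 (fun n => n%:R : C) e; rewrite /= !natrM in e.
rewrite -bin_sub ?leq_addl // addnK.
have : ((m + j).+1%:R : C) != 0 by apply: natf_neq0.
have : ((m + j).+2%:R : C) != 0 by apply: natf_neq0.
have := natf_neq0 R m; have := natf_neq0 R m.+1.
rewrite addn2 addn1 in e.
move: (m.+1%:R : C) (m.+2%:R : C) ((m + j).+1%:R : C) ((m + j).+2%:R : C) e.
rewrite addn2; move: ('C(m + j, m)%:R : C) ('C((m + j).+2, m.+2)%:R : C) =>
  x y a b c d e h1 h2 h3 h4.
have -> : x = b * (a * y) / (d * c) by rewrite -e; field; rewrite h3 h4.
by move: ((-1) ^+ m) ((-1) ^+ j) => p q; field; rewrite h1 h2 h3 h4.
Qed.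

Fact bump0 n : bump 0 n = n.+1.
Proof. by []. Qed.

(** * Finite differences, summation by parts and moments *)

Section Differences.
Variable U : lmodType C.

Definition dl (f : nat -> U) (m : nat) : U := f m - f m.+1.

Lemma iter_dl K (f : nat -> U) m :
  iter K dl f m = \sum_(i < K.+1) ('C(K, i)%:R * (-1) ^+ i : C) *: f (m + i)%N.
Proof.
elim: K m => [|K IH] m.
  by rewrite big_ord_recl big_ord0 addr0 addn0 bin0 mulr1 scale1r.
rewrite iterS /dl !IH big_ord_recl [in RHS]big_ord_recl !bin0 -addrA; congr (_ + _).
rewrite big_ord_recr [in RHS]big_ord_recr /= !bump0 !binn addnS opprD addrA; congr (_ + _).
  rewrite -sumrB; apply: eq_bigr => j _; rewrite bump0 binS natrD addnS addSn.
  by rewrite -scalerBl exprS; congr (_ *: _); ring.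
by rewrite exprS !mul1r mulN1r scaleNr.
Qed.

(** The weights [C(m, s)] have generating function [z^s / (1 - z)^(s+1)], and moving one difference
    from [f] onto the weights multiplies it by [1 - z]. The right side lists the coefficients of
    [z^s (1 - z)^(K-1-s)]. *)
Lemma sum_bin_iter_dl K s (f : nat -> U) N : (forall m, (N <= m)%N -> f m = 0) ->
  fsum (fun m => ('C(m, s)%:R : C) *: iter K dl f m) =
  fsum (fun i => ((-1) ^+ i * binz R (K%:Z - 1 - s%:Z) i) *: f (s + i)%N).
Proof.
elim: K f N => [|K IH] f N f0.
  rewrite (fsum_reindex (h := addn s)) /=.
  - apply: eq_fsum => j; congr (_ *: _).
    have -> : binz R (0 - 1 - s%:Z) j = binc (- (s%:R : C) - 1) j.
      rewrite /binz; congr (binc _ _).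
      by rewrite sub0r rmorphB rmorphN /= addrC.
    rewrite binc_opp -natrD binc_nat mulrA -exprMn mulrNN mulr1 expr1n mul1r.
    by rewrite -(bin_sub (leq_addr j s)) addKn.
  - exact: addnI.
  - apply: (finsupp_nat (K := N)) => j Nj /=; rewrite f0 ?scaler0 //; lia.
  - move=> j h; exists (j - s)%N; case: (leqP s j) => [|js]; first lia.
    by case: h; rewrite bin_small // scale0r.
have df0 m : (N <= m)%N -> dl f m = 0 by move=> Nm; rewrite /dl !f0 ?subrr //; lia.
under eq_fsum do rewrite iterSr.
rewrite (IH _ N df0) (@fsum_nat _ _ N.+1); last by move=> j Nj; rewrite df0 ?scaler0 //; lia.
rewrite (@fsum_nat _ _ N.+2); last by move=> j Nj; rewrite f0 ?scaler0 //; lia.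
rewrite /dl; under eq_bigr do rewrite scalerBr.
rewrite sumrB [in RHS]big_ord_recl /binz !binc0.
rewrite (_ : \sum_(i < N.+1) _ *: f (s + i)%N = \sum_(i < N.+2)
   ((-1) ^+ i * binc (K%:Z - 1 - s%:Z)%:~R i) *: f (s + i)%N); last first.
  by rewrite [RHS]big_ord_recr /= f0 ?scaler0 ?addr0 //; lia.
rewrite [X in X - _ = _]big_ord_recl /= binc0 -addrA; congr (_ + _); rewrite -sumrB;
  apply: eq_bigr => j _.
rewrite bump0 addnS -scalerBl; congr (_ *: _).
have -> : K.+1%:Z - 1 - s%:Z = K%:Z - 1 - s%:Z + 1 by lia.
by rewrite [(_ + 1)%:~R]intrD binc_pascal exprS; ring.
Qed.

(** Multiplying a binomial weight by [A - a] gives a combination of two binomial weights. Hence the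
    family [(A - a) F A] still has zero moments, while the point [a] has left its support. *)
Lemma moments_inj (c d : C) (F : int -> U) : d != 0 -> finsupp F ->
  (forall s, fsum (fun A => binc (c + A%:~R * d) s *: F A) = 0) -> forall A, F A = 0.
Proof.
move=> d0 [S sS]; elim: S F sS => [|a S IH] F sS mom A; first exact: sS.
have fF : finsupp F by exists (a :: S).
pose F' (A : int) := ((A - a)%:~R : C) *: F A.
have sS' : suppin F' S.
  move=> B BS; rewrite /F'; have [->|Ba] := eqVneq B a; first by rewrite subrr scale0r.
  by rewrite sS ?scaler0 // inE negb_or Ba.
have F'0 B : F' B = 0.
  apply: IH sS' _ B => s.
  have e B : binc (c + B%:~R * d) s *: F' B =
      (d^-1 * s.+1%:R) *: (binc (c + B%:~R * d) s.+1 *: F B) +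
      ((s%:R - c) / d - a%:~R) *: (binc (c + B%:~R * d) s *: F B).
    rewrite /F' !scalerA -scalerDl; congr (_ *: _); rewrite rmorphB bincS.
    have := natf_neq0 R s; move: (s.+1%:R : C) => t t0.
    by field; rewrite t0 d0.
  under eq_fsum do rewrite e.
  rewrite fsumD; try by do 2!apply: finsuppZ.
  rewrite fsumZ; last by apply: finsuppZ.
  rewrite fsumZ; last by apply: finsuppZ.
  by rewrite !mom !scaler0 addr0.
have Fne B : B != a -> F B = 0.
  move=> Ba; have /eqP := F'0 B; rewrite scaler_eq0 intr_eq0 subr_eq0 (negbTE Ba).
  by move=> /eqP.
have [->|Aa] := eqVneq A a; last exact: Fne.
have := mom 0%N; rewrite (@fsum1 _ _ _ a); first by rewrite binc0 scale1r.
by move=> B Ba; rewrite Fne ?scaler0.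
Qed.

End Differences.

(* The coefficient of [x^t] in [e^(hx) (e^x - 1)^M]. *)
Definition cz (M : int) (h : C) (t : int) : C := ck M h (t - M).

Lemma cz_pascal M h t : cz M (h + 1) t = cz M h t + cz (M + 1) h t.
Proof. by rewrite /cz ck_pascal; congr (_ + ck _ _ _); lia. Qed.

Lemma cz_neg M h t : t < M -> cz M h t = 0.
Proof. by move=> h1; rewrite /cz ck_neg //; lia. Qed.

Lemma cz_diag M h : cz M h M = 1.
Proof. by rewrite /cz subrr ck_0. Qed.

Lemma cz_diff K M h t :
  \sum_(i < K.+1) 'C(K, i)%:R * (-1) ^+ (K - i) * cz M (h + i%:R) t = cz (M + K%:Z) h t.
Proof.
have e n : iter n (@dl C^o) (fun i => cz M (h + i%:R) t) =
    fun i : nat => (-1) ^+ n * cz (M + n%:Z) (h + i%:R) t.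
  elim: n => [|n IH]; first by apply/funext => j; rewrite mul1r addr0.
  rewrite iterS IH; apply/funext => j; rewrite /dl -natr1 addrA cz_pascal.
  by rewrite exprS -addn1 PoszD addrA; ring.
have := iter_dl K (fun i => cz M (h + i%:R) t : C^o) 0; rewrite e addr0 => {}e.
apply: (@mulfI _ ((-1) ^+ K)); first by rewrite signr_eq0.
rewrite e mulr_sumr; apply: eq_bigr => j _; rewrite add0n.
have jK : (j <= K)%N by rewrite -ltnS.
rewrite -[in X in X * _ = _](subnK jK) exprD.
have := sqrr_sign C (K - j); rewrite expr2; move: ((-1) ^+ (K - j)) => x x1.
transitivity (x * x * ((-1) ^+ j * 'C(K, j)%:R * cz M (h + j%:R) t)); first by ring.
by rewrite x1 mul1r [(-1) ^+ j * _]mulrC.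
Qed.

(** Multiplication of [e^(hx) (e^x - 1)^M] by [(e^x - 1)^K]; expanding the latter binomially reduces
    it to a [K]-th difference in [h]. *)
Lemma cz_conv K M h (t : int) S : t - M < S%:Z ->
  \sum_(s < S) expm1_pow_coef R K s * cz M h (t - s%:Z) = cz (M + K%:Z) h t.
Proof.
move=> tS; rewrite -cz_diff /expm1_pow_coef.
under eq_bigr do rewrite !mulr_suml.
rewrite exchange_big /=; apply: eq_bigr => j _.
rewrite /cz addrC (ck_exp _ _ _ tS) mulr_sumr; apply: eq_bigr => s _.
rewrite -!mulrA; do 4!congr (_ * _); congr (ck _ _ _); lia.
Qed.

(** The identity [e^((c+h)x) = e^(hx) (1 + y)^c], which turns the exponential powers of the
    phi-coordinated axiom into binomial weights. *)
Lemma cz_binc (h c : C) (t : nat) :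
  (c + h) ^+ t / t`!%:R = \sum_(s < t.+1) cz s%:Z h t%:Z * binc c s.
Proof.
rewrite -cf0h [c + h]addrC -[LHS]/(ck 0 (h + c) t%:Z) (@ck_add _ _ _ _ t.+1); last by lia.
by apply: eq_bigr => s _; rewrite mulrC add0r.
Qed.

End PowerSeries.

Section NsumEq.
Variable U : zmodType.

Lemma nsum_eq_fsum (f h : nat -> U) K : nsum_eq f h ->
  (forall i, (K <= i)%N -> f i = 0) -> (forall i, (K <= i)%N -> h i = 0) -> fsum f = fsum h.
Proof.
move=> [K0 e] f0 h0.
rewrite (@fsum_nat _ f (maxn K K0)) ?(@fsum_nat _ h (maxn K K0)) ?e ?leq_maxr //.
- by move=> i; rewrite geq_max => /andP[/h0].
- by move=> i; rewrite geq_max => /andP[/f0].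
Qed.

Lemma fsum_nsum_eq (f h : nat -> U) K : fsum f = fsum h ->
  (forall i, (K <= i)%N -> f i = 0) -> (forall i, (K <= i)%N -> h i = 0) -> nsum_eq f h.
Proof.
move=> e f0 h0; exists K => K' KK'; rewrite -!fsum_nat // => i K'i.
- by apply: h0; rewrite (leq_trans KK').
- by apply: f0; rewrite (leq_trans KK').
Qed.

Lemma sum_shift (f : int -> U) (N c : nat) : (forall i, i < 0 -> f i = 0) ->
  (forall i, N%:Z <= i + c%:Z -> f i = 0) ->
  \sum_(e < N) f (e%:Z - c%:Z) = \sum_(e < N) f e%:Z.
Proof.
move=> fneg; elim: c => [|c IH] fN; first by under eq_bigr do rewrite subr0.
rewrite -IH; last by move=> i h; apply: fN; lia.
case: N fN {IH} => [|N] fN; first by rewrite !big_ord0.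
rewrite big_ord_recl [RHS]big_ord_recr /= fneg; last by lia.
rewrite [f (N%:Z - c%:Z)]fN ?add0r ?addr0; last by lia.
by apply: eq_bigr => j _; congr (f _); rewrite bump0; lia.
Qed.

End NsumEq.

(** * The isomorphism between V and Zhu's second structure *)

Section VOA.
Variables (R : realType) (V : lmodType R[i]) (Y : V -> int -> V -> V) (vac om : V)
  (wt : int -> V -> Prop).
Hypothesis HV : is_VOA Y vac om wt.
Local Notation C := (R[i]).

Lemma YlinL n v a u u' : Y (a *: u + u') n v = a *: Y u n v + Y u' n v.
Proof. by have [h _] := HV. Qed.
Lemma YlinR u n a v v' : Y u n (a *: v + v') = a *: Y u n v + Y u n v'.
Proof. by have [_ [h _]] := HV. Qed.
Lemma Ytrunc u v : exists K : nat, forall j : int, K%:Z <= j -> Y u j v = 0.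
Proof.
have [_ [_ [h _]]] := HV; have [N hN] := h u v.
by exists (absz N) => j jN; apply: hN; lia.
Qed.

Lemma Ycreat v n : 0 <= n -> Y v n vac = 0.
Proof. by have [_ [_ [_ [_ [h _]]]]] := HV; apply: h. Qed.
Lemma Ycreat1 v : Y v (-1) vac = v.
Proof. by have [_ [_ [_ [_ [_ [h _]]]]]] := HV. Qed.
Lemma YJacobi u v w (l m n : int) :
     nsum_eq (fun i => binz R m i *: Y (Y u (l + i%:Z) v) (m + n - i%:Z) w)
             (fun i => ((-1) ^+ i * binz R l i) *:
                 (Y u (m + l - i%:Z) (Y v (n + i%:Z) w)
                  - ((-1 : C) ^ l) *: Y v (n + l - i%:Z) (Y u (m + i%:Z) w))).
Proof. by have [_ [_ [_ [_ [_ [_ [h _]]]]]]] := HV. Qed.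
Lemma wt_grading : is_direct_grading wt.
Proof. by have [_ [_ [_ [_ [_ [_ [_ [h _]]]]]]]] := HV. Qed.
Lemma wt_findim n : fin_dim (wt n).
Proof. by have [_ [_ [_ [_ [_ [_ [_ [_ [h _]]]]]]]]] := HV. Qed.
Lemma wt_bounded : exists N : int, forall n v, n < N -> wt n v -> v = 0.
Proof. by have [_ [_ [_ [_ [_ [_ [_ [_ [_ [h _]]]]]]]]]] := HV. Qed.
Lemma wt_om : wt 2 om.
Proof. by have [_ [_ [_ [_ [_ [_ [_ [_ [_ [_ [h _]]]]]]]]]]] := HV. Qed.
Lemma L0_wt n v : wt n v -> Y om 1 v = n%:~R *: v.
Proof. by have [_ [_ [_ [_ [_ [_ [_ [_ [_ [_ [_ [_ [h _]]]]]]]]]]]]] := HV; apply: h. Qed.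
Lemma Yderiv w (n : int) x : Y (Y om 0 w) n x = - (n%:~R *: Y w (n - 1) x).
Proof. by have [_ [_ [_ [_ [_ [_ [_ [_ [_ [_ [_ [_ [_ h]]]]]]]]]]]]] := HV. Qed.

Definition YZl n v c u := lin_Z (YlinL n v) c u.
Definition YZr u n c v := lin_Z (YlinR u n) c v.
Definition Y0l n v := lin_0 (YlinL n v).
Definition Y0r u n := lin_0 (YlinR u n).

(** The Borcherds identity at [l = 0], where only [i = 0] survives among the products of two
    modes. *)
Lemma Ycomm u w v (m : nat) (n : int) :
  Y u m%:Z (Y w n v) = Y w n (Y u m%:Z v) +
    \sum_(i < m.+1) ('C(m, i)%:R : C) *: Y (Y u i%:Z w) (m%:Z + n - i%:Z) v.
Proof.
have := YJacobi u w v 0 m%:Z n.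
move=> /(@nsum_eq_fsum _ _ _ m.+1); rewrite (@fsum1 _ _ (fun i => (_ * binz R 0 i) *: _) 0%N).
  rewrite (@fsum_nat _ _ m.+1) => [e|i mi]; last first.
    by rewrite binz_int bin_small // scale0r.
  have e0 : Y u m%:Z (Y w n v) - Y w n (Y u m%:Z v) = ((-1) ^+ 0 * binz R 0 0) *:
    (Y u (m%:Z + 0 - 0%:Z) (Y w (n + 0%:Z) v) -
     ((-1 : C) ^ 0) *: Y w (n + 0 - 0%:Z) (Y u (m%:Z + 0%:Z) v)).
    rewrite /binz binc0 mulr1 scale1r expr0z scale1r.
    by congr (Y _ _ (Y _ _ _) - Y _ _ (Y _ _ _)); lia.
  apply/eqP; rewrite addrC -subr_eq; apply/eqP; rewrite e0 -e.
    by apply: eq_bigr => i _; rewrite -binz_int add0r.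
  - by move=> i mi; rewrite -/(binz R m%:Z i) binz_int bin_small // scale0r.
  - by case=> // i _; rewrite -/(binz R 0 i.+1) binz_int mulr0 scale0r.
by case=> // i _; rewrite binz_int mulr0 scale0r.
Qed.

(** The Borcherds identity on the vacuum with [m = -1] and [n = 0]: by creation only the term
    [v_l u] survives among the products. The modes [-1 - i] applied to [vac] stand for the divided
    powers of [L(-1)] in skew symmetry. *)
Lemma Yskew u v (l : int) :
  Y v l u = fsum (fun i : nat => (- (-1) ^ l * (-1) ^+ i : C) *:
                    Y (Y u (l + i%:Z) v) (- 1 - i%:Z) vac).
Proof.
have [K hK] := Ytrunc u v.
have J := YJacobi u v vac l (-1) 0.
have b1 i : binz R (-1) i = (-1) ^+ i.
  have := binc_opp (0 : C) i; rewrite oppr0 sub0r add0r binc_nat binn mulr1 => <-.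
  by rewrite /binz; congr (binc _ _).
have z1 (i : nat) : (i%:Z != 0) -> Y u (-1 + i%:Z) vac = 0.
  by move=> i0; apply: Ycreat; lia.
have e := nsum_eq_fsum (K := (absz l + K).+1) J.
have {}e := e _ _.
have {e} : fsum (fun i : nat => binz R (-1) i *: Y (Y u (l + i%:Z) v) (-1 + 0 - i%:Z) vac) =
   - (-1) ^ l *: Y v l u.
  rewrite e.
  - rewrite (@fsum1 _ _ _ 0%N).
      rewrite /binz binc0 mulr1 scale1r (Ycreat v) // Y0r sub0r.
      have -> : -1 + 0%:Z = -1 by lia.
      rewrite Ycreat1 scaleNr; congr (- (_ *: Y _ _ _)); lia.
    move=> i i0; rewrite (Ycreat v) // Y0r z1 ?Y0r ?scaler0 ?subrr ?scaler0 //.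
  - by move=> i h; rewrite hK ?Y0l ?scaler0 //; lia.
  - move=> i h; rewrite (Ycreat v) // Y0r z1 ?Y0r ?scaler0 ?subrr ?scaler0 //; lia.
move=> e; have s1 : ((-1 : C) ^ l) * (-1) ^ l = 1 by case: (l) => m;
  rewrite /exprz -?invfM -expr2 sqrr_sign ?invr1.
have -> : Y v l u = - (-1) ^ l *: (- (-1) ^ l *: Y v l u) by rewrite scalerA mulrNN s1 scale1r.
rewrite -e -fsumZ.
  by apply: eq_fsum => i; rewrite b1 scalerA addr0.
by apply: (finsupp_nat (K := (absz l + K).+1)) => i h; rewrite hK ?Y0l ?scaler0 //; lia.
Qed.

Lemma wt_sub n : is_subspace (wt n).
Proof. by have [h _] := wt_grading. Qed.
Lemma wt0 n : wt n 0. Proof. by have [h _] := wt_sub n. Qed.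
Lemma wtZ n a x : wt n x -> wt n (a *: x).
Proof. by move=> h; rewrite -[_ *: _]addr0; apply: (wt_sub n).2 => //; apply: wt0. Qed.
Lemma wtD n x y : wt n x -> wt n y -> wt n (x + y).
Proof. by move=> hx hy; rewrite -[x]scale1r; apply: (wt_sub n).2. Qed.

Lemma wt_ind (P : V -> Prop) : P 0 -> (forall x y, P x -> P y -> P (x + y)) ->
  (forall p v, wt p v -> P v) -> forall v, P v.
Proof.
move=> P0 PD Pw v; have [_ [h _]] := wt_grading; have [s [_ [sw ->]]] := h v.
by rewrite big_seq; apply: big_ind => // p /sw; apply: Pw.
Qed.

(** Directness of the grading gives the converse: the weight [n] component of [(L(0) - p) v] is
    [n - p] times that of [v]. Homogeneity thereby becomes a computation with [L(0)]. *)
Lemma wtE p v : wt p v <-> Y om 1 v = p%:~R *: v.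
Proof.
split; first exact: L0_wt.
have [_ [h dir]] := wt_grading; have [s [us [sw ->]]] := h v.
rewrite (lin_sum (YlinR om 1)) scaler_sumr => e.
have e0 : \sum_(q <- [seq (q.1, ((q.1 - p)%:~R : C) *: q.2) | q <- s]) q.2 = 0.
  rewrite big_map /=; transitivity (\sum_(q <- s) (Y om 1 q.2 - p%:~R *: q.2)).
    rewrite big_seq [RHS]big_seq; apply: eq_bigr => q /sw /L0_wt ->.
    by rewrite rmorphB scalerBl.
  by rewrite sumrB e subrr.
rewrite big_seq; apply: (big_ind (wt p)) => [|x y|q qs]; [exact: wt0|exact: wtD|].
have [<-|qp] := eqVneq q.1 p; first exact: sw.
have := dir _ _ _ e0 (q.1, ((q.1 - p)%:~R : C) *: q.2).
rewrite -map_comp (eq_map (g := fst)) // => /(_ us) /=.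
move=> /(_ _ (map_f _ qs)) H.
have /eqP : ((q.1 - p)%:~R : C) *: q.2 = 0.
  by apply: H => r /mapP[q' /sw q's ->] /=; apply: wtZ.
by rewrite scaler_eq0 intr_eq0 subr_eq0 (negbTE qp) => /eqP ->; apply: wt0.
Qed.

Lemma L0_Y p u n v : wt p u ->
  Y om 1 (Y u n v) = Y u n (Y om 1 v) + (p - n - 1)%:~R *: Y u n v.
Proof.
move=> up; rewrite (Ycomm om u v 1 n); congr (_ + _).
rewrite big_ord_recl big_ord_recl big_ord0 addr0 bin0 bin1 !scale1r Yderiv.
rewrite /= bump0 (L0_wt up) YZl.
rewrite addr0; have -> : 1%:Z + n - 1 = n by lia.
rewrite -scaleNr -scalerDl -rmorphN -rmorphD; congr (_%:~R *: _); lia.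
Qed.

Lemma wt_Y p q u n v : wt p u -> wt q v -> wt (p + q - n - 1) (Y u n v).
Proof.
move=> up /L0_wt vq; apply/wtE; rewrite (L0_Y _ _ up) vq YZr -scalerDl -rmorphD.
by congr (_%:~R *: _); lia.
Qed.

Lemma wt_vac : wt 0 vac.
Proof. by apply/wtE; rewrite Ycreat // scale0r. Qed.

(* [Phi d] is the coefficient of [t^d] in the solution of the flow equation
   [d/dt Phi = (sum_j gam j t^j L(j+1)) Phi], [Phi = id] at [t = 0], which realizes the
   change of coordinate [z |-> (e^(tz) - 1) / t]; it lowers weights by [d].
   The first argument of [phif] is fuel. *)
Fixpoint phif (f d : nat) (v : V) : V :=
  match d, f with
  | 0, _ => v
  | d'.+1, 0 => 0
  | d'.+1, f'.+1 =>
      (d%:R)^-1 *: \sum_(j < d) gam R j *: Y om (j%:Z + 2) (phif f' (d' - j) v)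
  end.
Definition Phi d := phif d d.

Lemma phifE f d v : (d <= f)%N -> phif f d v = Phi d v.
Proof.
rewrite /Phi; elim/ltn_ind: d f => -[|d] IH [|f] //= df; congr (_ *: _).
apply: eq_bigr => j _; congr (_ *: Y _ _ _); rewrite IH; try lia.
by case: d IH df j => [|d] IH df j; rewrite ?[RHS]IH; try lia.
Qed.

(** Extension by zero to negative [d], so that recursions and shifts of indices have no boundary
    terms. *)
Definition Pz (d : int) (v : V) : V := match d with Posz d => Phi d v | Negz _ => 0 end.

Lemma Pz_neg d v : d < 0 -> Pz d v = 0. Proof. by case: d. Qed.

Lemma Pz_rec (d : int) v N : d <= N%:Z ->
  (d%:~R : C) *: Pz d v = \sum_(j < N) gam R j *: Y om (j%:Z + 2) (Pz (d - 1 - j%:Z) v).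
Proof.
case: d => [[|d]|d] dN.
- rewrite scale0r big1 // => j _; rewrite Pz_neg ?Y0r ?scaler0 //; lia.
- rewrite /= scalerA divff ?natf_neq0 // scale1r.
  rewrite (big_ord_widen N (fun j => gam R j *: Y om (j%:Z + 2) (phif d (d - j) v))) //.
  rewrite big_mkcond /=; apply: eq_bigr => j _; case: ifP => jd.
    rewrite phifE ?leq_subr //.
    by have -> : d.+1%:Z - 1 - j%:Z = (d - j)%N by lia.
  by rewrite Pz_neg ?Y0r ?scaler0 //; lia.
rewrite scaler0 big1 // => j _; rewrite Pz_neg ?Y0r ?scaler0 //; lia.
Qed.

Lemma Phi_rec d v : (d.+1%:R : C) *: Phi d.+1 v =
  \sum_(j < d.+1) gam R j *: Y om (j%:Z + 2) (Phi (d - j) v).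
Proof.
have := @Pz_rec d.+1%:Z v d.+1 (lexx _) => /= ->; apply: eq_bigr => j _.
by have -> : d.+1%:Z - 1 - j%:Z = (d - j)%N by have := ltn_ord j; lia.
Qed.

Lemma PhiE d v : Phi d.+1 v = (d.+1%:R)^-1 *:
  \sum_(j < d.+1) gam R j *: Y om (j%:Z + 2) (Phi (d - j) v).
Proof. by rewrite -Phi_rec scalerA mulVf ?natf_neq0 // scale1r. Qed.

Lemma Phi_lin d a x y : Phi d (a *: x + y) = a *: Phi d x + Phi d y.
Proof.
elim/ltn_ind: d => -[//|d] IH; rewrite !PhiE scalerA mulrC -scalerA -scalerDr; congr (_ *: _).
rewrite scaler_sumr -big_split /=; apply: eq_bigr => j _.
by rewrite IH ?YlinR ?scalerLin // ltnS leq_subr.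
Qed.

Lemma Phi_wt d p v : wt p v -> wt (p - d%:Z) (Phi d v).
Proof.
move=> vp; elim/ltn_ind: d => -[|d] IH; first by rewrite subr0.
rewrite PhiE; apply: wtZ; apply: (big_ind (wt _)) => [|x y|j _]; [exact: wt0|exact: wtD|].
apply: wtZ; have := wt_Y (j%:Z + 2) wt_om (IH (d - j)%N _); rewrite ltnS leq_subr => /(_ isT).
by congr (wt _ _); have := ltn_ord j; lia.
Qed.

Lemma Phi_vac d : Phi d.+1 vac = 0.
Proof.
elim/ltn_ind: d => d IH; rewrite PhiE big1 ?scaler0 // => j _.
case e : (d - j)%N => [|k]; first by rewrite /= Ycreat ?scaler0.
by rewrite IH ?Y0r ?scaler0 //; lia.
Qed.

(** In the commutator formula the terms [i = 0, 1] are [L(-1)] and [L(0)] acting on [w], which give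
    scalars; the remaining terms involve only positive [L(i + 1)], the operators of the flow. *)
Lemma L_Y p w (j : nat) (m : int) v N : wt p w -> (j < N)%N ->
  Y om (j%:Z + 2) (Y w m v) = Y w m (Y om (j%:Z + 2) v) +
    (- (m + j%:Z + 2)%:~R + j.+2%:R * p%:~R : C) *: Y w (m + j%:Z + 1) v +
    \sum_(i < N) ('C(j + 2, i.+2)%:R : C) *: Y (Y om (i%:Z + 2) w) (m + j%:Z - i%:Z) v.
Proof.
move=> wp jN; have -> : j%:Z + 2 = (j + 2)%N by lia.
rewrite Ycomm -addrA; congr (_ + _).
rewrite (addn2 j) big_ord_recl big_ord_recl /= bin0 bin1 !scale1r !bump0 addrA; congr (_ + _).
  rewrite Yderiv (L0_wt wp) YZl scalerA scalerDl -scaleNr.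
  by congr (_ *: Y _ _ _ + _ *: Y _ _ _); try lia; congr (- _%:~R); lia.
rewrite (big_ord_widen N (fun i => ('C(j.+2, bump 0 (bump 0 i))%:R : C) *:
    Y (Y om (bump 0 (bump 0 i))%:Z w) (j.+2%:Z + m - (bump 0 (bump 0 i))%:Z) v)) // big_mkcond /=.
apply: eq_bigr => i _; rewrite !bump0; case: ifP => ij.
  by congr (_ *: Y (Y _ _ _) _ _); lia.
by rewrite bin_small ?scale0r //; lia.
Qed.

(** The contribution of [Phi d u] and [Phi e v] to the part of [Y[Phi u, x] Phi v] that drops
    weights by [D]; the remaining drop [D - d - e] comes from the expansion of Zhu's operator, taken
    at the weight [p - d] of [Phi d u]. *)
Definition Phi_term p u v n (D : int) (d e : nat) : V :=
  ck (- (n + (D - d%:Z - e%:Z)) - 1) (p%:~R - d%:R : C) (D - d%:Z - e%:Z) *: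
  Y (Phi d u) (n + (D - d%:Z - e%:Z)) (Phi e v).

(** Induction on [D] through the flow equation. The commutator [L_Y] produces three kinds of terms:
    [f1], where [L(j + 1)] acts on [Phi e v]; [f2], the scalar terms; [f3], where an [L(m + 1)] acts
    on [Phi d u]. *)
Lemma Phi_mult p u v n (D : int) N : wt p u -> D < N%:Z ->
  Pz D (Y u n v) = \sum_(d < N) \sum_(e < N) Phi_term p u v n D d e.
Proof.
move=> up; have neg (D' : int) (d e : nat) : D' < d%:Z + e%:Z -> Phi_term p u v n D' d e = 0.
  by move=> h; rewrite /Phi_term ck_neg ?scale0r //; lia.
case: D => D; last first.
  by move=> _; rewrite big1 // => d _; rewrite big1 // => e _; rewrite neg //; lia.
elim/ltn_ind: D => -[|D] IH DN.
  case: N {IH} DN => // N _.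
  rewrite big_ord_recl big_ord_recl big1 => [|e _]; last by rewrite neg.
  rewrite big1 => [|d _]; last by rewrite big1 // => e _; rewrite neg //; lia.
  rewrite !addr0 /Phi_term /=.
  by rewrite addr0 [cf _ _ _]cf0 scale1r.
apply: (@scalerI _ _ (D.+1%:R : C)); first exact: natf_neq0.
have IH' (D' : int) : D' < D.+1%:Z -> Pz D' (Y u n v)
  = \sum_(d < N) \sum_(e < N) Phi_term p u v n D' d e.
  case: D' => D' hD; first by apply: IH; lia.
  by rewrite big1 // => d _; rewrite big1 // => e _; rewrite neg //; lia.
pose k0 (d e : nat) : int := D.+1%:Z - d%:Z - e%:Z.
pose h (d : int) : C := p%:~R - d%:~R.
pose f1 (j d : nat) (e : int) : V := let k := D%:Z - j%:Z - d%:Z - e in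
  (gam R j * ck (- (n + k) - 1) (h d) k) *: Y (Phi d u) (n + k) (Y om (j%:Z + 2) (Pz e v)).
pose f2 (j d e : nat) : V := let k := k0 d e in let M := - (n + k) - 1 in
  (gam R j * (M%:~R + j.+2%:R * h d) * ck (M + 1 + j%:Z) (h d) (k - 1 - j%:Z)) *:
    Y (Phi d u) (n + k) (Phi e v).
(* Indexed by [m] and [i = j - m] because [ck_lower] sums over [i] at fixed [m]; for negative [i]
   the binomial coefficient of the commutator vanishes. *)
pose f3 (m e : nat) (d i : int) : V := let k := D%:Z - m%:Z - d - e%:Z in
  match i with Posz i =>
    (gam R (m + i) * 'C(m + i + 2, m.+2)%:R * ck (- (n + k) - 1 + i%:Z) (h d) (k - i%:Z)) *:
      Y (Y om (m%:Z + 2) (Pz d u)) (n + k) (Phi e v)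
  | Negz _ => 0 end.
transitivity (\sum_(j < N) \sum_(d < N) \sum_(e < N)
    (f1 j d e%:Z + f2 j d e + \sum_(m < N) f3 m e d%:Z (j%:Z - m%:Z))).
  rewrite -[D.+1%:R]/(D.+1%:Z%:~R) (@Pz_rec D.+1%:Z _ N); last by lia.
  apply: eq_bigr => j _; rewrite IH'; last by lia.
  rewrite (lin_sum (YlinR om _)) scaler_sumr; apply: eq_bigr => d _.
  rewrite (lin_sum (YlinR om _)) scaler_sumr; apply: eq_bigr => e _.
  rewrite /Phi_term YZr (@L_Y (p - d%:Z) _ _ _ _ N (Phi_wt d up) (ltn_ord j)) scalerA.
  have ek : D.+1%:Z - 1 - j%:Z - d%:Z - e%:Z = D%:Z - j%:Z - d%:Z - e%:Z by lia.
  rewrite ek 2!scalerDr scalerA; congr (_ + _ + _).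
  - rewrite /f2 /k0.
    have -> : n + (D%:Z - j%:Z - d%:Z - e%:Z) + j%:Z + 1 = n + (D.+1%:Z - d%:Z - e%:Z) by lia.
    have -> : - (n + (D.+1%:Z - d%:Z - e%:Z)) - 1 + 1 + j%:Z =
              - (n + (D%:Z - j%:Z - d%:Z - e%:Z)) - 1 by lia.
    have -> : D.+1%:Z - d%:Z - e%:Z - 1 - j%:Z = D%:Z - j%:Z - d%:Z - e%:Z by lia.
    rewrite mulrAC; congr (_ * (_ + _ * _) * _ *: _).
      by rewrite -rmorphN; congr _%:~R; lia.
    by rewrite /h rmorphB.
  - rewrite scaler_sumr; apply: eq_bigr => m _; rewrite scalerA /f3.
    case E : (j%:Z - m%:Z) => [i|i]; last by rewrite bin_small ?mulr0 ?scale0r //; lia.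
    have ej : (j : nat) = (m + i)%N by lia.
    have -> : n + (D%:Z - j%:Z - d%:Z - e%:Z) + j%:Z - m%:Z = n + (D%:Z - m%:Z - d%:Z - e%:Z) by
      lia.
    have -> : - (n + (D%:Z - m%:Z - d%:Z - e%:Z)) - 1 + i%:Z =
              - (n + (D%:Z - j%:Z - d%:Z - e%:Z)) - 1 by lia.
    have -> : D%:Z - m%:Z - d%:Z - e%:Z - i%:Z = D%:Z - j%:Z - d%:Z - e%:Z by lia.
    by rewrite mulrAC ej.
transitivity (\sum_(d < N) \sum_(e < N) (\sum_(j < N) f1 j d (e%:Z - j.+1%:Z) +
   \sum_(j < N) f2 j d e + \sum_(m < N) \sum_(i < N) f3 m e (d%:Z - m.+1%:Z) i%:Z)); last first.
  rewrite scaler_sumr; apply: eq_bigr => d _; rewrite scaler_sumr; apply: eq_bigr => e _.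
  rewrite /Phi_term -/(k0 d e) scalerA.
  (* The total drop is shared out: [e] and [d] unfold the flow of [Phi e v] and [Phi d u], and the
     middle part is handled by [ck_dilation]. *)
  have -> : (D.+1%:R : C) = e%:R + (k0 d e)%:~R + d%:R.
    by rewrite /k0 !rmorphB /=; ring.
  rewrite 2!mulrDl 2!scalerDl; congr (_ + _ + _).
  - rewrite mulrC -scalerA -YZr -[e%:R]/(e%:Z%:~R) -[Phi e v]/(Pz e%:Z v) (@Pz_rec e%:Z _ N);
    last first.
      by have := ltn_ord e; lia.
    rewrite (lin_sum (YlinR _ _)) scaler_sumr; apply: eq_bigr => j _.
    rewrite YZr scalerA /f1.
    have -> : e%:Z - j.+1%:Z = e%:Z - 1 - j%:Z by lia.
    have -> : D%:Z - j%:Z - d%:Z - (e%:Z - 1 - j%:Z) = k0 d e by rewrite /k0; lia.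
    by rewrite [in RHS]mulrC.
  - rewrite /f2 -scaler_suml; congr (_ *: _).
    by rewrite (@ck_dilation _ _ _ _ N) //; rewrite /k0; lia.
  - rewrite mulrC -scalerA -YZl -[d%:R]/(d%:Z%:~R) -[Phi d u]/(Pz d%:Z u) (@Pz_rec d%:Z _ N);
    last first.
      by have := ltn_ord d; lia.
    rewrite (lin_sum (YlinL _ _)) scaler_sumr; apply: eq_bigr => m _.
    rewrite YZl scalerA /f3.
    have -> : d%:Z - m.+1%:Z = d%:Z - 1 - m%:Z by lia.
    have -> : D%:Z - m%:Z - (d%:Z - 1 - m%:Z) - e%:Z = k0 d e by rewrite /k0; lia.
    rewrite -scaler_suml -ck_lower; last by rewrite /k0; lia.
    congr (_ *: _); rewrite [RHS]mulrC; congr (_ * ck _ _ _).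
    by rewrite /h !rmorphB /= -natr1; ring.
(* The two triple sums differ by shifts of [e] by [j + 1] and of [d] by [m + 1]; vanishing at both
   ends of the range lets [sum_shift] absorb them. *)
have neg1 j d (e : int) : e < 0 -> f1 j d e = 0.
  by move=> e0; rewrite /f1 Pz_neg // !Y0r scaler0.
have negN j d (e : int) : N%:Z <= e + j.+1%:Z -> f1 j d e = 0.
  by move=> e0; rewrite /f1 ck_neg ?mulr0 ?scale0r //; lia.
rewrite exchange_big /=; apply/esym.
transitivity (\sum_(d < N) (\sum_(e < N) \sum_(j < N) f1 j d (e%:Z - j.+1%:Z)) +
  \sum_(d < N) (\sum_(e < N) \sum_(j < N) f2 j d e) +
  \sum_(d < N) (\sum_(e < N) \sum_(m < N) \sum_(i < N) f3 m e (d%:Z - m.+1%:Z) i%:Z)).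
  by rewrite -!big_split /=; apply: eq_bigr => d _; rewrite -!big_split /=.
transitivity (\sum_(d < N) (\sum_(j < N) \sum_(e < N) f1 j d e%:Z) +
  \sum_(d < N) (\sum_(j < N) \sum_(e < N) f2 j d e) +
  \sum_(d < N) (\sum_(j < N) \sum_(e < N) \sum_(m < N) f3 m e d%:Z (j%:Z - m%:Z))); last first.
  rewrite -!big_split /=; apply: eq_bigr => d _; rewrite -!big_split /=; apply: eq_bigr => j _.
  by rewrite -!big_split.
congr (_ + _ + _).
- apply: eq_bigr => d _; rewrite exchange_big; apply: eq_bigr => j _.
  by apply: sum_shift => i hi; [apply: neg1 | apply: negN].
- by apply: eq_bigr => d _; rewrite exchange_big.
rewrite exchange_big [RHS](eq_bigr (fun d : 'I_N =>
  \sum_(e < N) \sum_(m < N) \sum_(j < N) f3 m e d%:Z (j%:Z - m%:Z))); last first.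
  move=> d _; rewrite exchange_big /=; apply: eq_bigr => e _; exact: exchange_big.
rewrite [RHS]exchange_big; apply: eq_bigr => e _.
rewrite exchange_big [RHS]exchange_big; apply: eq_bigr => m _.
rewrite [RHS](eq_bigr (fun d : 'I_N => \sum_(j < N) f3 m e d%:Z j%:Z)); last first.
  move=> d _; apply: (@sum_shift _ (f3 m e d%:Z) N m) => -[i|i] hi //.
  by rewrite /f3 ck_neg ?mulr0 ?scale0r //; lia.
rewrite exchange_big [RHS]exchange_big; apply: eq_bigr => i _.
apply: (@sum_shift _ (fun d => f3 m e d i%:Z) N m.+1) => d hd; rewrite /f3.
  by rewrite Pz_neg // Y0r Y0l scaler0.
by rewrite ck_neg ?mulr0 ?scale0r //; lia.
Qed.

(** * The weight filtration and the inverse of [PHI] *)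

Definition wt_le (n : int) (v : V) := exists s : seq (int * V),
  (forall q, q \in s -> wt q.1 q.2 /\ q.1 <= n) /\ v = \sum_(q <- s) q.2.

Lemma wt_leD n x y : wt_le n x -> wt_le n y -> wt_le n (x + y).
Proof.
move=> [s [sw ->]] [s' [sw' ->]]; exists (s ++ s'); rewrite big_cat; split=> // q.
by rewrite mem_cat => /orP[/sw|/sw'].
Qed.

Lemma wt_le_wt n m x : wt m x -> m <= n -> wt_le n x.
Proof. by move=> xm mn; exists [:: (m, x)]; rewrite big_seq1; split=> // q; rewrite inE =>
  /eqP ->. Qed.

Lemma wt_le0 n : wt_le n 0.
Proof. by exists [::]; rewrite big_nil. Qed.

Lemma wt_leN n x : wt_le n x -> wt_le n (- x).
Proof.
move=> [s [sw ->]]; exists [seq (q.1, - q.2) | q <- s]; rewrite big_map sumrN; split=> // q.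
by move=> /mapP[r /sw[rw rn] ->]; rewrite -scaleN1r; split=> //; apply: wtZ.
Qed.

Lemma wt_le_ind (P : V -> Prop) n : P 0 -> (forall x y, P x -> P y -> P (x + y)) ->
  (forall p v, wt p v -> p <= n -> P v) -> forall v, wt_le n v -> P v.
Proof.
move=> P0 PD Pw v [s [sw ->]].
by rewrite big_seq; apply: big_ind => // p /sw[]; apply: Pw.
Qed.

Lemma wt_le_exists v : exists n, wt_le n v.
Proof.
apply: (wt_ind (P := fun v => exists n, wt_le n v)) v; first by exists 0; apply: wt_le0.
  move=> x y [n xn] [m ym]; exists (Num.max n m); apply: wt_leD.
    by apply: (wt_le_ind (P := wt_le _)) xn => [|? ?|p z zp pn];
      [exact: wt_le0|exact: wt_leD|apply: wt_le_wt zp _; lia].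
  by apply: (wt_le_ind (P := wt_le _)) ym => [|? ?|p z zp pn];
      [exact: wt_le0|exact: wt_leD|apply: wt_le_wt zp _; lia].
by move=> p x xp; exists p; apply: wt_le_wt xp _.
Qed.

Definition wtmin : int := projT1 (cid wt_bounded).
Lemma wtminP n v : n < wtmin -> wt n v -> v = 0.
Proof. exact: (projT2 (cid wt_bounded)). Qed.

Lemma wt_le_min n v : n < wtmin -> wt_le n v -> v = 0.
Proof.
move=> nm; apply: (wt_le_ind (P := fun v => v = 0)) => [|x y -> ->|p x xp pn] //.
  by rewrite addr0.
by apply: wtminP xp; lia.
Qed.

Lemma Phi_finite v : exists K, forall d, (K <= d)%N -> Phi d v = 0.
Proof.
have [n vn] := wt_le_exists v; exists (absz (n - wtmin + 1)) => d dn.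
apply: (wt_le_ind (P := fun v => Phi d v = 0)) vn.
- exact: lin_0 (Phi_lin d).
- by move=> x y ex ey; rewrite (lin_D (Phi_lin d)) ex ey addr0.
by move=> p x xp pn; apply: (wtminP _ (Phi_wt d xp)); lia.
Qed.

Lemma Phi_finsupp v : finsupp (fun d => Phi d v).
Proof. by have [K hK] := Phi_finite v; apply: finsupp_nat hK. Qed.

Definition PHI v : V := fsum (fun d => Phi d v).

Lemma PHI_lin a x y : PHI (a *: x + y) = a *: PHI x + PHI y.
Proof.
rewrite /PHI -fsumZ; last exact: Phi_finsupp.
rewrite -fsumD; [|apply: finsuppZ; exact: Phi_finsupp|exact: Phi_finsupp].
by apply: eq_fsum => d; rewrite Phi_lin.
Qed.

Lemma PHI_vac : PHI vac = vac.
Proof. by rewrite /PHI (@fsum1 _ _ _ 0%N) // => -[|d] // _; rewrite Phi_vac. Qed.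

Lemma PHI_sum v : exists K, forall N, (K <= N)%N -> PHI v = \sum_(d < N) Phi d v.
Proof.
have [K hK] := Phi_finite v; exists K => N KN; apply: fsum_nat => i Ni.
by apply: hK; apply: leq_trans Ni.
Qed.

Lemma PHI_unip n v : wt_le n v -> wt_le (n - 1) (PHI v - v).
Proof.
apply: (wt_le_ind (P := fun v => wt_le (n - 1) (PHI v - v))).
- by rewrite (lin_0 PHI_lin) subrr; apply: wt_le0.
- move=> x y hx hy; rewrite (lin_D PHI_lin).
  by rewrite opprD addrACA; apply: wt_leD.
move=> p x xp pn; have [K hK] := PHI_sum x; rewrite
  (hK K.+1) ?leqnSn // big_ord_recl addrAC subrr add0r.
apply: (big_ind (wt_le _)) => [|? ?|d _]; [exact: wt_le0|exact: wt_leD|].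
by apply: wt_le_wt (Phi_wt _ xp) _; rewrite lift0; lia.
Qed.

(** A vector [v] of the kernel equals [-(PHI v - v)], so it descends one step of the filtration
    after another until the weights run out. *)
Lemma PHI_inj x y : PHI x = PHI y -> x = y.
Proof.
move=> e; apply/eqP; rewrite -subr_eq0; apply/eqP.
have {e} : PHI (x - y) = 0 by rewrite (lin_B PHI_lin) e subrr.
move: (x - y) => {x y} v e; have [n vn] := wt_le_exists v.
have h k : wt_le (n - k%:Z) v.
  elim: k => [|k IH]; first by rewrite subr0.
  have := wt_leN (PHI_unip IH); rewrite e sub0r opprK.
  by congr (wt_le _ _); lia.
by apply: (wt_le_min _ (h (absz (n - wtmin) + 1)%N)); lia.
Qed.

(** If [x] is a preimage of the lower vector [PHI v - v], then [v - x] is a preimage of [v]. *)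
Lemma PHI_surj v : exists x, PHI x = v.
Proof.
have h (k : nat) : forall v, wt_le (wtmin + k%:Z - 1) v -> exists x, PHI x = v.
  elim: k => [|k IH] {}v vn.
    by exists 0; rewrite (lin_0 PHI_lin) (wt_le_min _ vn) //; lia.
  have hv := PHI_unip vn.
  have [|x ex] := IH (PHI v - v); first by move: hv; congr (wt_le _ _); lia.
  by exists (v - x); rewrite (lin_B PHI_lin) ex opprB addrCA subrr addr0.
have [n vn] := wt_le_exists v; apply: (h (absz (n - wtmin + 1))).
apply: (wt_le_ind (P := wt_le _)) vn => [|? ?|p x xp pn]; [exact: wt_le0|exact: wt_leD|].
by apply: wt_le_wt xp _; lia.
Qed.

Definition PSI v : V := projT1 (cid (PHI_surj v)).
Lemma PHIK v : PHI (PSI v) = v. Proof. exact: (projT2 (cid (PHI_surj v))). Qed.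
Lemma PSIK v : PSI (PHI v) = v. Proof. by apply: PHI_inj; rewrite PHIK. Qed.
Lemma PSI_lin a x y : PSI (a *: x + y) = a *: PSI x + PSI y.
Proof. by apply: PHI_inj; rewrite PHI_lin !PHIK. Qed.
Lemma PSI_vac : PSI vac = vac. Proof. by apply: PHI_inj; rewrite PHIK PHI_vac. Qed.

(* For [u] of weight [p], the [n]-th mode of Zhu's operator
   [Y[u, x] v = Y(e^(x L(0)) u, e^x - 1) v]. *)
Definition brak p u n v : V :=
  fsum (fun k : nat => ck (- (n + k%:Z) - 1) (p%:~R : C) k%:Z *: Y u (n + k%:Z) v).

Lemma brak_finsupp p u n v :
  finsupp (fun k : nat => ck (- (n + k%:Z) - 1) (p%:~R : C) k%:Z *: Y u (n + k%:Z) v).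
Proof.
have [K hK] := Ytrunc u v; apply: (finsupp_nat (K := absz (K%:Z - n))) => k hk.
by rewrite hK ?scaler0 //; lia.
Qed.

Lemma brak_linr p u n a v v' : brak p u n (a *: v + v') = a *: brak p u n v + brak p u n v'.
Proof.
rewrite /brak -fsumZ; last exact: brak_finsupp.
rewrite -fsumD; [|apply: finsuppZ; exact: brak_finsupp|exact: brak_finsupp].
by apply: eq_fsum => k; rewrite YlinR scalerLin.
Qed.

(** [Phi_mult] summed over [D]. Only finitely many [d] and [e] matter, which gives one truncation
    bound for all products and allows the regrouping by [d], [e] and [k = D - d - e]. *)
Lemma PHI_Y p u n v : wt p u ->
  PHI (Y u n v) = fsum (fun d : nat => brak (p - d%:Z) (Phi d u) n (PHI v)).
Proof.
move=> up.
have [K1 h1] := Phi_finite u; have [K2 h2] := Phi_finite v.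
have [K3 h3] := Phi_finite (Y u n v).
have [K4 h4] : exists K, forall (d e : nat) (j : int), K%:Z <= j -> Y (Phi d u) j (Phi e v) = 0.
  have : exists K, forall (d e : nat) (j : int), (d < K1)%N -> (e < K2)%N -> K%:Z <= j ->
      Y (Phi d u) j (Phi e v) = 0.
    elim: K1 {h1} => [|K1 [K hK]]; first by exists 0%N.
    suff [K' hK'] : exists K', forall (e : nat) (j : int), (e < K2)%N -> K'%:Z <= j ->
      Y (Phi K1 u) j (Phi e v) = 0.
      exists (maxn K K') => d e j; rewrite ltnS leq_eqVlt => /orP[/eqP ->|dK] eK hj.
        by apply: hK' => //; lia.
      by apply: hK => //; lia.
    elim: K2 {h2 hK} => [|K2 [K' hK']]; first by exists 0%N.
    have [K'' hK''] := Ytrunc (Phi K1 u) (Phi K2 v).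
    exists (maxn K' K'') => e j; rewrite ltnS leq_eqVlt => /orP[/eqP ->|eK] hj.
      by apply: hK''; lia.
    by apply: hK' => //; lia.
  move=> [K hK]; exists K => d e j hj.
  have [dK|dK] := ltnP d K1; last by rewrite h1 // Y0l.
  have [eK|eK] := ltnP e K2; last by rewrite h2 // Y0r.
  exact: hK.
pose N := (K1 + K2 + K3 + absz (K4%:Z - n) + 1)%N.
pose F (d e : nat) (k : int) := ck (- (n + k) - 1) (p%:~R - d%:R : C) k *: Y (Phi d u) (n + k)
  (Phi e v).
have Fneg d e k : k < 0 -> F d e k = 0 by move=> k0; rewrite /F ck_neg ?scale0r.
have FK1 d e k : (K1 <= d)%N -> F d e k = 0 by move=> hd; rewrite /F h1 // Y0l scaler0.
have FK2 d e k : (K2 <= e)%N -> F d e k = 0 by move=> he; rewrite /F h2 // Y0r scaler0.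
have FK4 d e k : (absz (K4%:Z - n))%:Z <= k -> F d e k = 0.
  by move=> hk; rewrite /F h4 ?scaler0 //; lia.
(* A nonzero term has [d], [e] and [k] below [N], so [D = d + e + k] stays below [3 N]. *)
pose NN := (3 * N)%N.
transitivity (\sum_(d < NN) \sum_(e < NN) \sum_(k < NN) F d e k%:Z).
  rewrite /PHI (@fsum_nat _ _ NN); last by move=> i hi; apply: h3; lia.
  transitivity (\sum_(D < NN) \sum_(d < NN) \sum_(e < NN) F d e (D%:Z - (d + e)%N%:Z)).
    apply: eq_bigr => D _; rewrite -[Phi D _]/(Pz D%:Z _) (@Phi_mult p _ _ _ _ NN up); last first.
      by have := ltn_ord D; lia.
    apply: eq_bigr => d _; apply: eq_bigr => e _; rewrite /Phi_term /F.
    by have -> : D%:Z - d%:Z - e%:Z = D%:Z - (d + e)%N%:Z by lia.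
  rewrite exchange_big; apply: eq_bigr => d _; rewrite exchange_big; apply: eq_bigr => e _ /=.
  have [dK|dK] := ltnP d K1; last by rewrite !big1 // => k _; rewrite FK1.
  have [eK|eK] := ltnP e K2; last by rewrite !big1 // => k _; rewrite FK2.
  apply: sum_shift => k hk; first exact: Fneg.
  by apply: FK4; lia.
rewrite (@fsum_nat _ _ NN); last first.
  by move=> d hd; rewrite /brak fsum0 // => k; rewrite h1 ?Y0l ?scaler0 //; lia.
apply: eq_bigr => d _.
rewrite /PHI [RHS](lin_fsum (brak_linr _ _ _)); last exact: Phi_finsupp.
rewrite (@fsum_nat _ _ NN); last first.
  by move=> e he; rewrite /brak fsum0 // => k; rewrite h2 ?Y0r ?scaler0 //; lia.
apply: eq_bigr => e _; rewrite /brak (@fsum_nat _ _ NN); last first.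
  by move=> k hk; rewrite h4 ?scaler0 //; lia.
by apply: eq_bigr => k _; rewrite /F rmorphB.
Qed.

(** Inverts the sum over [d] in [PHI_Y]: [PSI u] is [u] minus the [PSI] of the lower vectors
    [Phi d u], [d > 0], to which induction on the weight applies. *)
Lemma PHI_Y_PSI p u n v : wt p u -> PHI (Y (PSI u) n v) = brak p u n (PHI v).
Proof.
have h (k : nat) : forall p u, wt p u -> p < wtmin + k%:Z ->
    PHI (Y (PSI u) n v) = brak p u n (PHI v).
  elim/ltn_ind: k => k IH {}p {}u up pk.
  have [pm|pm] := ltP p wtmin.
    have -> : u = 0 by apply: (wtminP pm up).
    rewrite (lin_0 PSI_lin) Y0l (lin_0 PHI_lin) /brak fsum0 // => j.
    by rewrite Y0l scaler0.
  have [K0 hK] := Phi_finite u; pose K := K0.+1.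
  have e1 : PHI u = \sum_(d < K) Phi d u by apply: fsum_nat => i Ki; apply: hK; lia.
  have e2 : PSI u = u - \sum_(d < K0) PSI (Phi d.+1 u).
    apply: PHI_inj; rewrite (lin_B PHI_lin) PHIK (lin_sum PHI_lin) e1 big_ord_recl.
    by under [X in _ - X]eq_bigr do rewrite PHIK; rewrite addrK.
  rewrite e2 (lin_B (YlinL n v)) (lin_B PHI_lin) (PHI_Y _ _ up) (@fsum_nat _ _ K).
    rewrite big_ord_recl subr0 (lin_sum (YlinL n v)) (lin_sum PHI_lin) -[RHS]addr0 -addrA.
    congr (_ + _); apply/eqP; rewrite subr_eq0; apply/eqP; apply: eq_bigr => d _.
    by rewrite (IH k.-1 _ (p - d.+1%:Z)) //; [lia | exact: Phi_wt | lia].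
  by move=> d Kd; rewrite /brak fsum0 // => j; rewrite hK ?Y0l ?scaler0 //; lia.
by move=> up; apply: (h (absz (p - wtmin + 1)) _ _ up); lia.
Qed.

(** The intertwining property in terms of the inverse, where the left vector of Zhu's operator has a
    single weight. *)
Lemma Y_PSI p u n v : wt p u -> Y (PSI u) n (PSI v) = PSI (brak p u n v).
Proof. by move=> up; apply: PHI_inj; rewrite (PHI_Y_PSI _ _ up) !PHIK. Qed.

End VOA.

(** * Gradings, eigenspaces and the correspondence of vertex operators *)

Section Grading.
Variables (R : realType) (I : eqType) (U : lmodType R[i]) (G : I -> U -> Prop).
Hypothesis HG : is_direct_grading G.
Local Notation C := (R[i]).

Definition homdec (v : U) : seq (I * U) := projT1 (cid (HG.2.1 v)).
Lemma homdecP v : [/\ uniq (map fst (homdec v)), forall p, p \in homdec v -> G p.1 p.2 &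
  v = \sum_(p <- homdec v) p.2].
Proof. by have [? [? ?]] := projT2 (cid (HG.2.1 v)). Qed.

Lemma hom_sub i : is_subspace (G i). Proof. exact: HG.1. Qed.
Lemma hom0 i : G i 0. Proof. by have [h _] := hom_sub i. Qed.
Lemma homZ n a x : G n x -> G n (a *: x).
Proof. by move=> h; rewrite -[_ *: _]addr0; apply: (hom_sub n).2 => //; apply: hom0. Qed.
Lemma homD n x y : G n x -> G n y -> G n (x + y).
Proof. by move=> hx hy; rewrite -[x]scale1r; apply: (hom_sub n).2. Qed.
Lemma hom_sum n (J : Type) (r : seq J) (P : pred J) (F : J -> U) :
  (forall j, P j -> G n (F j)) -> G n (\sum_(j <- r | P j) F j).
Proof. by move=> h; apply: big_ind => //; [apply: hom0 | apply: homD]. Qed.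

Lemma hom_ind (P : U -> Prop) : P 0 -> (forall x y, P x -> P y -> P (x + y)) ->
  (forall p v, G p v -> P v) -> forall v, P v.
Proof.
move=> P0 PD Pw v; have [_ sw ->] := homdecP v.
by rewrite big_seq; apply: big_ind => // p /sw; apply: Pw.
Qed.

Section LinearExtension.
Variables (W : lmodType C) (h : I -> U -> W).
Hypothesis hL : forall i a x y, h i (a *: x + y) = a *: h i x + h i y.

Lemma sum_by_index (W' : zmodType) (F : I * U -> W') (s : seq (I * U)) :
  \sum_(q <- s) F q = \sum_(i <- undup (map fst s)) \sum_(q <- s | q.1 == i) F q.
Proof.
rewrite (exchange_big_dep predT) //= big_seq [RHS]big_seq; apply: eq_bigr => q qs.
rewrite (eq_bigl (pred1 q.1)) => [|i]; last by rewrite /= eq_sym.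
by rewrite -big_filter filter_pred1_uniq ?undup_uniq ?mem_undup ?map_f // big_seq1.
Qed.

(** Makes [lext] independent of the chosen decomposition: after grouping by degree, directness kills
    each component before [h] is applied. *)
Lemma sum_hom_eq0 (s : seq (I * U)) : (forall q, q \in s -> G q.1 q.2) ->
  \sum_(q <- s) q.2 = 0 -> \sum_(q <- s) h q.1 q.2 = 0.
Proof.
move=> sG; rewrite !sum_by_index => s0.
pose t := [seq (i, \sum_(q <- s | q.1 == i) q.2) | i <- undup (map fst s)].
have t0 : \sum_(q <- t) q.2 = 0 by rewrite big_map.
have tu : uniq (map fst t) by rewrite -map_comp map_id_in ?undup_uniq.
have tG q : q \in t -> G q.1 q.2.
  move=> /mapP[i _ ->] /=; rewrite big_seq_cond; apply: hom_sum => p /andP[ps /eqP <-].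
  exact: sG.
rewrite big_seq big1 // => i iu.
have := HG.2.2 _ tu tG t0 (i, \sum_(q <- s | q.1 == i) q.2) (map_f _ iu) => /= e.
transitivity (\sum_(q <- s | q.1 == i) h i q.2).
  by apply: eq_bigr => q /eqP ->.
by rewrite -(lin_sum (hL i)) e (lin_0 (hL i)).
Qed.

Definition lext (v : U) : W := \sum_(q <- homdec v) h q.1 q.2.

Lemma lext_sum (s : seq (I * U)) : (forall q, q \in s -> G q.1 q.2) ->
  lext (\sum_(q <- s) q.2) = \sum_(q <- s) h q.1 q.2.
Proof.
move=> sG; rewrite /lext; set v := \sum_(q <- s) q.2.
have [_ dG dv] := homdecP v.
have : \sum_(q <- s ++ [seq (q.1, - q.2) | q <- homdec v]) h q.1 q.2 = 0.
  apply: sum_hom_eq0.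
    move=> q; rewrite mem_cat => /orP[/sG //|/mapP[r /dG rG ->]] /=.
    by rewrite -scaleN1r; apply: homZ.
  by rewrite big_cat big_map /= sumrN -dv subrr.
rewrite big_cat big_map /=.
under [X in _ + X]eq_bigr do rewrite (lin_N (hL _)).
by rewrite sumrN => /eqP; rewrite subr_eq0 => /eqP ->.
Qed.

Lemma lext_hom i v : G i v -> lext v = h i v.
Proof.
move=> iv; have := @lext_sum [:: (i, v)]; rewrite !big_seq1 => -> // q.
by rewrite inE => /eqP ->.
Qed.

Lemma lext_lin a x y : lext (a *: x + y) = a *: lext x + lext y.
Proof.
have [_ xG ex] := homdecP x; have [_ yG ey] := homdecP y.
have := @lext_sum ([seq (q.1, a *: q.2) | q <- homdec x] ++ homdec y).
rewrite !big_cat !big_map /= -scaler_sumr -ex -ey => ->.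
  under eq_bigr do rewrite (lin_Z (hL _)).
  by rewrite -scaler_sumr.
move=> q; rewrite mem_cat => /orP[/mapP[r /xG rG ->]|/yG //] /=; exact: homZ.
Qed.

End LinearExtension.

End Grading.

(** * The root of unity [omegaT] *)

Section Roots.
Variables (R : realType) (T : nat).
Hypothesis T0 : (0 < T)%N.
Local Notation C := (R[i]).

Lemma omegaT_exp k : omegaT R T ^+ k =
  Complex (cos (2 * pi / T%:R * k%:R)) (- sin (2 * pi / T%:R * k%:R)).
Proof.
elim: k => [|k IH]; first by rewrite mulr0 cos0 sin0 oppr0.
have e x : x * k.+1%:R = x + x * k%:R :> R by rewrite -natr1 mulrDr mulr1 addrC.
rewrite exprS IH /omegaT e cosD sinD.
by apply/eqP; rewrite eq_complex /=; apply/andP; split; apply/eqP; ring.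
Qed.

Lemma omegaT_T : omegaT R T ^+ T = 1.
Proof.
rewrite omegaT_exp divfK; last by rewrite pnatr_eq0 -lt0n.
by rewrite mulrC mulr_natr cos2pi sin2pi oppr0.
Qed.

(** With [y = pi k / T] strictly between 0 and [pi], the real part is
    [cos (2 y) = 1 - 2 sin^2 y < 1]. *)
Lemma omegaT_neq1 k : (0 < k < T)%N -> omegaT R T ^+ k != 1.
Proof.
move=> /andP[k0 kT]; apply/eqP; rewrite omegaT_exp => /eqP; rewrite eq_complex /= =>
  /andP[/eqP e _].
pose y : R := pi * (k%:R / T%:R).
have e2 : 2 * pi / T%:R * k%:R = y *+ 2 by rewrite /y -mulr_natr; ring.
have T0' : (0 : R) < T%:R by rewrite ltr0n.
have : 0 < sin y.
  apply: sin_gt0_pi; rewrite /y mulr_gt0 ?pi_gt0 ?divr_gt0 ?ltr0n //=.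
  by rewrite gtr_pMr ?pi_gt0 // ltr_pdivrMr // mul1r ltr_nat.
move: e; rewrite e2 cos_mulr2n => e.
have := cos2Dsin2 y; nra.
Qed.

Lemma omegaT_prim : T.-primitive_root (omegaT R T).
Proof.
rewrite /primitive_root_of_unity T0; apply/forallP => k.
rewrite unity_rootE; apply/eqP; have := ltn_ord k; rewrite leq_eqVlt => /orP[/eqP e|kT].
  by rewrite e omegaT_T !eqxx.
by rewrite (negbTE (omegaT_neq1 _)) ?kT // (ltn_eqF kT).
Qed.

Lemma omegaT_neq0 : omegaT R T != 0.
Proof. by apply/eqP => e; have /eqP := omegaT_T; rewrite e expr0n gtn_eqF // eq_sym oner_eq0. Qed.

Lemma omegaT_modz (k : int) : omegaT R T ^ k = omegaT R T ^+ absz (k %% T%:Z)%Z.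
Proof.
have hT : T%:Z != 0 by lia.
rewrite {1}(divz_eq k T%:Z) expfzDr ?omegaT_neq0 // mulrC [(_ %/ _)%Z * _]mulrC -exprz_exp.
have -> : omegaT R T ^ (T%:Z) = 1 by exact: omegaT_T.
rewrite exp1rz mulr1 -[in LHS](gez0_abs (modz_ge0 k hT)) //.
Qed.

Lemma omegaT_eq (k : int) (r : nat) : (r < T)%N ->
  (omegaT R T ^ k == omegaT R T ^+ r) = ((k %% T%:Z)%Z == r%:Z).
Proof.
move=> rT; have hT : T%:Z != 0 by lia.
rewrite omegaT_modz (eq_prim_root_expr omegaT_prim) (modn_small rT).
have h1 := modz_ge0 k hT; have h2 : (k %% T%:Z)%Z < T%:Z by rewrite ltz_pmod //; lia.
rewrite modn_small; [|lia]; apply/eqP/eqP; lia.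
Qed.

End Roots.

(** * Decomposition into eigenspaces of [g] *)

Section Eigen.
Variables (R : realType) (V : lmodType R[i]) (g : V -> V) (T : nat).
Hypothesis gL : forall (a : R[i]) x y, g (a *: x + y) = a *: g x + g y.
Hypothesis HT : has_order g T.
Local Notation C := (R[i]).
Local Notation w := (omegaT R T).

Lemma T_gt0 : (0 < T)%N. Proof. by have [] := HT. Qed.

Lemma iterg_lin j (a : C) x y : iter j g (a *: x + y) = a *: iter j g x + iter j g y.
Proof. by elim: j => //= j ->. Qed.

(** The projection onto [V^r], as a discrete Fourier average over the powers of [g]. *)
Definition epr (r : nat) (v : V) : V :=
  (T%:R)^-1 *: \sum_(j < T) (w ^- (r * j)) *: iter j g v.

Lemma epr_lin r a x y : epr r (a *: x + y) = a *: epr r x + epr r y.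
Proof.
rewrite /epr scalerA [a * _]mulrC -scalerA -scalerDr; congr (_ *: _).
rewrite scaler_sumr -big_split /=; apply: eq_bigr => j _.
by rewrite iterg_lin scalerLin.
Qed.

Lemma epr_eig r v : eigsp g T r (epr r v).
Proof.
have w0 := omegaT_neq0 R T_gt0.
rewrite /eigsp /epr (lin_Z gL) scalerA mulrC -scalerA; congr (_ *: _).
rewrite (lin_sum gL).
pose F j := w ^- (r * j) *: iter j g v.
transitivity (w ^+ r *: \sum_(j < T) F j.+1).
  rewrite scaler_sumr; apply: eq_bigr => j _; rewrite (lin_Z gL) /F scalerA; congr (_ *: _).
  by rewrite mulnS exprD invfM mulrA divff ?mul1r // expf_neq0.
congr (_ *: _).
have e : F T = F 0%N.
  rewrite /F muln0 mulnC exprM (omegaT_T R T_gt0) expr1n expr0.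
  by have [_ [-> _]] := HT.
have : \sum_(j < T) F j + F T = F 0%N + \sum_(j < T) F j.+1.
  by transitivity (\sum_(j < T.+1) F j); [rewrite big_ord_recr | rewrite big_ord_recl].
by rewrite e addrC => /addrI ->.
Qed.

Lemma epr_sum v : \sum_(r < T) epr r v = v.
Proof.
have w0 := omegaT_neq0 R T_gt0.
rewrite -scaler_sumr exchange_big /=.
rewrite (bigD1 (Ordinal T_gt0)) //= [X in _ + X]big1 => [|j j0].
  rewrite addr0; under eq_bigr do rewrite muln0 expr0 invr1 scale1r.
  rewrite sumr_const card_ord -[v *+ T]scaler_nat scalerA mulVf ?scale1r //.
  by rewrite pnatr_eq0 -lt0n T_gt0.
have {}j0 : (0 < j < T)%N by rewrite ltn_ord andbT lt0n; apply: contra j0.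
rewrite -scaler_suml.
have : (w ^- j - 1) * (\sum_(i < T) w ^- (i * j)) = 0.
  have -> : \sum_(i < T) w ^- (i * j) = \sum_(i < T) (w ^- j) ^+ i.
    by apply: eq_bigr => i _; rewrite exprVn -exprM mulnC.
  by rewrite -subrX1 exprVn -exprM mulnC exprM (omegaT_T R T_gt0) expr1n invr1 subrr.
move=> /eqP; rewrite mulf_eq0 subr_eq0 => /orP[/eqP e|/eqP -> ]; last by rewrite scale0r.
by have /eqP[] := omegaT_neq1 R T_gt0 j0; rewrite -[LHS]invrK e invr1.
Qed.

Lemma epr_id r v : (r < T)%N -> eigsp g T r v -> epr r v = v.
Proof.
move=> rT ev; rewrite /epr.
have e j : iter j g v = w ^+ (r * j) *: v.
  elim: j => [|j IH]; first by rewrite muln0 scale1r.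
  by rewrite iterS IH (lin_Z gL) ev scalerA -exprD mulnS addnC.
under eq_bigr do rewrite e scalerA mulVf ?expf_neq0 ?(omegaT_neq0 R T_gt0) // scale1r.
rewrite sumr_const card_ord -[v *+ T]scaler_nat scalerA mulVf ?scale1r //.
by rewrite pnatr_eq0 -lt0n T_gt0.
Qed.

End Eigen.

Section VOAaut.
Variables (R : realType) (V : lmodType R[i]) (Y : V -> int -> V -> V) (vac om : V)
  (wt : int -> V -> Prop) (g : V -> V) (T : nat).
Hypothesis HV : is_VOA Y vac om wt.
Hypothesis HA : is_VOA_aut Y om g.
Hypothesis HT : has_order g T.
Local Notation C := (R[i]).

Lemma g_lin (a : C) x y : g (a *: x + y) = a *: g x + g y.
Proof. by have [h _] := HA. Qed.
Lemma g_Y u n v : g (Y u n v) = Y (g u) n (g v).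
Proof. by have [_ [_ [h _]]] := HA. Qed.
Lemma g_om : g om = om.
Proof. by have [_ [_ [_ h]]] := HA. Qed.

Lemma g_wt p v : wt p v -> wt p (g v).
Proof.
move=> /(wtE HV) e; apply/(wtE HV); rewrite -[in LHS]g_om -g_Y e.
exact: lin_Z g_lin _ _.
Qed.

Lemma g_Phi d v : g (Phi Y om d v) = Phi Y om d (g v).
Proof.
elim/ltn_ind: d => -[//|d] IH; rewrite !(PhiE HV) (lin_Z g_lin) (lin_sum g_lin).
congr (_ *: _); apply: eq_bigr => j _.
by rewrite (lin_Z g_lin) g_Y g_om IH // ltnS leq_subr.
Qed.

Lemma g_PHI v : g (PHI Y om v) = PHI Y om (g v).
Proof.
rewrite /PHI (lin_fsum g_lin); last exact: Phi_finsupp HV v.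
by apply: eq_fsum => d; rewrite g_Phi.
Qed.

Lemma g_PSI v : g (PSI HV v) = PSI HV (g v).
Proof. by apply: (PHI_inj HV); rewrite -g_PHI !PHIK. Qed.

Lemma epr_wt p r v : wt p v -> wt p (epr g T r v).
Proof.
move=> vp; apply: (wtZ HV); apply: (hom_sum (wt_grading HV)) => j _; apply: (wtZ HV).
by elim: (j : nat) => //= k; apply: g_wt.
Qed.

Lemma homog_ind (P : V -> Prop) : P 0 -> (forall x y, P x -> P y -> P (x + y)) ->
  (forall p (r : nat) v, (r < T)%N -> eigsp g T r v -> wt p v -> P v) -> forall v, P v.
Proof.
move=> P0 PD Pw; apply: (wt_ind HV) => // p v vp.
rewrite -(epr_sum HT v); apply: big_ind => // r _.
by apply: (Pw p r); rewrite ?ltn_ord //; [apply: epr_eig g_lin HT _ _|apply: epr_wt].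
Qed.

Lemma eig_ind (r : nat) (P : V -> Prop) : (r < T)%N ->
  P 0 -> (forall x y, P x -> P y -> P (x + y)) ->
  (forall p v, eigsp g T r v -> wt p v -> P v) -> forall v, eigsp g T r v -> P v.
Proof.
move=> rT P0 PD Pw v ev; rewrite -(epr_id g_lin HT rT ev).
apply: (wt_ind HV (P := fun v => P (epr g T r v))).
- by rewrite (lin_0 (epr_lin T g_lin _)).
- by move=> x y Px Py; rewrite (lin_D (epr_lin T g_lin _)); apply: PD.
by move=> p u up; apply: (Pw p); [apply: epr_eig g_lin HT _ _|apply: epr_wt].
Qed.

(** * Passage between [YM] and [YW] on a fixed space *)

Section Rel.
Variable M : lmodType C.
Implicit Types YM YW : V -> int -> M -> M.

Definition linV YM := forall (a : C) u u' k x, YM (a *: u + u') k x = a *: YM u k x + YM u' k x.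

(* [Y_W(v, x) = Y_M(x^(L(0)) Phi v, x)] *)
Definition rel YM YW := [/\ linV YM, linV YW &
  forall p v k x, wt p v -> YW (PSI HV v) k x = YM v (k + T%:Z * p) x].

Definition toW YM : V -> int -> M -> M := fun v k x =>
  lext (wt_grading HV) (fun p u => YM u (k + T%:Z * p) x) (PHI Y om v).
Definition toM YW : V -> int -> M -> M := fun v k x =>
  lext (wt_grading HV) (fun p u => YW (PSI HV u) (k - T%:Z * p) x) v.

Lemma rel_toW YM : linV YM -> rel YM (toW YM).
Proof.
move=> L; split=> //.
  move=> a u u' k x; rewrite /toW (PHI_lin HV) lext_lin // => *; exact: L.
move=> p v k x vp; rewrite /toW PHIK (lext_hom _ _ vp) // => *; exact: L.
Qed.

Lemma rel_toM YW : linV YW -> rel (toM YW) YW.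
Proof.
move=> L.
have L' p k x a u u' : YW (PSI HV (a *: u + u')) (k - T%:Z * p) x =
  a *: YW (PSI HV u) (k - T%:Z * p) x + YW (PSI HV u') (k - T%:Z * p) x.
  by rewrite (PSI_lin HV) L.
split=> //; first by move=> a u u' k x; rewrite /toM lext_lin.
by move=> p v k x vp; rewrite /toM (lext_hom _ _ vp) // addrK.
Qed.

Lemma rel_fun YM YW YW' : rel YM YW -> rel YM YW' -> forall v k x, YW v k x = YW' v k x.
Proof.
move=> [_ L e] [_ L' e'] v k x; rewrite -(PSIK HV v); move: (PHI Y om v) => {}v.
apply: (wt_ind HV (P := fun v => YW (PSI HV v) k x = YW' (PSI HV v) k x)) v.
- by rewrite (lin_0 (PSI_lin HV)) (lin_0 (fun a u u' => L a u u' k x)) (lin_0 (fun a u u' =>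
  L' a u u' k x)).
- move=> u u' h h'; rewrite (lin_D (PSI_lin HV)).
  by rewrite (lin_D (fun a u u' => L a u u' k x)) (lin_D (fun a u u' => L' a u u' k x)) h h'.
by move=> p v vp; rewrite (e p) // (e' p).
Qed.

(** Each mode of [YW] is a finite sum of modes of [YM], so a property of operators that is stable
    under sums can be transferred. *)
Lemma rel_W_ind YM YW (P : (M -> M) -> Prop) : rel YM YW ->
  P (fun=> 0) -> (forall f h, P f -> P h -> P (fun x => f x + h x)) ->
  forall k, (forall p v, wt p v -> P (YM v (k + T%:Z * p))) -> forall v, P (YW v k).
Proof.
move=> [_ L e] P0 PD k Pw v; rewrite -(PSIK HV v); move: (PHI Y om v) => {}v.
apply: (wt_ind HV (P := fun v => P (YW (PSI HV v) k))) v.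
- rewrite (lin_0 (PSI_lin HV)) (_ : YW 0 k = fun=> 0) //.
  by apply/funext => x; rewrite (lin_0 (fun a u u' => L a u u' k x)).
- move=> u u' h h'; rewrite (_ : YW _ k = fun x => YW (PSI HV u) k x + YW (PSI HV u') k x).
    exact: PD.
  by apply/funext => x; rewrite (lin_D (PSI_lin HV)) (lin_D (fun a u u' => L a u u' k x)).
move=> p v vp; rewrite (_ : YW _ k = YM v (k + T%:Z * p)); first exact: Pw.
by apply/funext => x; apply: e.
Qed.

Lemma rel_M_ind YM YW (P : (M -> M) -> Prop) : rel YM YW ->
  P (fun=> 0) -> (forall f h, P f -> P h -> P (fun x => f x + h x)) ->
  forall k, (forall p v, wt p v -> P (YW (PSI HV v) (k - T%:Z * p))) -> forall v, P (YM v k).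
Proof.
move=> [L _ e] P0 PD k Pw v; apply: (wt_ind HV (P := fun v => P (YM v k))) v.
- rewrite (_ : YM 0 k = fun=> 0) //.
  by apply/funext => x; rewrite (lin_0 (fun a u u' => L a u u' k x)).
- move=> u u' h h'; rewrite (_ : YM _ k = fun x => YM u k x + YM u' k x).
    exact: PD.
  by apply/funext => x; rewrite (lin_D (fun a u u' => L a u u' k x)).
move=> p v vp; rewrite (_ : YM v k = YW (PSI HV v) (k - T%:Z * p)); first exact: Pw.
by apply/funext => x; rewrite (e p) // subrK.
Qed.

Lemma rel_submodule YM YW N : rel YM YW -> is_submodule YM N <-> is_submodule YW N.
Proof.
move=> r; split=> -[sN hN]; split=> // v k x Nx.
  apply: (rel_W_ind r (P := fun f => N (f x))) => //; first by case: sN.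
    by move=> f h Nf Nh; rewrite -[f x]scale1r; apply: sN.2.
  by move=> *; apply: hN.
apply: (rel_M_ind r (P := fun f => N (f x))) => //; first by case: sN.
  by move=> f h Nf Nh; rewrite -[f x]scale1r; apply: sN.2.
by move=> *; apply: hN.
Qed.

End Rel.

Lemma rel_isom (M M' : lmodType C) (YM YW : V -> int -> M -> M) (YM' YW' : V -> int -> M' -> M') :
  rel YM YW -> rel YM' YW' -> mod_isom YM YM' <-> mod_isom YW YW'.
Proof.
move=> [L LW e] [L' LW' e']; split=> -[f [fL [fb h]]]; exists f; split=> //; split=> // v k x.
  rewrite -(PSIK HV v); move: (PHI Y om v) => {}v.
  apply: (wt_ind HV (P := fun v => f (YW (PSI HV v) k x) = YW' (PSI HV v) k (f x))) v.
  - rewrite (lin_0 (PSI_lin HV)) (lin_0 (fun a u u' => LW a u u' k x)) (lin_0 fL).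
    by rewrite (lin_0 (fun a u u' => LW' a u u' k (f x))).
  - move=> u u' hu hu'; rewrite (lin_D (PSI_lin HV)) (lin_D (fun a u u' => LW a u u' k x)).
    by rewrite (lin_D (fun a u u' => LW' a u u' k (f x))) (lin_D fL) hu hu'.
  by move=> p v vp; rewrite (e p) // (e' p).
apply: (wt_ind HV (P := fun v => f (YM v k x) = YM' v k (f x))) v.
- rewrite (lin_0 (fun a u u' => L a u u' k x)) (lin_0 fL).
  by rewrite (lin_0 (fun a u u' => L' a u u' k (f x))).
- move=> u u' hu hu'; rewrite (lin_D (fun a u u' => L a u u' k x)).
  by rewrite (lin_D (fun a u u' => L' a u u' k (f x))) (lin_D fL) hu hu'.
by move=> p v vp; rewrite -[k](subrK (T%:Z * p)) -e // -e'.
Qed.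

End VOAaut.

(** * Twisted Jacobi identity and weak associativity *)

Section IntSums.
Variable R : realType.
Local Notation C := (R[i]).

Lemma sgnz_sub (K s : nat) : - (-1) ^ (K%:Z - 1 - s%:Z) = (-1) ^+ K * (-1) ^+ s :> C.
Proof.
have -> : K%:Z - 1 - s%:Z = K%:Z + (- s.+1%:Z) by lia.
rewrite expfzDr ?oppr_eq0 ?oner_eq0 // -mulrN; congr (_ * _).
by rewrite -exprnN invr_sign exprS mulN1r opprK.
Qed.

Variable U : zmodType.
Implicit Types F : int -> U.

Lemma finsupp_shift (n : int) F : finsupp F -> finsupp (fun A => F (A + n)).
Proof.
move=> [S sS]; exists [seq A - n | A <- S] => A AN; apply: sS; apply: contra AN => AS.
by apply/mapP; exists (A + n); rewrite ?addrK.
Qed.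

Lemma fsum_shift (n : int) F : finsupp F -> fsum (fun A => F (A + n)) = fsum F.
Proof.
move=> fF; symmetry; apply: (fsum_reindex (h := fun A => A + n)).
- exact: addIr.
- exact: finsupp_shift.
- by move=> i _; exists (i - n); rewrite subrK.
Qed.

Lemma finsupp_reflect (n : int) F : finsupp F -> finsupp (fun A => F (n - A)).
Proof.
move=> [S sS]; exists [seq n - A | A <- S] => A AN; apply: sS; apply: contra AN => AS.
by apply/mapP; exists (n - A) => //; lia.
Qed.

Lemma fsum_reflect (n : int) F : finsupp F -> fsum (fun A => F (n - A)) = fsum F.
Proof.
move=> fF; symmetry; apply: (fsum_reindex (h := fun A => n - A)).
- by move=> x y; lia.
- exact: finsupp_reflect.
- by move=> i _; exists (n - i); lia.
Qed.

Lemma fsum_int_split (F : int -> U) : finsupp F ->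
  fsum F = fsum (fun i : nat => F i%:Z) + fsum (fun i : nat => F (Negz i)).
Proof.
move=> [S sS]; pose B := (\max_(A <- S) absz A).+1.
have hB A : (B <= absz A)%N -> F A = 0.
  move=> BA; apply: sS; apply/negP => AS; have := @leq_bigmax_seq _ S predT absz A AS isT.
  by rewrite leqNgt BA.
rewrite (@fsum_int _ F B); last by move=> A hA; apply: hB; lia.
rewrite (@fsum_nat _ (fun i : nat => F i%:Z) B); last by move=> i hi; apply: hB.
rewrite (@fsum_nat _ (fun i : nat => F (Negz i)) B); last by move=> i hi; apply: hB; lia.
rewrite mul2n -addnn big_split_ord /= addrC; congr (_ + _).
  by apply: eq_bigr => i _; congr F; lia.
rewrite (reindex_inj rev_ord_inj) /=; apply: eq_bigr => i _; congr F.
by have := ltn_ord i; lia.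
Qed.

End IntSums.

(** * Binomial moments of finitely supported families *)

Section Moments.
Variables (R : realType) (T : nat).
Hypothesis T0 : (0 < T)%N.
Local Notation C := (R[i]).

Lemma Tneq0 : (T%:R : C) != 0.
Proof. by rewrite pnatr_eq0 -lt0n. Qed.

(** The exponent of the formal variable attached to the mode index [A]. *)
Definition xT (A : int) : C := - (A%:~R / T%:R) - 1.

Lemma xTE A : xT A = -1 + A%:~R * (- (T%:R)^-1).
Proof. by rewrite /xT; ring. Qed.

Lemma xT_shift A (n : int) : xT (A + T%:Z * n) = xT A - n%:~R.
Proof. by rewrite /xT rmorphD rmorphM /=; field; exact: Tneq0. Qed.

Variable U : lmodType C.
Implicit Types F : int -> U.

(** The coefficient of [y^s] in the sum over [A] of [(1 + y)^(xT A) F A]. *)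
Definition mom F (s : nat) : U := fsum (fun A => binc (xT A) s *: F A).

Lemma mom_inj F F' : finsupp F -> finsupp F' -> (forall s, mom F s = mom F' s) -> F =1 F'.
Proof.
move=> fF fF' e A; apply/eqP; rewrite -subr_eq0; apply/eqP.
have fN : finsupp (fun A => - F' A) by apply: (finsupp_morph (f := fun _ x => - x)) => // i;
  rewrite oppr0.
apply: (moments_inj (c := -1) (d := - (T%:R)^-1) (F := fun A => F A - F' A)) => [||s].
- by rewrite oppr_eq0 invr_eq0 Tneq0.
- exact: finsuppD.
under eq_fsum => B do rewrite -xTE scalerDr scalerN.
rewrite fsumD; [|exact: finsuppZ|]; last first.
  by apply: (finsupp_morph (f := fun _ x => - x)); [move=> i; rewrite oppr0|apply: finsuppZ].
rewrite -(@fsum_morph _ _ _ (fun x : U => - x)); [|by rewrite oppr0|by move=> x y;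
  rewrite opprD|exact: finsuppZ].
by rewrite -/(mom F s) -/(mom F' s) e subrr.
Qed.

(** Shifting the index by [T] multiplies the generating series by [1 + y], so the difference
    multiplies it by [y]. *)
Lemma mom_diff F s : finsupp F ->
  mom (fun A => F (A + T%:Z) - F A) s = if s is s'.+1 then mom F s' else 0.
Proof.
move=> fF; rewrite /mom.
have e1 : fsum (fun A => binc (xT A) s *: F (A + T%:Z)) = fsum (fun A => binc (xT A + 1) s *: F A).
  rewrite -[RHS](fsum_shift T%:Z); last exact: finsuppZ.
  by apply: eq_fsum => A; have := xT_shift A 1; rewrite mulr1 => ->; rewrite subrK.
under eq_fsum do rewrite scalerDr.
rewrite fsumD; [|by apply: finsuppZ; apply: finsupp_shift|]; last first.
  by apply: finsuppZ; apply: (finsupp_morph (f := fun _ x => - x)) => // i; rewrite oppr0.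
rewrite e1 -fsumD; last 2 first.
- exact: finsuppZ.
- by apply: finsuppZ; apply: (finsupp_morph (f := fun _ x => - x)) => // i; rewrite oppr0.
case: s {e1} => [|s].
  by apply: fsum0 => A; rewrite !binc0 !scale1r subrr.
by apply: eq_fsum => A; rewrite binc_pascal scalerN -scalerBl addrAC subrr add0r.
Qed.

Lemma finsupp_diff F : finsupp F -> finsupp (fun A => F (A + T%:Z) - F A).
Proof.
move=> fF; apply: finsuppD; first exact: finsupp_shift.
by apply: (finsupp_morph (f := fun _ x => - x)) => // i; rewrite oppr0.
Qed.

Lemma mom_vander (q : C) F s : finsupp F ->
  fsum (fun A => binc (q + xT A) s *: F A) = \sum_(i < s.+1) binc q i *: mom F (s - i).
Proof.
move=> fF; rewrite /mom.
have [S sS] := fF; have sS' := suppin_undup sS.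
have e (f : int -> C) : fsum (fun A => f A *: F A) = \sum_(A <- undup S) f A *: F A.
  by apply: fsumE; rewrite ?undup_uniq // => A /sS' ->; rewrite scaler0.
rewrite e; under [RHS]eq_bigr do rewrite e scaler_sumr.
rewrite exchange_big /=; apply: eq_bigr => A _.
by rewrite binc_Vandermonde scaler_suml; apply: eq_bigr => i _; rewrite scalerA.
Qed.

(** Multiplication of the generating series by [(1 + y)^q] is unitriangular, hence invertible. The
    twisted Jacobi identity supplies such a factor with [q = a / T]. *)
Lemma mom_solve (q : C) F (E : nat -> U) : finsupp F ->
  (forall s, \sum_(i < s.+1) binc q i *: E (s - i)%N = fsum (fun A => binc (q + xT A) s *: F A)) <->
  (forall s, E s = mom F s).
Proof.
move=> fF; split=> h; last first.
  by move=> s; rewrite mom_vander //; apply: eq_bigr => i _; rewrite h.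
elim/ltn_ind=> s IH; have := h s; rewrite mom_vander // !big_ord_recl subn0 binc0 !scale1r.
rewrite (eq_bigr (fun i : 'I_s => binc q (lift ord0 i) *: mom F (s - lift ord0 i)%N)).
  by move=> /addIr.
by move=> i _; rewrite IH // lift0; have := ltn_ord i; lia.
Qed.

End Moments.

(** * Weak associativity as a statement on moments *)

Section Star.
Variables (R : realType) (V : lmodType R[i]) (Y : V -> int -> V -> V) (T : nat).
Variables (M : lmodType R[i]) (YM : V -> int -> M -> M).
Hypothesis T0 : (0 < T)%N.
Local Notation C := (R[i]).
Local Notation pr := (phi_prod T YM).

Lemma phi_prod_dl K u v w A B :
  pr K u v w A B = iter K (@dl R M)
    (fun i => YM u (A + T%:Z * (K%:Z - i%:Z)) (YM v (B + T%:Z * i%:Z) w)) 0%N.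
Proof. by rewrite iter_dl; apply: eq_bigr. Qed.

Lemma iter_dlE K (f : nat -> M) m : iter K (@dl R M) f m = iter K (@dl R M) (fun i => f (m
  + i)%N) 0%N.
Proof. by rewrite !iter_dl; apply: eq_bigr => i _; rewrite add0n. Qed.

Lemma eq_iter_dl K (f h : nat -> M) m : (forall i, f i = h i) ->
  iter K (@dl R M) f m = iter K (@dl R M) h m.
Proof. by move=> e; rewrite !iter_dl; apply: eq_bigr => i _; rewrite e. Qed.

Lemma phi_prodS K u v w A B :
  pr K.+1 u v w A B = pr K u v w (A + T%:Z) B - pr K u v w A (B + T%:Z).
Proof.
rewrite !phi_prod_dl iterS /dl; congr (_ - _).
  by apply: eq_iter_dl => i; congr (YM u _ _); lia.
rewrite iter_dlE; apply: eq_iter_dl => i; congr (YM u _ (YM v _ _)); lia.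
Qed.

(* The sum of the two mode indices, [T K] included, is the constant [c]. *)
Definition pp K u v w c A := pr K u v w A (c - T%:Z * K%:Z - A).

Lemma pp_S K u v w c A : pp K.+1 u v w c A = pp K u v w c (A + T%:Z) - pp K u v w c A.
Proof.
by rewrite /pp phi_prodS; congr (_ - _); congr (phi_prod _ _ _ _ _ _ _ _); lia.
Qed.

Definition prtrunc K u v w :=
  exists N : int, forall A B : int, N <= A \/ N <= B -> pr K u v w A B = 0.

Lemma prtrunc_S K u v w : prtrunc K u v w -> prtrunc K.+1 u v w.
Proof.
move=> [N hN]; exists N => A B h; rewrite phi_prodS !hN ?subrr //; lia.
Qed.

Lemma pp_bound K u v w c : prtrunc K u v w ->
  exists a b : int, forall A, A < a \/ b <= A -> pp K u v w c A = 0.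
Proof.
move=> [N hN]; exists (c - T%:Z * K%:Z - N), N => A h; apply: hN; lia.
Qed.

Lemma pp_finsupp K u v w c : prtrunc K u v w -> finsupp (pp K u v w c).
Proof. by move=> /(pp_bound c)[a [b h]]; apply: finsupp_int h. Qed.

(* Weak associativity in the coordinate [y = e^x0 - 1 = (x1 - x2) / x2]: comparing powers of
   [y] in [(1 + y)^(-A/T - 1)] turns the substitution [x1 = x2 (1 + y)] into binomial moments. *)
Definition star K u v w := [/\ prtrunc K u v w,
  forall j k : int, K%:Z <= j -> YM (Y u j v) k w = 0 &
  forall (c : int) (s : nat), YM (Y u (K%:Z - 1 - s%:Z) v) (c - T%:Z * (K%:Z - 1 - s%:Z)) w =
    mom T (pp K u v w c) s].

(** Both sides are multiplied by [y]; the new moment at [s = 0] vanishes together with [u_K v].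
    Raising [K] allows several pairs of vectors to share one value. *)
Lemma star_S K u v w : star K u v w -> star K.+1 u v w.
Proof.
move=> [h1 h2 h3]; split; first exact: prtrunc_S.
  by move=> j k h; apply: h2; lia.
move=> c s; rewrite (_ : pp K.+1 u v w c = fun A => pp K u v w c (A + T%:Z) - pp K u v w c A);
  last first.
  by apply/funext => A; apply: pp_S.
rewrite mom_diff //; last exact: pp_finsupp.
case: s => [|s]; first by apply: h2; lia.
by rewrite -h3; congr (YM (Y _ _ _) _ _); lia.
Qed.

Lemma star_mono K K' u v w : (K <= K')%N -> star K u v w -> star K' u v w.
Proof. by move=> /subnK <-; elim: (_ - _)%N => // n IH /IH; apply: star_S. Qed.

Lemma mom_pp_shift K n u v w c s : finsupp (pp K u v w c) ->
  mom T (pp (n + K) u v w c) (n + s) = mom T (pp K u v w c) s /\ finsupp (pp (n + K) u v w c).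
Proof.
move=> fp; elim: n => [|n [IH fIH]] //.
rewrite addSn (_ : pp (n + K).+1 u v w c = fun A => pp (n + K) u v w c (A + T%:Z) - pp (n
  + K) u v w c A); last first.
  by apply/funext => A; apply: pp_S.
by split; [rewrite addSn mom_diff | apply: finsupp_diff].
Qed.

Hypothesis L : linV YM.
Hypothesis LX : forall u k (a : C) x y, YM u k (a *: x + y) = a *: YM u k x + YM u k y.
Variables (vac om : V) (wt : int -> V -> Prop).
Hypothesis HV : is_VOA Y vac om wt.
Hypothesis Mvac : forall k x, YM vac k x = if k == - T%:Z then x else 0.

Let Lv k x := fun a u u' => L a u u' k x.
Let M0r u k := lin_0 (LX u k).
Let M0l k x := lin_0 (Lv k x).

(** The derivative property: [u_(-1-i) 1] acts as the [i]-th divided derivative of [Y(u, x)]. At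
    [K = 0] the product with the vacuum lives at a single index, and [mom_pp_shift] carries its
    moments to the given [K]. *)
Lemma star_vac K u w : star K u vac w ->
  forall (i : nat) k, YM (Y u (- 1 - i%:Z) vac) k w =
    ((-1) ^+ i * binc (k%:~R / T%:R : C) i) *: YM u (k - T%:Z * i%:Z) w.
Proof.
move=> [_ _ h] i k; pose c := k - T%:Z - T%:Z * i%:Z.
have := h c (K + i)%N.
have -> : K%:Z - 1 - (K + i)%N%:Z = - 1 - i%:Z by lia.
have -> : c - T%:Z * (- 1 - i%:Z) = k by rewrite /c; lia.
move=> ->.
have ppE A : pp 0 u vac w c A = if A == c + T%:Z then YM u A w else 0.
  rewrite /pp phi_prod_dl /=.
  have -> : A + T%:Z * (0%:Z - 0%:Z) = A by lia.
  have -> : c - T%:Z * 0%:Z - A + T%:Z * 0%:Z = c - A by lia.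
  rewrite Mvac; have -> : (c - A == - T%:Z) = (A == c + T%:Z) by apply/eqP/eqP; lia.
  by case: ifP => //; rewrite M0r.
have fp : finsupp (pp 0 u vac w c).
  by exists [:: c + T%:Z] => A; rewrite inE ppE => /negbTE ->.
have [] := @mom_pp_shift 0 K u vac w c i fp; rewrite addn0 => -> _.
rewrite /mom (@fsum1 _ _ _ (c + T%:Z)) => [|A /negbTE AN]; last by rewrite ppE AN scaler0.
rewrite ppE eqxx; have -> : c + T%:Z = k - T%:Z * i%:Z by rewrite /c; lia.
congr (_ *: _); pose q : C := k%:~R / T%:R - i%:R.
have -> : xT R T (k - T%:Z * i%:Z) = - q - 1.
  by rewrite /xT /q rmorphB rmorphM /=; field; exact: Tneq0.
by rewrite binc_opp /q subrK.
Qed.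

(* [(x1 - x2)^K Y(u, x1) Y(v, x2) w = (x1 - x2)^K Y(v, x2) Y(u, x1) w] *)
Definition prcomm K u v w :=
  forall A B, pr K u v w A B = (-1) ^+ K *: pr K v u w B A.

Lemma prcomm_S K u v w : prcomm K u v w -> prcomm K.+1 u v w.
Proof.
move=> h A B; rewrite !phi_prodS !h exprS mulN1r scaleNr scalerBr opprB.
by [].
Qed.

Lemma prcomm_mono K K' u v w : (K <= K')%N -> prcomm K u v w -> prcomm K' u v w.
Proof. by move=> /subnK <-; elim: (_ - _)%N => // n IH /IH; apply: prcomm_S. Qed.

(* Skew symmetry and [star] for [(u, v)] compute the moments of the product in the order
   [v, u], and moments determine a finitely supported family. *)
Lemma star_comm K u v w : star K u v w -> star K v u w ->
  (forall j (i : nat) k, YM (Y (Y u j v) (- 1 - i%:Z) vac) k w =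
    ((-1) ^+ i * binc (k%:~R / T%:R : C) i) *: YM (Y u j v) (k - T%:Z * i%:Z) w) ->
  prcomm K v u w.
Proof.
move=> [t1 z1 s1] [t2 z2 s2] dv B A.
pose c := A + B + T%:Z * K%:Z.
have fuv := pp_finsupp c t1; have fvu := pp_finsupp c t2.
have fr : finsupp (fun B => (-1) ^+ K *: pp K u v w c (c - T%:Z * K%:Z - B)).
  by apply: finsuppZ; apply: finsupp_reflect fuv.
have -> : pr K v u w B A = pp K v u w c B by rewrite /pp; congr (phi_prod _ _ _ _ _ _ _ _);
  rewrite /c; lia.
have -> : pr K u v w A B = pp K u v w c (c - T%:Z * K%:Z - B).
  by rewrite /pp; congr (phi_prod _ _ _ _ _ _ _ _); rewrite /c; lia.
apply: (mom_inj T0 fvu fr) => s; rewrite -s2; set j := K%:Z - 1 - s%:Z.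
rewrite (Yskew HV u v j) (lin_fsum (Lv _ _)); last first.
  have [K' hK'] := Ytrunc HV u v; apply: (finsupp_nat (K := absz (K'%:Z - j))) => i hi.
  by rewrite hK' ?(Y0l HV) ?scaler0 //; lia.
pose q : C := (c - T%:Z * j)%:~R / T%:R.
have sgn : - (-1) ^ j = (-1) ^+ K * (-1) ^+ s :> C by exact: sgnz_sub.
transitivity (fsum (fun i : nat => ((-1) ^+ K * (-1) ^+ s * binc q i : C) *:
    YM (Y u (j + i%:Z) v) (c - T%:Z * (j + i%:Z)) w)).
  apply: eq_fsum => i; rewrite (lin_Z (Lv _ _)) dv sgn scalerA; congr (_ *: YM _ _ _); last by lia.
  rewrite -/q -!mulrA; congr (_ * (_ * _)).
  by rewrite mulrA -expr2 sqrr_sign mul1r.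
rewrite (@fsum_nat _ _ s.+1); last first.
  by move=> i hi; rewrite z1 ?scaler0 //; rewrite /j; lia.
transitivity (((-1) ^+ K * (-1) ^+ s : C) *: \sum_(i < s.+1) binc q i *: mom T (pp K u v w c)
  (s - i)).
  rewrite scaler_sumr; apply: eq_bigr => i _; rewrite scalerA; congr (_ *: _).
  rewrite -s1; have -> : K%:Z - 1 - (s - i)%N%:Z = j + i%:Z by rewrite /j; have := ltn_ord i; lia.
  by [].
rewrite -mom_vander // -scalerA -fsumZ; last exact: finsuppZ.
rewrite -fsumZ; last by apply: finsuppZ; apply: finsuppZ.
(* The reflection exchanges the indices of [u] and [v]. It turns [q + xT A] into [B'/T + s], and
   upper negation makes the weight that of [xT B']. *)
rewrite -(fsum_reflect (c - T%:Z * K%:Z)); last by do 3!apply: finsuppZ.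
apply: eq_fsum => B'; rewrite !scalerA; congr (_ *: _).
rewrite [RHS]mulrC -!mulrA; congr (_ * _).
have -> : xT R T B' = - (B'%:~R / T%:R) - 1 by [].
rewrite [in RHS]binc_opp; congr (_ * binc _ _).
rewrite /q /xT /j !rmorphB /= !rmorphM /= !rmorphB /=.
by field; exact: Tneq0.
Qed.

(** * Comparison with the twisted Jacobi identity *)

Section Jac.
Variables (u v : V) (w : M) (r : nat).
Hypothesis ucl : forall k x, (k %% T%:Z)%Z != r%:Z -> YM u k x = 0.
Hypothesis utr : exists N : int, forall k, N <= k -> YM u k w = 0.
Hypothesis vtr : exists N : int, forall k, N <= k -> YM v k w = 0.

Definition jacR (l a b : int) (i : nat) : M :=
  ((-1) ^+ i * binz R l i) *:
            (YM u (a + T%:Z * (l - i%:Z)) (YM v (b + T%:Z * i%:Z) w)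
             - ((-1 : C) ^ l) *:
                 YM v (b + T%:Z * (l - i%:Z)) (YM u (a + T%:Z * i%:Z) w)).
Definition jacL (l a b : int) (i : nat) : M :=
  binc (a%:~R / T%:R : C) i *: YM (Y u (l + i%:Z) v) (a + b - T%:Z * i%:Z) w.

Lemma jacR_trunc l a b : exists K, forall i, (K <= i)%N -> jacR l a b i = 0.
Proof.
have [N1 h1] := utr; have [N2 h2] := vtr.
exists (absz N1 + absz N2 + absz a + absz b)%N => i hi.
have hT : i%:Z <= T%:Z * i%:Z by nia.
by rewrite /jacR h1 ?h2 ?M0r ?scaler0 ?subrr ?scaler0 //; lia.
Qed.

Lemma jacL_trunc l a b : exists K, forall i, (K <= i)%N -> jacL l a b i = 0.
Proof.
have [K h] := Ytrunc HV u v; exists (absz l + K)%N => i hi.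
by rewrite /jacL h ?M0l ?scaler0 //; lia.
Qed.

Lemma jac_fsum l a b : nsum_eq (jacL l a b) (jacR l a b) <-> fsum (jacL l a b) = fsum (jacR l a b).
Proof.
have [K1 h1] := jacL_trunc l a b; have [K2 h2] := jacR_trunc l a b.
have h1' i : (K1 + K2 <= i)%N -> jacL l a b i = 0 by move=> hi; apply: h1; lia.
have h2' i : (K1 + K2 <= i)%N -> jacR l a b i = 0 by move=> hi; apply: h2; lia.
by split=> h; [apply: nsum_eq_fsum h h1' h2' | apply: fsum_nsum_eq h h1' h2'].
Qed.

Lemma jacR_nonneg (l : nat) a b :
  fsum (jacR l a b) = pr l u v w a b - (-1) ^+ l *: pr l v u w b a.
Proof.
rewrite (@fsum_nat _ _ l.+1); last first.
  by move=> i hi; rewrite /jacR binz_int bin_small // mulr0 scale0r.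
rewrite /phi_prod scaler_sumr -sumrB; apply: eq_bigr => i _.
rewrite /jacR binz_int scalerBr !scalerA [(-1) ^+ i * _]mulrC; congr (_ - _ *: _).
by rewrite [LHS]mulrC.
Qed.

(* The expansions of [(x1 - x2)^l] in the two orders contribute the indices [A < a] and
   [A >= a] respectively, and together they give the sum over all [A]. *)
Lemma jacR_star (K s : nat) a b : prcomm K u v w -> prtrunc K u v w -> (a %% T%:Z)%Z = r%:Z ->
  fsum (jacR (K%:Z - 1 - s%:Z) a b) =
  fsum (fun A => binc (a%:~R / T%:R + xT R T A) s *:
    pp K u v w (a + b + T%:Z * (K%:Z - 1 - s%:Z)) A).
Proof.
move=> cm tr ar; set l := K%:Z - 1 - s%:Z; set c := a + b + T%:Z * l.
have [N1 h1] := utr; have [N2 h2] := vtr.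
(* [ga (s + i)] and [et (s + i)] are the products in the two orders in the [i]-th Jacobi term.
   Starting at [s] puts the sums in the form of [sum_bin_iter_dl], whose differences realize
   [(x1 - x2)^K]. *)
pose ga (m : nat) := YM u (a + T%:Z * (K%:Z - 1 - m%:Z)) (YM v (c - a - T%:Z *
  (K%:Z - 1 - m%:Z)) w).
pose et (m : nat) := YM v (b + T%:Z * (K%:Z - 1 - m%:Z)) (YM u (a + T%:Z * (m%:Z - s%:Z)) w).
pose B := (absz N1 + absz N2 + absz a + absz b + absz c + T * (K + s + 1) + K + s)%N.
have TT (m : nat) : m%:Z <= T%:Z * m%:Z by nia.
have ga0 m : (B <= m)%N -> ga m = 0.
  move=> hm; rewrite /ga h2 ?M0r //; have := TT m; have := TT s; rewrite /B in hm; lia.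
have et0 m : (B <= m)%N -> et m = 0.
  move=> hm; rewrite /et h1 ?M0r //; have := TT m; have := TT K; rewrite /B in hm; lia.
pose f := pp K u v w c.
have iga m : iter K (@dl R M) ga m = f (a - T%:Z * (m%:Z + 1)).
  rewrite /f /pp phi_prod_dl iter_dlE; apply: eq_iter_dl => i; rewrite /ga.
  by congr (YM u _ (YM v _ _)); lia.
have iet m : iter K (@dl R M) et m = (-1) ^+ K *: f (a + T%:Z * (m%:Z - s%:Z)).
  rewrite /f /pp cm scalerA -expr2 sqrr_sign scale1r phi_prod_dl iter_dlE; apply: eq_iter_dl => i.
  by rewrite /et; congr (YM v _ (YM u _ _)); rewrite /c /l; lia.
have S1 := sum_bin_iter_dl K s ga0; have S2 := sum_bin_iter_dl K s et0.
have f0 A : (A %% T%:Z)%Z != r%:Z -> f A = 0.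
  move=> hA; rewrite /f /pp /phi_prod big1 // => i _; rewrite ucl ?scaler0 //.
  by rewrite addrC mulrC modzMDl.
have fF : finsupp f by apply: pp_finsupp.
transitivity (fsum (fun m : nat => ('C(m, s)%:R : C) *: f (a - T%:Z * (m%:Z + 1))) +
   (-1) ^+ s *: fsum (fun i : nat => ('C(s + i, s)%:R : C) *: f (a + T%:Z * i%:Z))).
  have -> : fsum (jacR l a b) = fsum (fun i => ((-1) ^+ i * binz R l i) *: ga (s + i)%N) -
     (-1) ^ l *: fsum (fun i => ((-1) ^+ i * binz R l i) *: et (s + i)%N).
    have f1 : finsupp (fun i => ((-1) ^+ i * binz R l i) *: ga (s + i)%N).
      by apply: (finsupp_nat (K := B)) => i hi; rewrite ga0 ?scaler0 //; lia.
    have f2 : finsupp (fun i => ((-1) ^+ i * binz R l i) *: et (s + i)%N).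
      by apply: (finsupp_nat (K := B)) => i hi; rewrite et0 ?scaler0 //; lia.
    rewrite -scaleNr -fsumZ // -fsumD //; last exact: finsuppZ.
    apply: eq_fsum => i; rewrite /jacR scalerBr scaleNr; congr (_ - _).
      by rewrite /ga; congr (_ *: YM u _ (YM v _ _)); rewrite /c /l; lia.
    rewrite !scalerA mulrC; congr (_ *: _); rewrite /et.
    by congr (YM v _ (YM u _ _)); rewrite /l; lia.
  rewrite -S1 -S2; congr (_ + _); first by apply: eq_fsum => m; rewrite iga.
  rewrite -scaleNr sgnz_sub.
  under eq_fsum do rewrite iet scalerA mulrC -scalerA.
  have fs : finsupp (fun m : nat => ('C(m, s)%:R : C) *: f (a + T%:Z * (m%:Z - s%:Z))).
    apply: (finsupp_nat (K := B)) => m hm; have := iet m; rewrite iter_dl big1.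
      by move=> /esym/eqP; rewrite scaler_eq0 signr_eq0 /= => /eqP ->; rewrite scaler0.
    by move=> i _; rewrite et0 ?scaler0 //; lia.
  rewrite fsumZ // scalerA mulrAC -expr2 sqrr_sign mul1r; congr (_ *: _).
  rewrite (fsum_reindex (h := addn s)) //=.
  - by apply: eq_fsum => i; congr (_ *: f _); lia.
  - exact: addnI.
  - case: fs => S sS; exists [seq (m - s)%N | m <- S] => i hi /=; apply: sS.
    by apply: contra hi => hS; apply/mapP; exists (s + i)%N => //; lia.
  - move=> i hi; exists (i - s)%N; case: (leqP s i) => [|is_]; first lia.
    by case: hi; rewrite bin_small // scale0r.
(* Only modes of [u] congruent to [r] are nonzero, so [A = a + T n]; the sign of [n] separates the
   two orders. *)
rewrite [RHS](fsum_reindex (h := fun n : int => a + T%:Z * n)); last first.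
- move=> A hA; have : (A %% T%:Z)%Z = r%:Z.
    by apply/eqP; apply: contraT => /f0 fA; case: hA; rewrite -/(f A) fA scaler0.
  rewrite -ar => e; exists ((A %/ T%:Z)%Z - (a %/ T%:Z)%Z).
  rewrite [LHS](divz_eq A T%:Z) e [X in _ = X + _](divz_eq a T%:Z); ring.
- case: fF => S sS; exists [seq ((A - a) %/ T%:Z)%Z | A <- S] => n hn /=.
  rewrite -/f sS ?scaler0 //; apply: contra hn => hS; apply/mapP.
  exists (a + T%:Z * n) => //; rewrite addrC addKr mulKz //; lia.
- by move=> x y /addrI; apply: mulfI; lia.
rewrite fsum_int_split; last first.
  case: fF => S sS; exists [seq ((A - a) %/ T%:Z)%Z | A <- S] => n hn /=.
  rewrite -/f sS ?scaler0 //; apply: contra hn => hS; apply/mapP.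
  exists (a + T%:Z * n) => //; rewrite addrC addKr mulKz //; lia.
have xa (n : int) : a%:~R / T%:R + xT R T (a + T%:Z * n) = - (n%:~R) - 1.
  by rewrite xT_shift // /xT; ring.
rewrite addrC; congr (_ + _).
  rewrite -fsumZ; last first.
    case: fF => S sS; exists [seq absz ((A - a) %/ T%:Z)%Z | A <- S] => n hn /=.
    rewrite sS ?scaler0 //; apply: contra hn => hS; apply/mapP.
    exists (a + T%:Z * n%:Z) => //; rewrite addrC addKr mulKz //; lia.
  apply: eq_fsum => i; rewrite xa binc_opp scalerA -natrD binc_nat; congr (_ * _%:R *: _).
  by rewrite -(bin_sub (leq_addr i s)) addKn addnC -(bin_sub (leq_addl i s)) addnK.
apply: eq_fsum => m; rewrite xa; have -> : - (Negz m)%:~R - 1 = m%:R :> C.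
  by rewrite NegzE mulrNz opprK -[m.+1%:~R]/(m.+1%:R) -natr1 addrK.
by rewrite binc_nat; congr (_ *: f _); lia.
Qed.

(** For [l >= K] the left side is zero and commutativity cancels the right side. For [l = K - 1 - s]
    both sides are the [s]-th moment weighted by [(1 + y)^(a/T)]. *)
Lemma jac_of_star K : star K u v w -> prcomm K u v w ->
  forall l a b, (a %% T%:Z)%Z = r%:Z -> nsum_eq (jacL l a b) (jacR l a b).
Proof.
move=> [tr z s1] cm l a b ar; apply/jac_fsum.
have [Kl|lK] := leP K%:Z l.
  rewrite fsum0; last by move=> i; rewrite /jacL z ?scaler0 //; lia.
  case: l Kl => // l Kl; rewrite jacR_nonneg (prcomm_mono _ cm) ?scalerA; last by lia.
  by rewrite subrr.
have [s el] : exists s : nat, l = K%:Z - 1 - s%:Z by exists (absz (K%:Z - 1 - l)%R); lia.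
rewrite el jacR_star //; set c := a + b + _.
have fF : finsupp (pp K u v w c) by apply: pp_finsupp.
have := (mom_solve T0 (a%:~R / T%:R) (fun s : nat => mom T (pp K u v w c) s) fF).2
  (fun=> erefl) s => <-.
rewrite (@fsum_nat _ _ s.+1); last by move=> i hi; rewrite /jacL z ?scaler0 //; lia.
apply: eq_bigr => i _; rewrite /jacL; congr (_ *: _); rewrite -s1.
have -> : (s - i)%N%:Z = s%:Z - i%:Z by have := ltn_ord i; lia.
by congr (YM (Y _ _ _) _ _); rewrite /c; lia.
Qed.

(** At [l = K] the Jacobi identity is commutativity, which also bounds the index of [u] in the
    product. At [l = K - 1 - s] and [a = r] it gives weighted moments, and [mom_solve] removes the
    weight. *)
Lemma star_of_jac K : (r < T)%N -> (forall j : int, K%:Z <= j -> Y u j v = 0) ->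
  (forall l a b, (a %% T%:Z)%Z = r%:Z -> nsum_eq (jacL l a b) (jacR l a b)) -> star K u v w.
Proof.
move=> rT hK J.
have cm : prcomm K u v w.
  move=> A B; have [Ar|Ar] := eqVneq (A %% T%:Z)%Z r%:Z.
    have /jac_fsum := J K%:Z A B Ar; rewrite jacR_nonneg fsum0 => [/esym/eqP|i].
      by rewrite subr_eq0 => /eqP.
    by rewrite /jacL hK ?M0l ?scaler0 //; lia.
  rewrite /phi_prod !big1 ?scaler0 // => i _.
    by rewrite [YM u _ w]ucl ?M0r ?scaler0 // [T%:Z * _]mulrC addrC modzMDl.
  by rewrite ucl ?scaler0 // [T%:Z * _]mulrC addrC modzMDl.
have tr : prtrunc K u v w.
  have [N1 h1] := utr; have [N2 h2] := vtr; exists (Num.max N1 N2) => A B [hA|hB].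
    rewrite cm /phi_prod big1 ?scaler0 // => i _; rewrite h1 ?M0r ?scaler0 //; nia.
  by rewrite /phi_prod big1 // => i _; rewrite h2 ?M0r ?scaler0 //; nia.
split=> //; first by move=> j k hj; rewrite hK // M0l.
move=> c; have fF : finsupp (pp K u v w c) by apply: pp_finsupp.
apply/(mom_solve T0 (r%:R / T%:R) _ fF) => s.
pose l := K%:Z - 1 - s%:Z; pose b := c - r%:Z - T%:Z * l.
have rr : (r%:Z %% T%:Z)%Z = r%:Z by rewrite modz_small //; lia.
have /jac_fsum := J l r%:Z b rr; rewrite jacR_star //.
have -> : r%:Z + b + T%:Z * (K%:Z - 1 - s%:Z) = c by rewrite /b /l; lia.
move=> <-; rewrite (@fsum_nat _ _ s.+1); last first.
  by move=> i hi; rewrite /jacL hK ?M0l ?scaler0 // /l; lia.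
apply: eq_bigr => i _; rewrite /jacL; congr (_ *: _).
have -> : (s - i)%N%:Z = s%:Z - i%:Z by have := ltn_ord i; lia.
by congr (YM (Y _ _ _) _ _); rewrite /b /l; lia.
Qed.

End Jac.
End Star.

(** * The phi-coordinated axiom *)

Section StarPhi.
Variables (R : realType) (V : lmodType R[i]) (Y : V -> int -> V -> V) (vac om : V)
  (wt : int -> V -> Prop) (T : nat).
Hypothesis HV : is_VOA Y vac om wt.
Hypothesis T0 : (0 < T)%N.
Variables (M : lmodType R[i]) (YM YW : V -> int -> M -> M).
Hypothesis rl : rel T HV YM YW.
Local Notation C := (R[i]).
Local Notation PS := (PSI HV).

Let L : linV YM. Proof. by case: rl. Qed.
Let LW : linV YW. Proof. by case: rl. Qed.
Let Lv k x := fun a u u' => L a u u' k x.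
Let LWv k x := fun a u u' => LW a u u' k x.

Definition phiax (K : nat) (u v : V) (w : M) : Prop :=
     (exists N : int, forall A B : int, (N <= A \/ N <= B) ->
         phi_prod T YW K u v w A B = 0) /\
     (forall t c : int, exists M0 : nat, forall M : nat, (M0 <= M)%N ->
         \sum_(s < M) expm1_pow_coef R K s *:
             YW (Y u (s%:Z - t - 1) v) (c + K%:Z * T%:Z) w
         = match t with
           | Negz _ => 0
           | Posz t' =>
             \sum_(i < 2 * M)
               (((- ((i%:Z - M%:Z) + T%:Z))%:~R / T%:R) ^+ t' / (t'`!)%:R) *:
               phi_prod T YW K u v w (i%:Z - M%:Z) (c - T%:Z - (i%:Z - M%:Z))
           end).

Section Homog.
Variables (p q : int) (u v : V) (w : M).
Hypotheses (up : wt p u) (vq : wt q v).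

Lemma phi_prod_rel K A B : phi_prod T YW K (PS u) (PS v) w A B =
  phi_prod T YM K u v w (A + T%:Z * p) (B + T%:Z * q).
Proof.
have [_ _ e] := rl; apply: eq_bigr => i _.
rewrite (e p) // (e q) //; congr (_ *: YM u _ (YM v _ _)); lia.
Qed.

Lemma prtrunc_rel K : prtrunc T YW K (PS u) (PS v) w <-> prtrunc T YM K u v w.
Proof.
split=> -[N hN].
  exists (N + T%:Z * p + `|T%:Z * p| + T%:Z * q + `|T%:Z * q| + `|T%:Z * p| + `|T%:Z * q|) => A B h.
  have := hN (A - T%:Z * p) (B - T%:Z * q); rewrite phi_prod_rel !subrK; apply; lia.
exists (N + `|T%:Z * p| + `|T%:Z * q|) => A B h; rewrite phi_prod_rel hN //; lia.
Qed.

(** The coefficient of [y^(-j-1)]: the mode index is adjusted so that the total [k] does not depend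
    on [j]. *)
Definition EE (k j : int) : M := YM (Y u j v) (k - T%:Z * j) w.

Lemma EE_trunc : exists J : nat, forall k j, J%:Z <= j -> EE k j = 0.
Proof.
by have [K h] := Ytrunc HV u v; exists K => k j hj; rewrite /EE h // (lin_0 (Lv _ _)).
Qed.

Lemma EEsupp (K : nat) t k : exists J : nat,
  forall j : int, j < - J%:Z \/ J%:Z <= j -> cz (K%:Z - 1 - j) (p%:~R : C) t *: EE k j = 0.
Proof.
have [J hJ] := EE_trunc; exists (J + absz t + K + 1)%N => j [h|h].
  by rewrite cz_neg ?scale0r //; lia.
by rewrite hJ ?scaler0 //; lia.
Qed.

Lemma YW_PSI_Y n k : YW (Y (PS u) n (PS v)) k w =
  fsum (fun j : int => cz (- j - 1) (p%:~R : C) (- n - 1) *: EE (k + T%:Z * (p + q - 1)) j).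
Proof.
rewrite (Y_PSI HV _ _ up) /brak.
have e x y a : YW (PS (a *: x + y)) k w = a *: YW (PS x) k w + YW (PS y) k w.
  by rewrite (PSI_lin HV) LW.
rewrite (lin_fsum (fun a x y => e x y a)); last exact: (brak_finsupp HV).
rewrite [RHS](fsum_reindex (h := fun i : nat => n + i%:Z)).
- apply: eq_fsum => i; rewrite (lin_Z (fun a x y => e x y a)); congr (_ *: _).
    by rewrite /cz; congr (ck _ _ _); lia.
  case: rl => _ _ h; rewrite (h (p + q - (n + i%:Z) - 1)); last exact: (wt_Y HV).
  by rewrite /EE; congr (YM _ _ _); lia.
- by move=> x y /addrI [].
- have [J hJ] := EE_trunc; apply: (finsupp_nat (K := absz (J%:Z - n)%R)) => i hi /=.
  by rewrite hJ ?scaler0 //; lia.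
move=> j hj; exists (absz (j - n)%R); have [jn|jn] := ltP j n; last by lia.
by case: hj; rewrite cz_neg ?scale0r //; lia.
Qed.

(** In [YW] the vector [u_j v] comes with [e^(p x0) (e^x0 - 1)^(-j-1)]; the factor [(e^x0 - 1)^K] of
    the axiom raises the power to [K - 1 - j]. *)
Lemma phiL (K : nat) t k : exists M0 : nat, forall N, (M0 <= N)%N ->
  \sum_(s < N) expm1_pow_coef R K s *: YW (Y (PS u) (s%:Z - t - 1) (PS v)) k w =
  fsum (fun j : int => cz (K%:Z - 1 - j) (p%:~R : C) t *: EE (k + T%:Z * (p + q - 1)) j).
Proof.
have [J hJ] := EE_trunc; pose B := (J + absz t + K + 1)%N.
exists (absz t + B + 2)%N => N hN; set k' := k + _.
rewrite (fsumE (zrange_uniq B)); last first.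
  move=> j; rewrite mem_zrange => hj; have [jJ|jJ] := ltP j J%:Z; last by rewrite hJ ?scaler0.
  by rewrite cz_neg ?scale0r //; lia.
transitivity (\sum_(s < N) \sum_(j <- zrange B) (expm1_pow_coef R K s *
   cz (- j - 1) (p%:~R : C) (t - s%:Z)) *: EE k' j).
  apply: eq_bigr => s _; rewrite YW_PSI_Y -/k'.
  have -> : - (s%:Z - t - 1) - 1 = t - s%:Z by lia.
  rewrite (fsumE (zrange_uniq B)) ?scaler_sumr; first by apply: eq_bigr => j _; rewrite scalerA.
  move=> j; rewrite mem_zrange => hj; have [jJ|jJ] := ltP j J%:Z; last by rewrite hJ ?scaler0.
  by rewrite cz_neg ?scale0r //; lia.
rewrite exchange_big /= big_seq [RHS]big_seq; apply: eq_bigr => j; rewrite mem_zrange => hj.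
rewrite -scaler_suml cz_conv; last by lia.
by congr (cz _ _ _ *: _); lia.
Qed.

(** Moments extended by zero: with [s = K - 1 - j], negative [s] encodes the vanishing of [u_j v]
    for [j >= K]. *)
Definition mz (K : nat) k (s : int) : M :=
  match s with Posz s => mom T (pp T YM K u v w k) s | Negz _ => 0 end.

(** Twisting by [x^(L(0))] changes the exponent of [e^x0] to [xT A + p]; [cz_binc] separates
    [e^(p x0)] from [(1 + y)^(xT A)], whose coefficients form the moments. *)
Lemma phiR (K t : nat) c : prtrunc T YM K u v w -> exists M0 : nat, forall N, (M0 <= N)%N ->
  \sum_(i < 2 * N) (((- ((i%:Z - N%:Z) + T%:Z))%:~R / T%:R : C) ^+ t / (t`!)%:R) *:
     phi_prod T YW K (PS u) (PS v) w (i%:Z - N%:Z) (c - T%:Z - (i%:Z - N%:Z)) =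
  fsum (fun s : int => cz s (p%:~R : C) t%:Z *: mz K (c + K%:Z * T%:Z + T%:Z * (p + q - 1)) s).
Proof.
move=> tr; have trW := (prtrunc_rel K).2 tr; set k := c + _ + _.
pose F (A : int) : M := ((- (A + T%:Z))%:~R / T%:R : C) ^+ t / (t`!)%:R *:
  phi_prod T YW K (PS u) (PS v) w A (c - T%:Z - A).
have [N1 h1] := trW.
have FB A : A < c - T%:Z - N1 + 1 \/ N1 <= A -> F A = 0.
  by move=> hA; rewrite /F h1 ?scaler0 //; lia.
have [M0 hM] := fsum_int_large FB; exists M0 => N /hM ->.
have fF : finsupp F by apply: finsupp_int FB.
pose f := pp T YM K u v w k.
have ff : finsupp f by apply: pp_finsupp.
rewrite -(fsum_shift (- (T%:Z * p)) fF).
transitivity (fsum (fun A => \sum_(s < t.+1) (cz s%:Z (p%:~R : C) t%:Z * binc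
  (xT R T A) s) *: f A)).
  apply: eq_fsum => A; rewrite /F phi_prod_rel -scaler_suml -cz_binc /f /pp.
  have -> : (- (A - T%:Z * p + T%:Z))%:~R / T%:R = xT R T A + p%:~R :> C.
    by rewrite /xT rmorphN !rmorphD rmorphN rmorphM /=; field; exact: Tneq0.
  congr (_ *: _); congr (phi_prod _ _ _ _ _ _ _ _); rewrite ?subrK // /k; lia.
have [S sS] := ff; have sS' := suppin_undup sS.
rewrite (@fsumE _ _ _ (undup S)) ?undup_uniq //; last first.
  by move=> A /sS' e; rewrite big1 // => s _; rewrite e scaler0.
rewrite exchange_big /=.
transitivity (\sum_(s < t.+1) cz s%:Z (p%:~R : C) t%:Z *: mz K k s%:Z).
  apply: eq_bigr => s _; rewrite /= /mom (@fsumE _ _ _ (undup S)) ?undup_uniq //.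
    by rewrite scaler_sumr; apply: eq_bigr => A _; rewrite scalerA.
  by move=> A /sS' e; rewrite -/f e scaler0.
pose G (s : int) := cz s (p%:~R : C) t%:Z *: mz K k s.
rewrite [RHS](fsum_reindex (h := Posz) (F := G)).
- by rewrite (@fsum_nat _ _ t.+1) // => s hs; rewrite /G cz_neg ?scale0r //; lia.
- by move=> x y [].
- by apply: (finsupp_nat (K := t.+1)) => s hs; rewrite /= /G cz_neg ?scale0r //; lia.
by case=> s hs; [exists s | case: hs; rewrite /G scaler0].
Qed.

Lemma phiax_eq K : phiax K (PS u) (PS v) w <-> prtrunc T YM K u v w /\
  forall k t : int, fsum (fun j : int => cz (K%:Z - 1 - j) (p%:~R : C) t *: EE k j) =
             fsum (fun s : int => cz s (p%:~R : C) t *: mz K k s).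
Proof.
have neg k (t : nat) : fsum (fun s : int => cz s (p%:~R : C) (Negz t) *: mz K k s) = 0.
  by apply: fsum0 => -[s|s]; rewrite /= ?scaler0 // cz_neg ?scale0r //; lia.
split=> -[h1 h2].
  have tr := (prtrunc_rel K).1 h1; split=> // k t.
  pose c := k - K%:Z * T%:Z - T%:Z * (p + q - 1).
  have ek : c + K%:Z * T%:Z + T%:Z * (p + q - 1) = k by rewrite /c; lia.
  have [M1 hM1] := phiL K t (c + K%:Z * T%:Z); have [M0 hM0] := h2 t c.
  rewrite ek in hM1; case: t hM1 hM0 => t hM1 hM0; last first.
    by rewrite -(hM1 (M0 + M1)%N) ?leq_addl // hM0 ?leq_addr // neg.
  have [M2 hM2] := phiR t c tr; rewrite ek in hM2.
  rewrite -(hM1 (M0 + M1 + M2)%N); last by lia.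
  by rewrite hM0; [rewrite hM2 //; lia|lia].
split; first exact/(prtrunc_rel K).
move=> t c; set k := c + K%:Z * T%:Z + T%:Z * (p + q - 1).
have [M1 hM1] := phiL K t (c + K%:Z * T%:Z).
case: t hM1 => t hM1.
  have [M2 hM2] := phiR t c h1; exists (M1 + M2)%N => N hN.
  by rewrite hM1 ?hM2 ?h2 //; lia.
by exists M1 => N hN; rewrite hM1 // h2 neg.
Qed.

(** The series [e^(hx) (e^x - 1)^s] starts with [x^s], so a family bounded below is determined by
    its combination of these series. *)
Lemma cz_triangular (h : C) (F : int -> M) (B : int) : (forall s, s < B -> F s = 0) ->
  (forall t, fsum (fun s => cz s h t *: F s) = 0) -> forall s, F s = 0.
Proof.
move=> FB e s; have [sB|sB] := ltP s B; first exact: FB.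
have -> : s = B + (absz (s - B)%R)%:Z by lia.
elim/ltn_ind: (absz _) => n IH.
have := e (B + n%:Z); rewrite (@fsum1 _ _ _ (B + n%:Z)); first by rewrite cz_diag scale1r.
move=> s' hs'; have [lt|le] := ltP (B + n%:Z) s'; first by rewrite cz_neg ?scale0r.
have [sB'|sB'] := ltP s' B; first by rewrite FB ?scaler0.
have -> : s' = B + (absz (s' - B)%R)%:Z by lia.
by rewrite IH ?scaler0 //; lia.
Qed.

(** Both conditions contain the same truncation and amount to [EE k (K - 1 - s) = mz K k s] for all
    integers [s]; for the axiom this follows by cancelling the common series with
    [cz_triangular]. *)
Lemma star_phi K : star Y T YM K u v w <-> phiax K (PS u) (PS v) w.
Proof.
have reidx k t : fsum (fun j : int => cz (K%:Z - 1 - j) (p%:~R : C) t *: EE k j) =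
    fsum (fun s : int => cz s (p%:~R : C) t *: EE k (K%:Z - 1 - s)).
  have [J hJ] := EEsupp K t k.
  rewrite -(fsum_reflect (K%:Z - 1)); last by apply: (finsupp_int hJ).
  by apply: eq_fsum => s; congr (cz _ _ _ *: _); lia.
apply: (iff_trans (B := prtrunc T YM K u v w /\ forall k s, EE k (K%:Z - 1 - s) = mz K k s)).
  split=> [[tr z h]|[tr h]]; split=> //.
  - move=> k [s|s]; first exact: h.
    by rewrite /= /EE z //; lia.
  - move=> j k hj; have := h (k + T%:Z * j) (K%:Z - 1 - j).
    rewrite /EE; have -> : K%:Z - 1 - (K%:Z - 1 - j) = j by lia.
    rewrite addrK => ->; case E : (K%:Z - 1 - j) => [s|s] //; lia.
  - by move=> c s; apply: (h c s%:Z).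
apply: iff_trans (iff_sym (phiax_eq K)).
split=> -[tr h]; split=> // k.
  move=> t; rewrite reidx; apply: eq_fsum => s; by rewrite h.
have [J hJ] := EE_trunc.
move=> s; apply/eqP; rewrite -subr_eq0; apply/eqP; move: s.
have f1 t : finsupp (fun s : int => cz s (p%:~R : C) t *: EE k (K%:Z - 1 - s)).
  apply: (finsupp_int (a := - J%:Z) (b := `|t| + 1)) => s [hs|hs].
    by rewrite hJ ?scaler0 //; lia.
  by rewrite cz_neg ?scale0r //; lia.
have f2 t : finsupp (fun s : int => cz s (p%:~R : C) t *: - mz K k s).
  apply: (finsupp_int (a := 0) (b := `|t| + 1)) => s [hs|hs].
    by case: s hs => // s _; rewrite oppr0 scaler0.
  by rewrite cz_neg ?scale0r //; lia.
apply: (@cz_triangular p%:~R (fun s => EE k (K%:Z - 1 - s) - mz K k s) (- J%:Z)).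
  by move=> [s|s] hs; [lia | rewrite /= subr0 hJ //; lia].
move=> t; under eq_fsum do rewrite scalerDr.
rewrite fsumD // -reidx h -fsumD //; last first.
  have [S sS] := f2 t; exists S => s /sS /eqP; rewrite scalerN oppr_eq0 => /eqP //.
by apply: fsum0 => s; rewrite -scalerDr subrr scaler0.
Qed.

End Homog.

End StarPhi.

(** * Additivity of the phi-coordinated axiom in both vectors *)

Section PhiAx.
Variables (R : realType) (V : lmodType R[i]) (Y : V -> int -> V -> V) (vac om : V)
  (wt : int -> V -> Prop) (T : nat).
Hypothesis HV : is_VOA Y vac om wt.
Variables (M : lmodType R[i]) (YW : V -> int -> M -> M).
Local Notation C := (R[i]).
Hypothesis LW : linV YW.
Hypothesis LX : forall u k (a : C) x y, YW u k (a *: x + y) = a *: YW u k x + YW u k y.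

Let LWv k x := fun a u u' => LW a u u' k x.

Lemma phi_prodDl K u u' v w A B :
  phi_prod T YW K (u + u') v w A B = phi_prod T YW K u v w A B + phi_prod T YW K u' v w A B.
Proof.
rewrite /phi_prod -big_split /=; apply: eq_bigr => i _.
by rewrite (lin_D (LWv _ _)) scalerDr.
Qed.

Lemma phi_prodDr K u v v' w A B :
  phi_prod T YW K u (v + v') w A B = phi_prod T YW K u v w A B + phi_prod T YW K u v' w A B.
Proof.
rewrite /phi_prod -big_split /=; apply: eq_bigr => i _.
by rewrite (lin_D (LWv _ _)) (lin_D (LX _ _)) scalerDr.
Qed.

Lemma phiaxD K u v w u1 v1 u2 v2 :
  (forall A B, phi_prod T YW K u v w A B = phi_prod T YW K u1 v1 w A B
    + phi_prod T YW K u2 v2 w A B) ->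
  (forall n, Y u n v = Y u1 n v1 + Y u2 n v2) ->
  phiax Y T YW K u1 v1 w -> phiax Y T YW K u2 v2 w -> phiax Y T YW K u v w.
Proof.
move=> eP eY [[N1 h1] e1] [[N2 h2] e2]; split.
  exists (Num.max N1 N2) => A B h; rewrite eP h1 ?h2 ?addr0 //; lia.
move=> t c; have [M1 hM1] := e1 t c; have [M2 hM2] := e2 t c.
exists (M1 + M2)%N => N hN.
under eq_bigr do rewrite eY (lin_D (LWv _ _)) scalerDr.
rewrite big_split /= hM1 ?hM2; [|lia|lia].
case: t {e1 e2 hM1 hM2} => t; last by rewrite addr0.
by rewrite -big_split /=; apply: eq_bigr => i _; rewrite eP scalerDr.
Qed.

Lemma phiax0 K u v w : u = 0 \/ v = 0 -> phiax Y T YW K u v w.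
Proof.
move=> h.
have e0 A B : phi_prod T YW K u v w A B = 0.
  rewrite /phi_prod big1 // => i _.
  case: h => ->; first by rewrite (lin_0 (LWv _ _)) scaler0.
  by rewrite (lin_0 (LWv _ w)) (lin_0 (LX _ _)) scaler0.
have eY n : Y u n v = 0 by case: h => ->; rewrite ?(Y0l HV) ?(Y0r HV).
split; first by exists 0.
move=> t c; exists 0%N => N _; rewrite big1 => [|s _]; last by rewrite eY (lin_0 (LWv _ _)) scaler0.
by case: t => // t; rewrite big1 // => i _; rewrite e0 scaler0.
Qed.

End PhiAx.

Lemma nsum_eqD (U : zmodType) (f f1 f2 h h1 h2 : nat -> U) :
  (forall i, f i = f1 i + f2 i) -> (forall i, h i = h1 i + h2 i) ->
  nsum_eq f1 h1 -> nsum_eq f2 h2 -> nsum_eq f h.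
Proof.
move=> ef eh [K1 e1] [K2 e2]; exists (K1 + K2)%N => K hK.
under eq_bigr do rewrite ef; under [RHS]eq_bigr do rewrite eh.
by rewrite !big_split /= e1 ?e2 //; lia.
Qed.

Lemma nsum_eq0 (U : zmodType) (f h : nat -> U) :
  (forall i, f i = 0) -> (forall i, h i = 0) -> nsum_eq f h.
Proof. by move=> ef eh; exists 0%N => K _; rewrite !big1. Qed.

(** * Weak twisted modules correspond to phi-coordinated modules *)

Section Equivalence.
Variables (R : realType) (V : lmodType R[i]) (Y : V -> int -> V -> V) (vac om : V)
  (wt : int -> V -> Prop) (g : V -> V) (T : nat).
Hypothesis HV : is_VOA Y vac om wt.
Hypothesis HA : is_VOA_aut Y om g.
Hypothesis HT : has_order g T.
Variables (M : lmodType R[i]) (YM YW : V -> int -> M -> M).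
Hypothesis rl : rel T HV YM YW.
Local Notation C := (R[i]).
Local Notation PS := (PSI HV).

Let T0 : (0 < T)%N. Proof. exact: T_gt0 HT. Qed.
Let L : linV YM. Proof. by case: rl. Qed.
Let LW : linV YW. Proof. by case: rl. Qed.
Let e : forall p v k x, wt p v -> YW (PS v) k x = YM v (k + T%:Z * p) x. Proof. by case: rl. Qed.
Let Lv k x := fun a u u' => L a u u' k x.
Let LWv k x := fun a u u' => LW a u u' k x.

Lemma rel_linX : (forall u k (a : C) x y, YM u k (a *: x + y) = a *: YM u k x + YM u k y) <->
  (forall u k (a : C) x y, YW u k (a *: x + y) = a *: YW u k x + YW u k y).
Proof.
split=> h u k a x y.
  apply: (rel_W_ind rl (P := fun f => f (a *: x + y) = a *: f x + f y)).
  - by rewrite scaler0 addr0.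
  - by move=> f f' hf hf'; rewrite hf hf' scalerDr addrACA.
  - by move=> *; apply: h.
apply: (rel_M_ind rl (P := fun f => f (a *: x + y) = a *: f x + f y)).
- by rewrite scaler0 addr0.
- by move=> f f' hf hf'; rewrite hf hf' scalerDr addrACA.
- by move=> *; apply: h.
Qed.

Lemma PSI_ind (P : V -> Prop) : P 0 -> (forall x y, P x -> P y -> P (x + y)) ->
  (forall p v, wt p v -> P (PS v)) -> forall v, P v.
Proof.
move=> P0 PD Pw v; rewrite -(PSIK HV v); move: (PHI Y om v) => {}v.
apply: (wt_ind HV (P := fun v => P (PS v))) v => //.
- by rewrite (lin_0 (PSI_lin HV)).
- by move=> x y Px Py; rewrite (lin_D (PSI_lin HV)); apply: PD.
Qed.

Lemma rel_trunc : (forall v x, exists N : int, forall k, N <= k -> YM v k x = 0) <->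
  (forall v x, exists N : int, forall k, N <= k -> YW v k x = 0).
Proof.
split=> h v x.
  apply: (PSI_ind (P := fun v => exists N : int, forall k, N <= k -> YW v k x = 0)) v.
  - by exists 0 => k _; rewrite (lin_0 (LWv _ _)).
  - move=> u u' [N hN] [N' hN']; exists (Num.max N N') => k hk.
    by rewrite (lin_D (LWv _ _)) hN ?hN' ?addr0 //; lia.
  move=> p v vp; have [N hN] := h v x; exists (N - T%:Z * p) => k hk.
  by rewrite (e _ _ vp) hN //; lia.
apply: (wt_ind HV (P := fun v => exists N : int, forall k, N <= k -> YM v k x = 0)) v.
- by exists 0 => k _; rewrite (lin_0 (Lv _ _)).
- move=> u u' [N hN] [N' hN']; exists (Num.max N N') => k hk.
  by rewrite (lin_D (Lv _ _)) hN ?hN' ?addr0 //; lia.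
move=> p v vp; have [N hN] := h (PS v) x; exists (N + T%:Z * p) => k hk.
by have := e (k - T%:Z * p) x vp; rewrite subrK => <-; apply: hN; lia.
Qed.

Lemma rel_vac : (forall k x, YM vac k x = if k == - T%:Z then x else 0) <->
  (forall k x, YW vac k x = if k == - T%:Z then x else 0).
Proof.
have h k x : YW vac k x = YM vac k x.
  by rewrite -{1}(PSI_vac HV) (e _ _ (wt_vac HV)) mulr0 addr0.
by split=> H k x; [rewrite h|rewrite -h].
Qed.

Lemma weak_twisted_trunc : is_weak_twisted Y vac g T YM ->
  forall v x, exists N : int, forall k, N <= k -> YM v k x = 0.
Proof.
move=> [_ [_ [_ [_ [h _]]]]] v x.
apply: (homog_ind HV HA HT (P := fun v => exists N : int, forall k, N <= k -> YM v k x = 0)) v.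
- by exists 0 => k _; rewrite (lin_0 (Lv _ _)).
- move=> u u' [N hN] [N' hN']; exists (Num.max N N') => k hk.
  by rewrite (lin_D (Lv _ _)) hN ?hN' ?addr0 //; lia.
by move=> p r v rT ev _; apply: h rT ev.
Qed.

Lemma star_of_twisted : is_weak_twisted Y vac g T YM ->
  forall (r : nat) u v, (r < T)%N -> eigsp g T r u ->
  exists K : nat, forall w, star Y T YM K u v w.
Proof.
move=> wk r u v rT eu; have tr := weak_twisted_trunc wk.
have [_ [LX [cl [vc [_ J]]]]] := wk; have [K hK] := Ytrunc HV u v; exists K => w.
have ucl k x : (k %% T%:Z)%Z != r%:Z -> YM u k x = 0 by move=> hk; apply: cl rT eu hk.
apply: (star_of_jac T0 L LX HV ucl (tr u w) (tr v w) rT hK) => l a b ar.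
exact: (J r u v w l a b rT eu ar).
Qed.

Lemma phi_of_twisted : is_weak_twisted Y vac g T YM -> is_phi_coordinated Y vac g T YW.
Proof.
move=> wk; have tr := weak_twisted_trunc wk; have [_ [LX [cl [vc [_ J]]]]] := wk.
have LXW := rel_linX.1 LX.
split; first exact: LW.
split; first exact: LXW.
split; first exact/rel_trunc.
split; first exact/rel_vac.
split.
  move=> v k x; rewrite -(PSIK HV v); move: (PHI Y om v) => {}v; rewrite (g_PSI HV HA).
  apply: (homog_ind HV HA HT (P := fun v => YW (PS (g v)) k x = omegaT R T ^ k *: YW (PS v) k x)) v.
  - by rewrite (lin_0 (g_lin HA)) (lin_0 (PSI_lin HV)) (lin_0 (LWv _ _)) scaler0.
  - move=> u u' h h'; rewrite (lin_D (g_lin HA)) !(lin_D (PSI_lin HV)) !(lin_D (LWv _ _)).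
    by rewrite h h' scalerDr.
  move=> p r v rT ev vp; rewrite ev (lin_Z (PSI_lin HV)) (lin_Z (LWv _ _)) (e _ _ vp).
  have [kr|kr] := eqVneq (k %% T%:Z)%Z r%:Z.
    by move/eqP: kr; rewrite -(omegaT_eq R T0 k rT) => /eqP ->.
  by rewrite (cl r) ?scaler0 // addrC mulrC modzMDl.
move=> u v.
(* Asserted for all large [K], uniformly in [w], so that the values found for homogeneous components
   can be merged. *)
suff [K hK] : exists K0 : nat, forall K, (K0 <= K)%N -> forall w, phiax Y T YW K u v w.
  by exists K; apply: hK.
rewrite -(PSIK HV u) -(PSIK HV v); move: (PHI Y om u) (PHI Y om v) => {}u {}v.
apply: (homog_ind HV HA HT (P := fun u => exists K0 : nat, forall K, (K0 <= K)%N ->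
   forall w, phiax Y T YW K (PS u) (PS v) w)) u.
- by exists 0%N => K _ w; apply: (phiax0 T HV LW LXW); left; rewrite (lin_0 (PSI_lin HV)).
- move=> u u' [K hK] [K' hK']; exists (maxn K K') => K1; rewrite geq_max => /andP[/hK h /hK' h'] w.
  rewrite (lin_D (PSI_lin HV)); apply: (phiaxD LW _ _ (h w) (h' w)) => *; first exact: phi_prodDl.
  exact: lin_D (YlinL HV _ _) _ _.
move=> p r u rT eu up.
apply: (wt_ind HV (P := fun v => exists K0 : nat, forall K, (K0 <= K)%N ->
   forall w, phiax Y T YW K (PS u) (PS v) w)) v.
- by exists 0%N => K _ w; apply: (phiax0 T HV LW LXW); right; rewrite (lin_0 (PSI_lin HV)).
- move=> v v' [K hK] [K' hK']; exists (maxn K K') => K1; rewrite geq_max => /andP[/hK h /hK' h'] w.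
  rewrite (lin_D (PSI_lin HV)); apply: (phiaxD LW _ _ (h w) (h' w)) => *; first exact: phi_prodDr.
  exact: lin_D (YlinR HV _ _) _ _.
move=> q v vq; have [K hK] := star_of_twisted wk v rT eu; exists K => K' KK' w.
by apply/(star_phi T0 rl w up vq); apply: star_mono KK' (hK w).
Qed.

Lemma twisted_of_phi : is_phi_coordinated Y vac g T YW -> is_weak_twisted Y vac g T YM.
Proof.
move=> [_ [LXW [trW [vcW [gW ax]]]]].
have LX := rel_linX.2 LXW; have tr := rel_trunc.2 trW; have vc := rel_vac.2 vcW.
have cl (r : nat) u (k : int) x : (r < T)%N -> eigsp g T r u ->
      (k %% T%:Z)%Z != r%:Z -> YM u k x = 0.
  move=> rT eu kr; apply: (eig_ind HV HA HT rT (P := fun u => YM u k x = 0)) eu.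
  - exact: lin_0 (Lv k x).
  - by move=> y z hy hz; rewrite (lin_D (Lv k x)) hy hz addr0.
  (* The shift [T p] keeps the residue of [k], so condition (ii) equates the mode with its multiple
     by a ratio different from 1 unless [k] is congruent to [r]. *)
  move=> p {}u eu up; have := gW (PS u) (k - T%:Z * p) x.
  rewrite (g_PSI HV HA) eu (lin_Z (PSI_lin HV)) (lin_Z (LWv _ _)) (e _ _ up) subrK.
  move=> /eqP; rewrite -subr_eq0 -scalerBl scaler_eq0 => /orP[|/eqP //].
  rewrite subr_eq0 eq_sym (omegaT_eq R T0 _ rT) addrC -mulrN mulrC modzMDl.
  by rewrite (negbTE kr).
have st p q u v : wt p u -> wt q v -> exists K, forall w, star Y T YM K u v w.
  move=> up vq; have [K hK] := ax (PS u) (PS v); exists K => w.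
  by apply/(star_phi T0 rl w up vq); apply: hK.
split=> //; split=> //; split=> //; split=> //; split; first by move=> *; apply: tr.
move=> r u v x l a b rT eu ar.
apply: (eig_ind HV HA HT rT (P := fun u => nsum_eq (jacL Y T YM u v x l a b)
  (jacR T YM u v x l a b))) eu.
- apply: nsum_eq0 => i; rewrite /jacL /jacR.
    by rewrite (Y0l HV) (lin_0 (Lv _ _)) scaler0.
  by rewrite !(lin_0 (Lv _ _)) (lin_0 (LX _ _)) scaler0 subrr scaler0.
- move=> y z; apply: nsum_eqD => i; rewrite /jacL /jacR.
    by rewrite (lin_D (YlinL HV _ _)) (lin_D (Lv _ _)) scalerDr.
  rewrite !(lin_D (Lv _ _)) (lin_D (LX _ _)) -scalerDr; congr (_ *: _).
  by rewrite scalerDr opprD addrACA.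
move=> p {}u eu up.
apply: (wt_ind HV (P := fun v => nsum_eq (jacL Y T YM u v x l a b) (jacR T YM u v x l a b))) v.
- apply: nsum_eq0 => i; rewrite /jacL /jacR.
    by rewrite (Y0r HV) (lin_0 (Lv _ _)) scaler0.
  by rewrite !(lin_0 (Lv _ _)) (lin_0 (LX _ _)) scaler0 subrr scaler0.
- move=> y z; apply: nsum_eqD => i; rewrite /jacL /jacR.
    by rewrite (lin_D (YlinR HV _ _)) (lin_D (Lv _ _)) scalerDr.
  rewrite !(lin_D (Lv _ _)) (lin_D (LX _ _)) -scalerDr; congr (_ *: _).
  by rewrite scalerDr opprD addrACA.
move=> q v vq.
have [K1 s1] := st _ _ _ _ up vq; have [K2 s2] := st _ _ _ _ vq up.
have s1' := star_mono T0 (leq_maxl K1 K2) (s1 x); have s2' := star_mono T0 (leq_maxr K1 K2) (s2 x).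
apply: (jac_of_star T0 L LX HV (r := r) _ _ _ s1') => //.
- by move=> k y; apply: cl rT eu.
- apply: (star_comm T0 L HV s2' s1') => j i k.
  (* Skew symmetry uses the derivative property of the vectors [v_j u]; these are homogeneous, so
     [star] holds for them paired with the vacuum. *)
  have [K3 s3] := st _ _ _ _ (wt_Y HV j vq up) (wt_vac HV).
  exact: (star_vac T0 LX vc (s3 x)).
Qed.

End Equivalence.

(** * Irreducible modules *)

Section Uncountable.
Variable R : realType.
Local Notation C := (R[i]).

(** Nested intervals: at each step a third avoiding [u n] is kept, and the supremum of the left ends
    lies in all of them. *)
Lemma real_uncountable (u : nat -> R) : exists x, forall n, u n <> x.
Proof.
pose step n (I : R * R) : R * R := let d := (I.2 - I.1) / 3 in
  if u n <= I.1 + d then (I.1 + 2 * d, I.2) else (I.1, I.1 + d).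
pose I := fix I n : R * R := if n is n'.+1 then step n' (I n') else (0, 1).
have IS n : I n.+1 = step n (I n) by [].
have lt n : (I n).1 < (I n).2.
  elim: n => [|n IH]; first exact: ltr01.
  by rewrite IS /step; case: ifP => _ /=; lra.
have mono n : (I n).1 <= (I n.+1).1 /\ (I n.+1).2 <= (I n).2.
  by have := lt n; rewrite IS /step; case: ifP => _ /=; lra.
have mono1 n k : (I n).1 <= (I (n + k)%N).1.
  by elim: k => [|k IH]; rewrite ?addn0 // addnS; have [h _] := mono (n + k)%N; lra.
have mono2 n k : (I (n + k)%N).2 <= (I n).2.
  by elim: k => [|k IH]; rewrite ?addn0 // addnS; have [_ h] := mono (n + k)%N; lra.
have cross m n : (I m).1 <= (I n).2.
  have := mono1 m n; have := mono2 n m; have := lt (m + n)%N; rewrite addnC; lra.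
pose E : classical_sets.set R := fun x => exists n, x = (I n).1.
have supE : has_sup E.
  by split; [exists (I 0%N).1, 0%N | exists (I 0%N).2 => x [n ->]].
exists (sup E) => n un.
have h1 : (I n.+1).1 <= sup E by apply: (ub_le_sup supE.2); exists n.+1.
have h2 : sup E <= (I n.+1).2 by apply: (ge_sup supE.1) => x [m ->].
move: h1 h2; rewrite IS /step -un; case: ifP => /=; have := lt n; lra.
Qed.

Lemma finite_of_bounded (P : C -> Prop) N :
  (forall s : seq C, uniq s -> (forall a, a \in s -> P a) -> (size s <= N)%N) ->
  exists s : seq C, forall a, P a -> a \in s.
Proof.
move=> h; apply: contrapT => nex.
have ext k : exists s : seq C, [/\ uniq s, forall a, a \in s -> P a & size s = k].
  elim: k => [|k [s [us sP sk]]]; first by exists [::].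
  have [a [Pa aN]] : exists a, P a /\ a \notin s.
    apply: contrapT => na; apply: nex; exists s => a Pa; apply/negPn/negP => aN.
    by apply: na; exists a.
  exists (a :: s); split; rewrite /= ?aN ?us ?sk // => b; rewrite inE => /orP[/eqP ->|/sP] //.
have [s [us sP sk]] := ext N.+1.
by have := h s us sP; rewrite sk ltnn.
Qed.

(** Each [A n] is finite, so the real parts of all their elements form a sequence; a real number
    missed by it belongs to no [A n]. *)
Lemma complex_uncountable (A : nat -> C -> Prop) :
  (forall n (s : seq C), uniq s -> (forall a, a \in s -> A n a) -> (size s <= n)%N) ->
  exists a, forall n, ~ A n a.
Proof.
move=> h.
pose s n := projT1 (cid (finite_of_bounded (h n))).
have sP n a : A n a -> a \in s n by apply: (projT2 (cid (finite_of_bounded (h n)))).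
pose u m : R := if unpickle m is Some q then complex.Re (nth 0 (s q.1) q.2) else 0.
have [x hx] := real_uncountable u.
exists (x%:C)%C => n /sP xs; apply: (hx (pickle (n, index (x%:C)%C (s n)))).
by rewrite /u pickleK /= nth_index.
Qed.

End Uncountable.

(** * Dixmier's argument for an operator on a countably spanned space *)

Section Dixmier.
Variables (R : realType) (U : lmodType R[i]) (D : U -> U).
Local Notation C := (R[i]).
Hypothesis DL : forall (a : C) x y, D (a *: x + y) = a *: D x + D y.

Definition pev (p : {poly C}) (x : U) : U := \sum_(i < size p) p`_i *: iter i D x.

Lemma pevE N (p : {poly C}) x : (size p <= N)%N -> pev p x = \sum_(i < N) p`_i *: iter i D x.
Proof.
move=> pN; rewrite /pev (big_ord_widen N (fun i => p`_i *: iter i D x)) // big_mkcond /=.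
by apply: eq_bigr => i _; case: ifP => // /negbT; rewrite -leqNgt => h;
  rewrite nth_default ?scale0r.
Qed.

Lemma pev_linp x a (p q : {poly C}) : pev (a *: p + q) x = a *: pev p x + pev q x.
Proof.
pose N := (size (a *: p + q)%R + size p + size q)%N.
rewrite !(@pevE N) /N; try lia.
rewrite scaler_sumr -big_split /=; apply: eq_bigr => i _.
by rewrite coefD coefZ scalerDl scalerA.
Qed.

Lemma iterD_lin n (a : C) x y : iter n D (a *: x + y) = a *: iter n D x + iter n D y.
Proof. by elim: n => //= n ->. Qed.

Lemma pev_linx p a x y : pev p (a *: x + y) = a *: pev p x + pev p y.
Proof.
rewrite /pev scaler_sumr -big_split /=; apply: eq_bigr => i _.
by rewrite iterD_lin scalerLin.
Qed.

Lemma pevX (p : {poly C}) x : pev ('X * p) x = pev p (D x).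
Proof.
rewrite (@pevE (size p).+1); last by have := size_polyMleq 'X p; rewrite size_polyX.
rewrite big_ord_recl coefXM /= scale0r add0r (@pevE (size p)) //.
by apply: eq_bigr => i _; rewrite coefXM /= -iterS iterSr.
Qed.

Lemma pevXsubC (p : {poly C}) b x : pev (('X - b%:P) * p) x = pev p (D x - b *: x).
Proof.
have -> : ('X - b%:P) * p = (- b) *: p + 'X * p by rewrite mulrBl mul_polyC scaleNr addrC.
rewrite pev_linp pevX.
by rewrite [D x - _]addrC -scaleNr pev_linx.
Qed.

Lemma pev1 x : pev 1 x = x.
Proof. by rewrite /pev size_poly1 big_ord_recl big_ord0 coef1 scale1r addr0. Qed.

(** Over an algebraically closed field [p(D)] is a nonzero scalar times a product of operators
    [D - z], each injective. *)
Lemma pev_eq0 p x : (forall a y, D y = a *: y -> y = 0) -> p != 0 -> pev p x = 0 -> x = 0.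
Proof.
move=> Hinj p0; have [zs ->] := closed_field_poly_normal p.
rewrite (lin_Z (pev_linp x)) => /eqP; rewrite scaler_eq0 lead_coef_eq0 (negbTE p0) /= => /eqP.
elim: zs x => [|z zs IH] x; first by rewrite big_nil pev1.
rewrite big_cons pevXsubC => /IH /eqP; rewrite subr_eq0 => /eqP; exact: Hinj.
Qed.

(* If every [D - a] is invertible, the vectors [(D - a)^-1 x0] are linearly independent by
   partial fractions, which is too many for a countable spanning family. *)
Lemma dixmier (S : nat -> U) (x0 : U) : x0 <> 0 ->
  (forall x, exists n (c : nat -> C), x = \sum_(i < n) c i *: S i) ->
  (forall a : C, (forall x, D x = a *: x) \/
    ((forall x, D x = a *: x -> x = 0) /\ (forall y, exists x, D x - a *: x = y))) ->
  exists a : C, forall x, D x = a *: x.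
Proof.
move=> x0N span dich; apply: contrapT => nex.
have {dich} dich a : (forall x, D x = a *: x -> x = 0) /\ (forall y, exists x, D x - a *: x = y).
  by have [h|//] := dich a; case: nex; exists a.
have Hinj a y : D y = a *: y -> y = 0 by apply: (dich a).1.
pose r a := projT1 (cid ((dich a).2 x0)).
have rP a : D (r a) - a *: r a = x0 by apply: (projT2 (cid ((dich a).2 x0))).
pose A n (a : C) := exists c : nat -> C, r a = \sum_(i < n) c i *: S i.
suff [a nA] : exists a, forall n, ~ A n a.
  by have [n [c e]] := span (r a); apply: (nA n); exists c.
apply: complex_uncountable => n s us sA; rewrite leqNgt; apply/negP => ns.
have ain (i : 'I_n.+1) : s`_i \in s by rewrite mem_nth // (leq_trans _ ns).
pose c (i : 'I_n.+1) := projT1 (cid (sA _ (ain i))).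
have cP (i : 'I_n.+1) : r s`_i = \sum_(j < n) c i j *: S j by apply: (projT2 (cid (sA _ (ain i)))).
pose Mx : 'M[C]_(n.+1, n) := \matrix_(i, j) c i j.
have : kermx Mx != 0.
  by rewrite kermx_eq0 /row_free neq_ltn ltnS rank_leq_col.
move=> /rowV0Pn[k /sub_kermxP kM k0].
have rel0 : \sum_(i < n.+1) k 0 i *: r s`_i = 0.
  under eq_bigr do rewrite cP scaler_sumr.
  rewrite exchange_big big1 //= => j _.
  under eq_bigr do rewrite scalerA.
  rewrite -scaler_suml (_ : \sum_(i < n.+1) _ = (k *m Mx) 0 j); first by rewrite kM mxE scale0r.
  by rewrite mxE; apply: eq_bigr => i _; rewrite mxE.
(* Clearing denominators: the product of all [D - s_j] turns the relation into [p(D) x0 = 0]. At a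
   node [s_i] with [k 0 i] nonzero only [P i] survives, so [p] is nonzero. *)
pose P (i : 'I_n.+1) : {poly C} := \prod_(j < n.+1 | j != i) ('X - (s`_j)%:P).
pose p := \sum_(i < n.+1) k 0 i *: P i.
have : pev p x0 = 0.
  have e : pev (\prod_(j < n.+1) ('X - (s`_j)%:P)) (\sum_(i < n.+1) k 0 i *: r s`_i) = pev p x0.
    rewrite (lin_sum (pev_linx _)) /p (lin_sum (pev_linp _)); apply: eq_bigr => i _.
    by rewrite (lin_Z (pev_linx _)) (lin_Z (pev_linp _)) (bigD1 i) //= pevXsubC rP.
  by rewrite -e rel0 (lin_0 (pev_linx _)).
move/(pev_eq0 Hinj) => h; apply: x0N; apply: h.
have /existsP[i ki] : [exists i, k 0 i != 0].
  apply: contraR k0 => /existsPn h; apply/eqP/rowP => i; rewrite mxE.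
  by have := h i; rewrite negbK => /eqP.
apply/eqP => /(congr1 (fun q => q.[s`_i])); rewrite horner0 /p horner_sum (bigD1 i) //= big1 =>
  [|j ji].
  rewrite addr0 hornerZ => /eqP; rewrite mulf_eq0 (negbTE ki) /P horner_prod => /prodf_eq0[j ji].
  rewrite hornerXsubC subr_eq0; rewrite nth_uniq ?(leq_trans _ ns) //.
  by rewrite eq_sym => /eqP e; move: ji; rewrite -val_eqE /= e eqxx.
rewrite hornerZ /P horner_prod (bigD1 i) 1?eq_sym //= hornerXsubC subrr mul0r mulr0 //.
Qed.

End Dixmier.

Section Regroup.
Variables (R : realType) (I : eqType) (U : lmodType R[i]) (G : I -> U -> Prop).
Hypothesis HG : is_direct_grading G.
Local Notation C := (R[i]).

Lemma regroup (N : U -> Prop) (t : seq (I * U)) : is_subspace N ->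
  (forall q, q \in t -> G q.1 q.2 /\ N q.2) ->
  exists s : seq (I * U), uniq (map fst s) /\ (forall q, q \in s -> G q.1 q.2 /\ N q.2) /\
    \sum_(q <- t) q.2 = \sum_(q <- s) q.2.
Proof.
move=> [N0 NL] tP.
exists [seq (i, \sum_(q <- t | q.1 == i) q.2) | i <- undup (map fst t)].
split; first by rewrite -map_comp map_id_in ?undup_uniq.
split; last by rewrite big_map sum_by_index.
move=> q /mapP[i _ ->] /=; rewrite big_seq_cond; split.
  by apply: (hom_sum HG) => p /andP[/tP[pG _] /eqP <-].
apply: big_ind => // [x y Nx Ny|p /andP[/tP[]] //].
by rewrite -[x]scale1r; apply: NL.
Qed.

(* Eliminates one degree at a time by applying [deg - d k]. *)
Lemma graded_components (d : I -> C) (N : U -> Prop) (s : seq (I * U)) : is_subspace N ->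
  injective d -> (forall x, N x -> N (lext HG (fun i y => d i *: y) x)) ->
  uniq (map fst s) -> (forall q, q \in s -> G q.1 q.2) ->
  N (\sum_(q <- s) q.2) -> forall q, q \in s -> N q.2.
Proof.
move=> [N0 NL] dinj Nd.
have NZ a x : N x -> N (a *: x) by move=> Nx; rewrite -[_ *: _]addr0; apply: NL.
have ND x y : N x -> N y -> N (x + y) by move=> Nx Ny; rewrite -[x]scale1r; apply: NL.
have [n] := ubnP (size s); elim: n s => // n IH [//|[k x] s] sn /andP[ks us] sG.
rewrite big_cons /= => Nxs.
have sG' q : q \in s -> G q.1 q.2 by move=> qs; apply: sG; rewrite inE qs orbT.
have xG : G k x by apply: (sG (k, x)); rewrite inE eqxx.
pose t := [seq (q.1, (d q.1 - d k) *: q.2) | q <- s].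
have Nt : N (\sum_(q <- t) q.2).
  have dL i (a : C) (y z : U) : d i *: (a *: y + z) = a *: (d i *: y) + d i *: z by
    apply: scalerLin.
  have := Nd _ Nxs; rewrite (lin_D (lext_lin HG dL)) (lext_hom HG dL xG) (lext_sum HG dL sG') => h.
  have := ND _ _ (NZ (- d k) _ Nxs) h; congr N.
  rewrite scalerDr !scaleNr addrACA addNr add0r big_map scaler_sumr -sumrN -big_split /=.
  by apply: eq_bigr => q _; rewrite addrC -scalerBl.
have Ns q : q \in s -> N q.2.
  move=> qs; have := IH t _ _ _ Nt (q.1, (d q.1 - d k) *: q.2).
  rewrite size_map -map_comp (eq_map (g := fst)) // => /(_ _ us) H.
  have : N ((d q.1 - d k) *: q.2).
    apply: H; [by []| |exact: map_f].
    by move=> r /mapP[q' /sG' q'G ->] /=; apply: (homZ HG).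
  move/(NZ (d q.1 - d k)^-1); rewrite scalerA mulVf ?scale1r //.
  by rewrite subr_eq0; apply: contraNneq ks => /dinj <-; apply: (map_f fst qs).
move=> q; rewrite inE => /orP[/eqP ->|/Ns //] /=.
have -> : x = x + \sum_(q <- s) q.2 + (-1) *: \sum_(q <- s) q.2.
  by rewrite scaleN1r addrK.
by apply: (ND) => //; apply: NZ; rewrite big_seq; apply: big_ind => // y z; apply: ND.
Qed.

End Regroup.

(** * Submodules of an irreducible admissible module *)

Section Irreducible.
Variables (R : realType) (V : lmodType R[i]) (Y : V -> int -> V -> V) (vac om : V)
  (wt : int -> V -> Prop) (g : V -> V) (T : nat).
Hypothesis HV : is_VOA Y vac om wt.
Hypothesis HA : is_VOA_aut Y om g.
Hypothesis HT : has_order g T.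
Variables (M : lmodType R[i]) (YM : V -> int -> M -> M) (gr : nat -> M -> Prop).
Hypothesis HM : is_irr_admissible Y vac wt g T YM gr.
Local Notation C := (R[i]).

Let T0 : (0 < T)%N. Proof. exact: T_gt0 HT. Qed.
Let wk : is_weak_twisted Y vac g T YM. Proof. by case: HM => [[]]. Qed.
Let HG : is_direct_grading gr. Proof. by case: HM => [[_ []]]. Qed.
Let adm : forall (d : int) v (j : int) (k : nat) x, wt d v -> gr k x ->
      grZ gr (k%:Z + T%:Z * d - j - T%:Z) (YM v j x).
Proof. by case: HM => [[_ []]]. Qed.
Let irr : forall N : M -> Prop, is_graded_submodule YM gr N ->
      (forall x, N x -> x = 0) \/ (forall x, N x).
Proof. by case: HM => _ []. Qed.
Let L : linV YM. Proof. by case: wk. Qed.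
Let LX : forall u k (a : C) x y, YM u k (a *: x + y) = a *: YM u k x + YM u k y.
Proof. by case: wk => _ []. Qed.
Let Lv k x := fun a u u' => L a u u' k x.

Lemma grZ_hom e x : grZ gr e x -> exists k : nat, gr k x.
Proof. by case: e => [k|k] /= h; [exists k|exists 0%N; rewrite h; apply: (hom0 HG)]. Qed.

(** Since [om_0 v = v_(-2) 1], this is the case [i = 1] of [star_vac]. *)
Lemma YM_deriv v b x : YM (Y om 0 v) (b + T%:Z) x =
  - ((b + T%:Z)%:~R / T%:R : C) *: YM v b x.
Proof.
have -> : Y om 0 v = Y v (- 1 - 1%:Z) vac.
  have := Yderiv HV v (-1) vac; rewrite (Ycreat1 HV) => ->.
  by rewrite mulrN1z scaleN1r opprK.
apply: (homog_ind HV HA HT (P := fun v => YM (Y v (- 1 - 1%:Z) vac) (b + T%:Z) x =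
  - ((b + T%:Z)%:~R / T%:R : C) *: YM v b x)) v.
- by rewrite (Y0l HV) !(lin_0 (Lv _ _)) scaler0.
- by move=> u u' h h'; rewrite (lin_D (YlinL HV _ _)) !(lin_D (Lv _ _)) h h' scalerDr.
move=> p r v rT ev _.
have [K hK] := star_of_twisted HA HT (rel_toW T HV L) wk vac rT ev.
have vc : forall k x, YM vac k x = if k == - T%:Z then x else 0 by case: wk => _ [_ [_ []]].
rewrite (star_vac T0 LX vc (hK x)) mulr1 addrK bincS binc0 expr1 subr0 divr1 mul1r mulN1r.
by [].
Qed.

(** The twisted Jacobi identity for [om], which is fixed by [g], at [l = 0] and [a = T]: the weights
    [C(1, i)] leave only [om_0 v] and [om_1 v = p v]. *)
Lemma L0M_comm p v b x : wt p v ->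
  YM om T%:Z (YM v b x) = YM v b (YM om T%:Z x) + (p%:~R - b%:~R / T%:R - 1 : C) *: YM v b x.
Proof.
move=> vp; have [_ [_ [_ [_ [_ J]]]]] := wk.
have eom : eigsp g T 0 om by rewrite /eigsp (g_om HA) scale1r.
have TT : (T%:Z %% T%:Z)%Z = 0%:Z by rewrite modzz.
have := J 0%N om v x 0 T%:Z b T0 eom TT.
move=> /(@nsum_eq_fsum _ _ _ 2); rewrite (@fsum1 _ _ (fun i => (_ * binz R 0 i) *: _) 0%N);
  last first.
  by case=> // i _; rewrite binz_int mulr0 scale0r.
have b1 : (T%:~R / T%:R : C) = 1%:R by rewrite divff // Tneq0.
rewrite b1 (@fsum_nat _ _ 2); last first.
  by move=> i hi; rewrite binc_nat bin_small // scale0r.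
move=> /(_ _ _)/esym e; have {}e := e _ _.
have {e} : YM om T%:Z (YM v b x) - YM v b (YM om T%:Z x) =
   (p%:~R - b%:~R / T%:R - 1 : C) *: YM v b x.
  transitivity (\sum_(i < 2) binc (1%:R : C) i *: YM (Y om (0 + i%:Z) v) (T%:Z
    + b - T%:Z * i%:Z) x); last first.
    rewrite big_ord_recl big_ord_recl big_ord0 addr0 binc0 scale1r binc_nat /= bump0 bin1 scale1r.
    have -> : T%:Z + b - T%:Z * 0%:Z = b + T%:Z by lia.
    have -> : T%:Z + b - T%:Z * 1%:Z = b by lia.
    have -> : Y om (0 + 1%:Z) v = p%:~R *: v by apply: (L0_wt HV vp).
    rewrite addr0 YM_deriv (lin_Z (Lv _ _)) -scalerDl; congr (_ *: _).
    by rewrite rmorphD /=; field; exact: Tneq0.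
  rewrite -e.
  - rewrite /binz binc0 mulr1 scale1r expr0z scale1r.
    by congr (YM _ _ (YM _ _ _) - YM _ _ (YM _ _ _)); lia.
  - by move=> i hi; rewrite binc_nat bin_small // scale0r.
  - by case=> // i _; rewrite binz_int mulr0 scale0r.
by move=> /eqP; rewrite subr_eq addrC => /eqP.
Qed.

Definition degd (k : nat) : C := k%:R / T%:R.
Let dL i (a : C) (x y : M) : degd i *: (a *: x + y) = a *: (degd i *: x) + degd i *: y.
Proof. exact: scalerLin. Qed.
Definition deg (x : M) : M := lext HG (fun k y => degd k *: y) x.
(* [L(0) - deg], which commutes with all modes. *)
Definition DD (x : M) : M := YM om T%:Z x - deg x.

Lemma DD_lin a x y : DD (a *: x + y) = a *: DD x + DD y.
Proof. by rewrite /DD LX /deg (lext_lin HG dL) scalerBr opprD addrACA. Qed.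

Lemma DD_gr k x : gr k x -> gr k (DD x).
Proof.
move=> xk; apply: (homD HG).
  have := adm T%:Z (wt_om HV) xk.
  by have -> : k%:Z + T%:Z * 2 - T%:Z - T%:Z = k%:Z by lia.
rewrite /deg (lext_hom HG dL xk) -scaleN1r; do 2!apply: (homZ HG); exact: xk.
Qed.

Lemma DD_comm v b x : DD (YM v b x) = YM v b (DD x).
Proof.
apply: (wt_ind HV (P := fun v => DD (YM v b x) = YM v b (DD x))) v.
- by rewrite !(lin_0 (Lv _ _)) (lin_0 DD_lin).
- by move=> u u' h h'; rewrite !(lin_D (Lv _ _)) (lin_D DD_lin) h h'.
move=> p v vp; apply: (hom_ind HG (P := fun x => DD (YM v b x) = YM v b (DD x))) x.
- by rewrite (lin_0 (LX _ _)) (lin_0 DD_lin) (lin_0 (LX _ _)).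
- by move=> y z h h'; rewrite (lin_D (LX _ _)) !(lin_D DD_lin) (lin_D (LX _ _)) h h'.
move=> k x xk; rewrite /DD (L0M_comm _ _ vp) (lin_B (LX _ _)) -addrA; congr (_ + _).
rewrite /deg (lext_hom HG dL xk) (lin_Z (LX _ _)).
have := adm b vp xk; case E : (_ - T%:Z) => [m|m] /= h; last first.
  by rewrite h (lin_0 (lext_lin HG dL)) !scaler0 subrr oppr0.
rewrite (lext_hom HG dL h) -scalerBl -scaleNr; congr (_ *: _); rewrite /degd.
have -> : (m%:R : C) = (k%:Z + T%:Z * p - b - T%:Z)%:~R by rewrite E.
by rewrite !rmorphB rmorphD rmorphM /=; field; exact: Tneq0.
Qed.

Let Da (a : C) x := DD x - a *: x.
Let Da_lin a b x y : Da a (b *: x + y) = b *: Da a x + Da a y.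
Proof. have gen (p q r s : M) : (b *: p + q) - (b *: r + s) = b *: (p - r) + (q - s).
  by rewrite scalerBr opprD addrACA.
by rewrite /Da DD_lin (scalerLin a) gen. Qed.
Let Da_gr a k x : gr k x -> gr k (Da a x).
Proof. by move=> h; apply: (homD HG); [exact: DD_gr|rewrite -scaleNr; apply: (homZ HG)]. Qed.
Let Da_comm a v b x : Da a (YM v b x) = YM v b (Da a x).
Proof. by rewrite /Da DD_comm (lin_B (LX v b) (DD x) (a *: x)) (lin_Z (LX _ _)). Qed.

(** Schur's lemma: [DD - a] preserves degrees and commutes with all modes, so its kernel and image
    are graded submodules. *)
Lemma DD_dichotomy a : (forall x, DD x = a *: x) \/
    ((forall x, DD x = a *: x -> x = 0) /\ (forall y, exists x, DD x - a *: x = y)).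
Proof.
have kerS : is_graded_submodule YM gr (fun x => Da a x = 0).
  split; first split.
  - split; first exact: lin_0 (Da_lin a).
    by move=> b x y hx hy; rewrite Da_lin hx hy scaler0 addr0.
  - by move=> v k x hx; rewrite Da_comm hx (lin_0 (LX _ _)).
  move=> x hx; have [us sG ex] := homdecP HG x; exists (homdec HG x); split=> //; split=> // q qs.
  split; first exact: sG.
  have := HG.2.2 [seq (r.1, Da a r.2) | r <- homdec HG x] _ _ _ (q.1, Da a q.2) (map_f _ qs).
  apply.
  - by rewrite -map_comp (eq_map (g := fst)).
  - by move=> r /mapP[r' /sG r'G ->] /=; apply: Da_gr.
  - by rewrite big_map /= -(lin_sum (Da_lin a)) -ex.
have imS : is_graded_submodule YM gr (fun y => exists x, Da a x = y).
  split; first split.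
  - split; first by exists 0; exact: lin_0 (Da_lin a).
    by move=> b x y [x' <-] [y' <-]; exists (b *: x' + y'); rewrite Da_lin.
  - by move=> v k x [x' <-]; exists (YM v k x'); rewrite Da_comm.
  move=> y [x <-]; have [us sG ex] := homdecP HG x.
  exists [seq (r.1, Da a r.2) | r <- homdec HG x]; split.
    by rewrite -map_comp (eq_map (g := fst)).
  split; last by rewrite big_map /= -(lin_sum (Da_lin a)) -ex.
  by move=> r /mapP[r' /sG r'G ->] /=; split; [apply: Da_gr|exists r'.2].
have [k0|k1] := irr kerS; last first.
  by left=> x; apply/eqP; rewrite -subr_eq0; apply/eqP; apply: k1.
have [i0|i1] := irr imS.
  by left=> x; apply/eqP; rewrite -subr_eq0; apply/eqP; apply: i0; exists x.
by right; split=> // x hx; apply: k0; rewrite /Da hx subrr.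
Qed.

Section CountableSpan.
Variable x0 : M.
Hypotheses (x0gr : gr 0%N x0) (x0N : x0 <> 0).

Let bas (n : int) : seq V := projT1 (cid (wt_findim HV n)).
Let basP n : (forall x, x \in bas n -> wt n x) /\
    forall v, wt n v -> exists c : nat -> C, v = \sum_(i < size (bas n)) c i *: (bas n)`_i.
Proof. exact: (projT2 (cid (wt_findim HV n))). Qed.

Let word_act (w : seq (int * nat * int)) : M :=
  foldr (fun t x => YM ((bas t.1.1)`_t.1.2) t.2 x) x0 w.
Let S m : M := if (unpickle m : option (seq (int * nat * int))) is Some w then word_act w else 0.

Let bas_wt n j : wt n (bas n)`_j.
Proof.
have [h|h] := ltnP j (size (bas n)); last by rewrite nth_default //; apply: (wt0 HV).
by apply: (basP n).1; apply: mem_nth.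
Qed.

Let S_hom m : exists k : nat, gr k (S m).
Proof.
rewrite /S; case: (unpickle m) => [w|]; last by exists 0%N; apply: (hom0 HG).
elim: w => [|t w [k hk]] /=; first by exists 0%N.
exact: grZ_hom (adm t.2 (bas_wt _ _) hk).
Qed.

Let spanned x := exists n (c : nat -> C), x = \sum_(j < n) c j *: S j.

Let spanned_sub : is_subspace spanned.
Proof.
split; first by exists 0%N, (fun=> 0); rewrite big_ord0.
move=> a x y [n [c ->]] [n' [c' ->]].
pose ext k (d : nat -> C) j := if (j < k)%N then d j else 0.
have extE k (d : nat -> C) : (k <= n + n')%N -> \sum_(j < k) d j *: S j = \sum_(j < n
  + n') ext k d j *: S j.
  move=> kn; rewrite (big_ord_widen _ (fun j => d j *: S j) kn) big_mkcond /=.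
  by apply: eq_bigr => j _; rewrite /ext; case: ifP => //; rewrite scale0r.
exists (n + n')%N, (fun j => a * ext n c j + ext n' c' j).
rewrite (extE n) ?leq_addr // (extE n') ?leq_addl // scaler_sumr -big_split /=.
by apply: eq_bigr => j _; rewrite scalerDl scalerA.
Qed.

Let spannedD x y : spanned x -> spanned y -> spanned (x + y).
Proof. by move=> hx hy; rewrite -[x]scale1r; apply: spanned_sub.2. Qed.
Let spannedZ a x : spanned x -> spanned (a *: x).
Proof. by move=> hx; rewrite -[_ *: _]addr0; apply: spanned_sub.2 => //; apply: spanned_sub.1. Qed.
Let spannedS m : spanned (S m).
Proof.
exists m.+1, (fun j => (j == m)%:R); rewrite big_ord_recr /= eqxx scale1r big1 ?add0r // => j _.
by rewrite (ltn_eqF (ltn_ord j)) scale0r.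
Qed.
Let spanned_sum (J : Type) (r : seq J) (P : pred J) (F : J -> M) :
  (forall j, P j -> spanned (F j)) -> spanned (\sum_(j <- r | P j) F j).
Proof. by move=> h; apply: (big_ind spanned) => //; case: spanned_sub. Qed.

(** Finite words in modes of basis vectors of the weight spaces are countable. Applied to the
    homogeneous [x0] they give homogeneous vectors, whose span is a nonzero graded submodule. *)
Lemma countably_spanned : exists S : nat -> M,
  forall x, exists n (c : nat -> C), x = \sum_(j < n) c j *: S j.
Proof.
exists S; suff gs : is_graded_submodule YM gr spanned.
  have [h|//] := irr gs; case: x0N; apply: h.
  have -> : x0 = S (pickle ([::] : seq (int * nat * int))) by rewrite /S pickleK.
  exact: spannedS.
split.
  split=> // v k x [n [c ->]]; rewrite (lin_sum (LX _ _)); apply: spanned_sum => j _.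
  rewrite (lin_Z (LX _ _)); apply: spannedZ.
  apply: (wt_ind HV (P := fun v => spanned (YM v k (S j)))) v.
  - by rewrite (lin_0 (Lv _ _)); case: spanned_sub.
  - by move=> u u' h h'; rewrite (lin_D (Lv _ _)); apply: spannedD.
  move=> p v vp; have [d ->] := (basP p).2 v vp.
  rewrite (lin_sum (Lv _ _)); apply: spanned_sum => l _; rewrite (lin_Z (Lv _ _)); apply: spannedZ.
  rewrite /S; case E : (unpickle (j : nat)) => [w|]; last by rewrite (lin_0 (LX _ _));
    case: spanned_sub.
  have -> : YM (bas p)`_l k (word_act w) = S (pickle ((p, l : nat, k) :: w)) by rewrite /S pickleK.
  exact: spannedS.
move=> x [n [c ->]].
pose dg m := projT1 (cid (S_hom m)).
have dgP m : gr (dg m) (S m) by apply: (projT2 (cid (S_hom m))).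
have := @regroup _ _ _ _ HG spanned [seq (dg j, c j *: S j) | j <- iota 0 n] spanned_sub.
case=> [q /mapP[j _ ->] /=|s [us [sP es]]].
  by split; [apply: (homZ HG)|apply: spannedZ].
exists s; split=> //; split=> //; rewrite -es big_map /=.
by rewrite -(big_mkord predT (fun j => c j *: S j)) /index_iota subn0.
Qed.

End CountableSpan.

Lemma DD_scalar : exists a : C, forall x, DD x = a *: x.
Proof.
have [_ [[x0 [x0g x0N]] _]] := HM.
have [S hS] := countably_spanned x0g x0N.
exact: (dixmier DD_lin x0N hS DD_dichotomy).
Qed.

(** As [DD] is a scalar, [deg] is [L(0)] minus a scalar and preserves [N]; since the degrees are
    distinct complex numbers, [N] contains the components of its elements. *)
Lemma irr_submodule N : is_submodule YM N -> (forall x, N x -> x = 0) \/ (forall x, N x).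
Proof.
move=> [sN hN]; apply: irr; split=> // x Nx.
have [us sG ex] := homdecP HG x; exists (homdec HG x); split=> //; split=> // q qs.
split; first exact: sG.
have [a Da_] := DD_scalar.
have Nd y : N y -> N (deg y).
  move=> Ny; have -> : deg y = (- a) *: y + YM om T%:Z y.
    by rewrite scaleNr -Da_ /DD opprB subrK.
  by apply: sN.2 => //; apply: hN.
apply: (@graded_components _ _ _ _ HG degd N (homdec HG x)) => //.
  move=> k l /(mulIf _) e; apply/eqP; rewrite -(eqr_nat C); apply/eqP; apply: e.
  by rewrite invr_eq0 Tneq0.
by rewrite -ex.
Qed.

End Irreducible.

(** * Gradings and the bijection *)

Section Gradings.
Variables (R : realType) (V : lmodType R[i]) (Y : V -> int -> V -> V) (vac om : V)
  (wt : int -> V -> Prop) (T : nat).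
Hypothesis HV : is_VOA Y vac om wt.
Variables (M : lmodType R[i]) (YM YW : V -> int -> M -> M) (gr : nat -> M -> Prop).
Hypothesis rl : rel T HV YM YW.
Hypothesis HG : is_direct_grading gr.

Lemma grZ_D e x y : grZ gr e x -> grZ gr e y -> grZ gr e (x + y).
Proof. by case: e => k /=; [apply: (homD HG)|move=> -> ->; rewrite addr0]. Qed.

Lemma grZ_0 e : grZ gr e 0.
Proof. by case: e => k //=; apply: (hom0 HG). Qed.

Lemma rel_grading :
  (forall (d : int) v (j : int) (k : nat) x, wt d v -> gr k x ->
      grZ gr (k%:Z + T%:Z * d - j - T%:Z) (YM v j x)) <->
  (forall v (j : int) (k : nat) x, gr k x -> grZ gr (k%:Z - j - T%:Z) (YW v j x)).
Proof.
have [_ _ e] := rl; split=> h.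
  move=> v j k x xk; apply: (rel_W_ind rl (P := fun f => grZ gr (k%:Z - j - T%:Z) (f x))).
  - exact: grZ_0.
  - by move=> f f'; apply: grZ_D.
  move=> p {}v vp; have := h p v (j + T%:Z * p) k x vp xk.
  by congr (grZ _ _ _); lia.
move=> d v j k x vd xk; have := h (PSI HV v) (j - T%:Z * d) k x xk.
by rewrite (e d) // subrK; congr (grZ _ _ _); lia.
Qed.

End Gradings.

Theorem theorem8p12 (R : realType) (V : lmodType R[i])
  (Y : V -> int -> V -> V) (vac om : V) (wt : int -> V -> Prop)
  (g : V -> V) (T : nat) :
  is_VOA Y vac om wt -> is_VOA_aut Y om g -> has_order g T ->
  exists F : gmod R V -> gmod R V,
    (forall M, is_irr_admissible Y vac wt g T (@gm_Y R V M) (@gm_gr R V M) ->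
       is_irr_graded_phi Y vac g T (@gm_Y R V (F M)) (@gm_gr R V (F M))) /\
    (forall M M',
       is_irr_admissible Y vac wt g T (@gm_Y R V M) (@gm_gr R V M) ->
       is_irr_admissible Y vac wt g T (@gm_Y R V M') (@gm_gr R V M') ->
       (gmod_isom M M' <-> gmod_isom (F M) (F M'))) /\
    (forall W, is_irr_graded_phi Y vac g T (@gm_Y R V W) (@gm_gr R V W) ->
       exists M, is_irr_admissible Y vac wt g T (@gm_Y R V M) (@gm_gr R V M) /\
                 gmod_isom (F M) W).
Proof.
move=> HV HA HT.
pose F (M : gmod R V) : gmod R V := GMod (toW T HV (@gm_Y R V M)) (@gm_gr R V M).
have adm_rel (M : gmod R V) : is_irr_admissible Y vac wt g T (@gm_Y R V M) (@gm_gr R V M) ->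
    rel T HV (@gm_Y R V M) (@gm_Y R V (F M)).
  by case=> [[[l _] _] _]; apply: rel_toW.
exists F; split; last split.
- move=> M HM; have rl := adm_rel M HM.
  have [[wk [HG ad]] [[x0 [x0g x0N]] _]] := HM.
  split; last first.
    split; first by exists x0.
    by move=> N /(rel_submodule N rl) /(irr_submodule HV HA HT HM).
  split; first exact: (phi_of_twisted HA HT rl wk).
  split=> //; split; first exact: ((rel_grading rl HG).1 ad).
  by move=> _; exists x0.
- move=> M M' HM HM'; exact: rel_isom (adm_rel M HM) (adm_rel M' HM').
move=> W [[ph [HG [ad W0]]] [Wne irrW]].
have lW : linV (@gm_Y R V W) by case: ph.
have rl := rel_toM T HV lW.
exists (GMod (toM T HV (@gm_Y R V W)) (@gm_gr R V W)); split.
  split; last split.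
  - split; first exact: (twisted_of_phi HA HT rl ph).
    split=> //; exact: ((rel_grading rl HG).2 ad).
  - exact: W0.
  (* A graded submodule is in particular a submodule, so irreducibility of [W] applies to it. *)
  by move=> N [/(rel_submodule N rl) hN _]; apply: irrW.
(* Space and grading are unchanged, and [toW] applied to [toM] returns the vertex operators of [W],
   so the identity is an isomorphism. *)
exists id; split=> //; split; first by exists id.
move=> v k x; have lM : linV (toM T HV (@gm_Y R V W)) by case: rl.
exact: (rel_fun (rel_toW T HV lM) rl).
Qed.
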